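(* Let $E\subset\mathbb{T}$ be a $K$-set, and let $s$ be a nonnegative real number. Let $T$ be an invertible bounded operator on a Banach space whose spectrum is included in $E$ and which satisfies $$\|T^{n}\| = O(n^{s}),\quad n\to+\infty,$$ and $$\|T^{-n}\| = O\big(e^{n^{\beta}}\big),\quad n\to+\infty,\quad\text{for some real } \beta<\frac{\delta(E)}{1+\delta(E)}.$$ Then, for every $\varepsilon>0$, $$\|T^{-n}\| = O\big(n^{s+\frac12+\varepsilon}\big),\quad n\to+\infty.$$
   Context: $\mathbb{T}$ denotes the unit circle in $\mathbb{C}$. For $z\in\mathbb{T}$ and a closed set $E\subset\mathbb{T}$, $d(z,E)$ denotes the distance between $z$ and $E$. For an arc $L$ of $\mathbb{T}$, $|L|$ denotes its length. A closed subset $E$ of $\mathbb{T}$ is called a $K$-set if there exists a constant $c>0$ such that for every arc $L$ of $\mathbb{T}$, $$\sup_{z\in L} d(z,E)\ \ge\ c\,|L|.$$ For a $K$-set $E$, set $$\delta(E)=\sup\Big\{\delta\ge 0:\ \int_0^{2\pi}\frac{1}{d(e^{it},E)^{\delta}}\,dt<+\infty\Big\}.$$ *)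

(* Defs.v *)
From HB Require Import structures.
From mathcomp Require Export all_boot all_order all_algebra.
From mathcomp Require Export complex.
From mathcomp Require Export all_classical all_reals all_analysis.

Set Implicit Arguments.
Unset Strict Implicit.
Unset Printing Implicit Defensive.

Export Order.TTheory GRing.Theory Num.Theory.
Export numFieldNormedType.Exports.

Local Open Scope classical_set_scope.
Local Open Scope ring_scope.
Local Open Scope complex_scope.

Section KSet.
Variable R : realType.
Implicit Types (z : R[i]) (E : set R[i]).

Definition expi (t : R) : R[i] := cos t +i* sin t.

Definition circle : set R[i] := [set z | `|z| = 1].

(* [inf set0 = 0], so the empty set is not a K-set below. *)
Definition dist z E : R := inf [set complex.Re `|z - w| | w in E].

(* When a <= b <= a + 2 * pi, [arc a b] is an arc of length b - a (the whole
   circle if b = a + 2 * pi). *)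
Definition arc (a b : R) : set R[i] := expi @` `[a, b].

(* Closed arcs suffice: [dist ^~ E] is continuous, so its supremum over an arc
   does not depend on whether the endpoints are included. *)
Definition Kset E : Prop :=
  [/\ closed (E : set (R[i] : numFieldType)), E `<=` circle &
      exists2 c : R, 0 < c & forall a b : R, a <= b -> b <= a + 2 * pi ->
        c * (b - a) <= sup [set dist z E | z in arc a b]].

(* The inverse is that of \bar R, so that the integrand is +oo on E as soon as
   d > 0.  If E is a K-set, this set contains 0 and is bounded above by 1. *)
Definition deltaE E : R :=
  sup [set d : R | 0 <= d /\
    (\int[lebesgue_measure]_(t in `[0%R, (2 * pi)%R])
       ((dist (expi t) E `^ d)%:E)^-1 < +oo)%E].

End KSet.

Section Operators.
Variables (R : realType) (X : completeNormedModType R[i]).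

Definition bounded_op (A : X -> X) : Prop :=
  exists M : R, forall x, `|A x| <= M%:C * `|x|.

(* Norms in X are elements of R[i] with zero imaginary part. *)
Definition opnorm (A : X -> X) : R :=
  sup [set complex.Re `|A x| | x in [set x : X | `|x| <= 1]].

Definition inverse_op (A B : X -> X) : Prop :=
  [/\ bounded_op B, cancel A B & cancel B A].

Definition spectrum (A : X -> X) : set R[i] :=
  [set l | ~ exists B : {linear X -> X}, inverse_op (fun x => A x - l *: x) B].

End Operators.

(* Main.v *)
(** Fix r = 1/N and a finite set Z of points of the circle such that every point of
    E is O(r)-close to Z.  The product f over w in Z of ((1+r-u)/(1+2r-u))^m, u = z conj(w),
    with m of order N^gam, is bounded slightly beyond the unit disc and exponentially
    small in m near E.  If Z is so thin that 1/f is bounded on |z| = 1 - 1/n, then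
    the truncation P of 1/f at order n has bounded coefficients and
    f P = 1 + X^n H, whence T^-n = f(T) P(T) T^-n - H(T).  Parseval's identity and
    AM-GM bound H(T) by a multiple of N^(s+1/2).  Since the spectrum of T lies in E,
    f(T) is so small that the first term is absorbed: a partition of unity into
    trigonometric polynomials, the analogue of Gevrey functions of an order adapted
    to |T^-k| <= exp(k^beta), splits f(T) into a piece away from E, killed by the
    invertibility of T - l for l outside E, and a piece near E where f is tiny.
    This requires beta/(1-beta) < gam and yields |T^-n| = O(N^(s+1/2)).

    The estimate is used twice.  Finiteness of the integral of d(., E)^-delta leaves
    O(N^(1-delta)) grid points near E; taking N = n^b with b large, T^-n grows at
    most polynomially.  So beta may be replaced by any positive number, and the
    small saving in the number of grid points provided by the K-set condition makes
    N of order n^(1+epsilon) admissible. *)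

Require Import Defs.
From mathcomp Require Import measurable_realfun ring lra zify.

Set Implicit Arguments.
Unset Strict Implicit.
Unset Printing Implicit Defensive.

Local Open Scope classical_set_scope.
Local Open Scope ring_scope.
Local Open Scope complex_scope.

(** * Real-valued norms and the unit circle *)

(** The obstacle: that [f] is small on E says nothing about f(T); only coefficients are controlled,
    through the norms of T^k and T^-k. Hence everything is discretised. A Laurent polynomial is
    judged by its values at the M-th roots of unity and by its coefficients farther than K < M/2
    from the centre ([fold_sum_le]). Cut-offs are discrete Fourier transforms of order 2K + 1, and K
    grows until the piece away from E is negligible.

    The condition beta/(1 - beta) < gam balances the two parts. A cut-off of width 1/N has
    coefficients of size about exp(-(k/N)^b) with b < 1 close to 1. This beats exp(k^beta) from k =
    N^kap on, kap slightly above 1/(1 - beta). Below that index T^-k costs at most exp(N^(kap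
    beta)), which the smallness q^m of f near E, with m of order N^gam, pays for when kap beta <
    gam. For gam close to delta the condition reads beta < delta/(1 + delta).

    The exponent 1/2 is the price of passing from l2 to l1: H has bounded l2 norm on the circle of
    radius 1 + 1/(2N), so that about N coefficients count. *)

Definition rnorm (R : realType) (V : normedZmodType R[i]) (x : V) : R :=
  complex.Re `|x|.

Section RealNorm.
Variable R : realType.
Implicit Types V : normedZmodType R[i].

Lemma rnormE V (x : V) : `|x| = (rnorm x)%:C.
Proof.
have := normr_ge0 x; rewrite /rnorm; case: `|x| => a b.
by rewrite lecE /= => /andP[/eqP -> _].
Qed.

Lemma realC_inj : injective (fun a : R => a%:C).
Proof. by move=> a b []. Qed.

Lemma rnorm_ge0 V (x : V) : 0 <= rnorm x.
Proof. by rewrite -lecR -rnormE normr_ge0. Qed.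

Lemma rnormD V (x y : V) : rnorm (x + y) <= rnorm x + rnorm y.
Proof. by rewrite -lecR rmorphD /= -!rnormE ler_normD. Qed.

Lemma rnorm0 V : rnorm (0 : V) = 0.
Proof. by rewrite /rnorm normr0. Qed.

Lemma rnormN V (x : V) : rnorm (- x) = rnorm x.
Proof. by rewrite /rnorm normrN. Qed.

Lemma rnormB V (x y : V) : rnorm (x - y) <= rnorm x + rnorm y.
Proof. by rewrite -(rnormN y) rnormD. Qed.

Lemma rnormBC V (x y : V) : rnorm (x - y) = rnorm (y - x).
Proof. by rewrite -rnormN opprB. Qed.

Lemma rnorm_sum V I (r : seq I) (P : pred I) (F : I -> V) :
  rnorm (\sum_(i <- r | P i) F i) <= \sum_(i <- r | P i) rnorm (F i).
Proof.
elim/big_rec2: _ => [|i y x _ h]; first by rewrite rnorm0.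
by apply: le_trans (rnormD _ _) _; rewrite lerD2l.
Qed.

Lemma rnorm_eq0 V (x : V) : (rnorm x == 0) = (x == 0).
Proof.
apply/eqP/eqP => [h|->]; last exact: rnorm0.
by apply/eqP; rewrite -normr_eq0 rnormE h.
Qed.

Lemma rnorm1 : rnorm (1 : R[i]) = 1.
Proof. by rewrite /rnorm normr1. Qed.

Lemma rnormM (x y : R[i]) : rnorm (x * y) = rnorm x * rnorm y.
Proof. by apply: realC_inj; rewrite rmorphM /= -!rnormE normrM. Qed.

Lemma rnormX (x : R[i]) n : rnorm (x ^+ n) = rnorm x ^+ n.
Proof. by elim: n => [|n ih]; rewrite ?expr0 ?rnorm1 // !exprS rnormM ih. Qed.

Lemma rnormV (x : R[i]) : rnorm x^-1 = (rnorm x)^-1.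
Proof. by apply: realC_inj; rewrite fmorphV /= -!rnormE normfV. Qed.

Lemma rnorm_prod I (r : seq I) (P : pred I) (F : I -> R[i]) :
  rnorm (\prod_(i <- r | P i) F i) = \prod_(i <- r | P i) rnorm (F i).
Proof. exact: (big_morph _ rnormM rnorm1). Qed.

Lemma rnormC (a : R) : rnorm a%:C = `|a|.
Proof.
apply: realC_inj; rewrite -rnormE normc_def /= expr0n /= addr0.
by rewrite sqrtr_sqr.
Qed.

Lemma rnormR (a : R) : 0 <= a -> rnorm a%:C = a.
Proof. by move=> a0; rewrite rnormC ger0_norm. Qed.

Lemma rnorm_nat n : rnorm (n%:R : R[i]) = n%:R.
Proof. by rewrite -(rmorph_nat (real_complex R)) rnormR. Qed.

Lemma rnorm_conj (x : R[i]) : rnorm x^*%C = rnorm x.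
Proof. by rewrite /rnorm normcJ. Qed.

Lemma sqr_rnorm (x : R[i]) : ((rnorm x) ^+ 2)%:C = x * x^*%C.
Proof. by rewrite rmorphXn /= -rnormE sqr_normc. Qed.

Lemma sqr_rnormE (x : R[i]) :
  (rnorm x) ^+ 2 = complex.Re x ^+ 2 + complex.Im x ^+ 2.
Proof. by apply: realC_inj; rewrite add_Re2_Im2 rnormE rmorphXn. Qed.

Lemma rnorm_ge_dist V (x y : V) : rnorm x - rnorm y <= rnorm (x - y).
Proof. by rewrite lerBlDr -{1}(subrK y x) rnormD. Qed.

End RealNorm.

Lemma rnormZ (R : realType) (V : normedModType R[i]) (a : R[i]) (x : V) :
  rnorm (a *: x) = rnorm a * rnorm x.
Proof. by apply: realC_inj; rewrite rmorphM /= -!rnormE normrZ. Qed.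

Section Circle.
Variable R : realType.
Local Notation C := R[i].
Local Notation expi := (@expi R).

Lemma expiD (a b : R) : expi (a + b) = expi a * expi b.
Proof. by rewrite /expi cosD sinD; simpc; rewrite [sin a * cos b + _]addrC. Qed.

Lemma expi0 : expi 0 = 1.
Proof. by rewrite /expi cos0 sin0. Qed.

Lemma expiMn (a : R) n : expi (a *+ n) = expi a ^+ n.
Proof. by elim: n => [|n ih]; rewrite ?expi0 // mulrS expiD ih exprS. Qed.

Lemma rnorm_expi (a : R) : rnorm (expi a) = 1.
Proof.
apply/eqP; rewrite -(@eqrXn2 _ 2) ?rnorm_ge0 // sqr_rnormE /= cos2Dsin2.
by rewrite expr1n.
Qed.

Lemma expi2pi : expi (2 * pi) = 1.
Proof. by rewrite /expi mulr_natl cos2pi sin2pi. Qed.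

Lemma conj_expi a : (expi a)^*%C = expi (- a).
Proof. by rewrite /expi cosN sinN. Qed.

Lemma expiN a : expi (- a) = (expi a)^-1.
Proof.
have h : expi a * expi (- a) = 1 by rewrite -expiD subrr expi0.
have e0 : expi a != 0 by rewrite -rnorm_eq0 rnorm_expi oner_neq0.
by apply: (mulfI e0); rewrite h divff.
Qed.

Lemma sqr_chord t : rnorm (expi t - 1) ^+ 2 = (2 * sin (t / 2)) ^+ 2.
Proof.
have e : t = t / 2 + t / 2 by rewrite -splitr.
rewrite sqr_rnormE /= {1 2}e cosD sinD.
have := cos2Dsin2 (t / 2); set c := cos _; set s := sin _ => h.
have -> : c * c = 1 - s * s by rewrite -!expr2 -h addrK.
rewrite subr0.
have -> : (s * c + c * s) ^+ 2 = 4 * s ^+ 2 * c ^+ 2 by ring.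
have -> : c ^+ 2 = 1 - s ^+ 2 by rewrite -h addrK.
by ring.
Qed.

Lemma chordE t : rnorm (expi t - 1) = `|2 * sin (t / 2)|.
Proof.
by apply/eqP; rewrite -(@eqrXn2 _ 2) ?rnorm_ge0 // sqr_chord real_normK ?num_real.
Qed.

Lemma sin_le (t : R) : 0 <= t -> sin t <= t.
Proof.
move=> t0.
have [|c _] := @MVT_segment R sin cos 0 t t0.
  by apply: continuous_subspaceT => x; exact: continuous_sin.
by rewrite sin0 !subr0 => ->; rewrite ler_piMl ?cos_le1.
Qed.

Lemma norm_sin_le (t : R) : `|sin t| <= `|t|.
Proof.
wlog t0 : t / 0 <= t => [h|].
  have [/h//|/ltW t0] := leP 0 t.
  by rewrite -normrN -sinN -(normrN t) h // oppr_ge0.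
rewrite (ger0_norm t0) ler_norml sin_le // andbT.
have [t1|t1] := leP 1 t; first by have := sin_geN1 t; lra.
have : 0 <= sin t; last lra.
by apply: sin_ge0_pi; have := pi_ge2 R; lra.
Qed.

Lemma chord_le t : rnorm (expi t - 1) <= `|t|.
Proof.
rewrite chordE normrM.
have := norm_sin_le (t / 2).
by rewrite (normrM t) normfV !(ger0_norm (ler0n R 2)); lra.
Qed.

Lemma expi_lip a b : rnorm (expi a - expi b) <= `|a - b|.
Proof.
have -> : expi a - expi b = expi b * (expi (a - b) - 1).
  by rewrite mulrBr -expiD mulr1 addrCA subrr addr0.
by rewrite rnormM rnorm_expi mul1r chord_le.
Qed.

(** With [c = cos (pi / 4)], [c ^+ 2 = 1 / 2]: at half the angle the cosine is at least [c], so the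
    mean value theorem gives [sin (t / 2) >= c * (t / 2)], and the doubling formula multiplies this
    by [2 * c]. *)
Lemma sin_ge_half (t : R) : 0 <= t <= pi / 2 -> t / 2 <= sin t.
Proof.
move=> /andP[t0 t1]; have pi2 := pi_ge2 R.
have e : t = t / 2 + t / 2 by rewrite -splitr.
set c := cos (pi / 4 : R).
have c0 : 0 < c by apply: cos_gt0_pihalf; lra.
have c2 : c ^+ 2 = 1 / 2.
  have : cos (pi / 2 : R) = 0 by exact: cos_pihalf.
  have -> : (pi / 2 : R) = (pi / 4) *+ 2 by rewrite mulr2n; field.
  rewrite cos_mulr2n -/c => h.
  have : c ^+ 2 *+ 2 = 1 by apply/eqP; rewrite -subr_eq0 h.
  by rewrite mulr2n; lra.
have cc (x : R) : 0 <= x <= pi / 4 -> c <= cos x.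
  move=> /andP[x0 x1].
  have [->//|ne] := eqVneq x (pi / 4).
  by apply/ltW; rewrite ltr_cos ?in_itv //=; lra.
have hs : c * (t / 2) <= sin (t / 2).
  have t20 : 0 <= t / 2 by lra.
  have [|d] := @MVT_segment R sin cos 0 (t / 2) t20.
    by apply: continuous_subspaceT => x; exact: continuous_sin.
  rewrite in_itv /= sin0 !subr0 => /andP[d0 d1] ->.
  by rewrite ler_wpM2r // cc //; lra.
have hc : c <= cos (t / 2) by apply: cc; lra.
rewrite {2}e sinD.
have : c * (t / 2) * c <= sin (t / 2) * cos (t / 2).
  by apply: ler_pM => //; [apply: mulr_ge0|]; lra.
have -> : c * (t / 2) * c = c ^+ 2 * (t / 2) by ring.
by rewrite c2; lra.
Qed.

Lemma chord_ge t : `|t| <= pi -> `|t| / 2 <= rnorm (expi t - 1).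
Proof.
wlog t0 : t / 0 <= t => [h|].
  have [/h//|/ltW t0 ht] := leP 0 t.
  have -> : rnorm (expi t - 1) = rnorm (expi (- t) - 1).
    by rewrite !chordE mulNr sinN mulrN normrN.
  by rewrite -(normrN t) h ?normrN // oppr_ge0.
rewrite ger0_norm // => ht; rewrite chordE.
apply: le_trans (ler_norm _).
have := @sin_ge_half (t / 2) ltac:(lra); lra.
Qed.

Lemma circle_expi (z : C) : rnorm z = 1 -> exists2 t, 0 <= t < 2 * pi & z = expi t.
Proof.
case: z => x y h.
have h2 : x ^+ 2 + y ^+ 2 = 1.
  by have := sqr_rnormE (x +i* y); rewrite h /= expr1n => <-.
have hx : -1 <= x <= 1.
  by rewrite -ler_norml -(@expr_le1 _ 2) // real_normK ?num_real // -h2 lerDl sqr_ge0.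
have a0 := acos_ge0 hx; have a1 := acos_lepi hx.
have cx : cos (acos x) = x by rewrite acosK // in_itv /=.
have hs : sin (acos x) = `|y|.
  by rewrite sin_acos // -h2 addrAC subrr add0r sqrtr_sqr.
have p0 := pi_gt0 R.
have [y0|y0] := leP 0 y.
  exists (acos x); first by lra.
  by rewrite /expi cx hs ger0_norm.
have am : 0 < acos x.
  rewrite lt_neqAle a0 andbT; apply/eqP => e.
  by move: hs; rewrite -e sin0 => /eqP; rewrite eq_sym normr_eq0 => /eqP; lra.
exists (2 * pi - acos x); first by lra.
rewrite expiD expi2pi mul1r -conj_expi /expi /= cx hs ltr0_norm //.
by rewrite opprK.
Qed.

End Circle.

(** * Real estimates *)

Section RealEstimates.
Variable R : realType.
Implicit Types (x y a c A : R) (n p k : nat).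

Lemma nat_above x : exists n : nat, x <= n%:R.
Proof.
exists (Num.truncn x).+1.
have [x0|x0] := leP 0 x; last by rewrite (le_trans (ltW x0)).
by have /andP[_ /ltW] := truncn_itv x0.
Qed.

Lemma nat_between x : 1 <= x -> exists n : nat, [/\ (0 < n)%N, n%:R <= x & x <= 2 * n%:R].
Proof.
move=> x1; have x0 : 0 <= x by lra.
exists (Num.truncn x); have /andP[h1 h2] := truncn_itv x0.
have n0 : (0 < Num.truncn x)%N by rewrite -ltnS -(ltr_nat R) (le_lt_trans x1).
split => //; apply: ltW; apply: lt_le_trans h2 _.
by rewrite -natrM ler_nat; lia.
Qed.

Lemma pow_le_exp y p : 0 <= y -> y ^+ p <= p%:R ^+ p * expR y.
Proof.
move=> y0; case: p => [|p]; first by rewrite !expr0 mul1r -expR0 ler_expR.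
have p0 : 0 < p.+1%:R :> R by rewrite ltr0n.
have -> : y = p.+1%:R * (y / p.+1%:R) by rewrite mulrC divfK // gt_eqF.
rewrite expRM_natl -exprMn; apply: lerXn2r; rewrite ?nnegrE.
- by rewrite !mulr_ge0 // ?invr_ge0 ltW.
- by rewrite mulr_ge0 ?expR_ge0 // ltW.
by rewrite ler_pM2l //; apply: le_trans (expR_ge1Dx _); rewrite lerDr.
Qed.

Lemma powR_le_1D y a p : 0 <= y -> 0 <= a -> a <= p%:R -> y `^ a <= 1 + y ^+ p.
Proof.
move=> y0 a0 ap; have [y1|y1] := leP y 1.
  have : y `^ a <= 1 `^ a by rewrite ge0_ler_powR // nnegrE.
  rewrite powR1.
  by have := exprn_ge0 p y0; lra.
have : y `^ a <= y `^ p%:R by rewrite ler_powR // ltW.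
by rewrite powR_mulrn //; lra.
Qed.

Lemma powR_le_exp a c : 0 <= a -> 0 < c ->
  exists2 C, 0 < C & forall y, 0 <= y -> y `^ a <= C * expR (c * y).
Proof.
move=> a0 c0; have [p hp] := nat_above a.
have d0 : 0 <= c^-1 ^+ p * p%:R ^+ p by rewrite mulr_ge0 ?exprn_ge0 // invr_ge0 ltW.
exists (1 + c^-1 ^+ p * p%:R ^+ p); first by lra.
move=> y y0; apply: le_trans (powR_le_1D y0 a0 hp) _.
rewrite mulrDl lerD //.
  by rewrite mul1r -expR0 ler_expR mulr_ge0 // ltW.
have -> : y = c^-1 * (c * y) by rewrite mulKf // gt_eqF.
rewrite exprMn -mulrA ler_pM2l ?exprn_gt0 ?invr_gt0 //.
by rewrite mulKf ?gt_eqF // pow_le_exp // mulr_ge0 // ltW.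
Qed.

Lemma powR_ltC (A c al be : R) : 0 <= A -> 0 < c -> 0 <= al -> al < be ->
  exists2 C, 0 <= C & forall x, 0 <= x -> A * x `^ al <= C + c * x `^ be.
Proof.
move=> A0 c0 al0 albe.
set x0 := (A / c) `^ (be - al)^-1.
exists (A * x0 `^ al); first by rewrite mulr_ge0 ?powR_ge0.
move=> x h; have [h1|h1] := leP x x0.
  apply: (@le_trans _ _ (A * x0 `^ al)).
    by rewrite ler_wpM2l // ge0_ler_powR // nnegrE ?powR_ge0.
  by rewrite lerDl mulr_ge0 ?powR_ge0 // ltW.
have xp : 0 < x by apply: le_lt_trans h1; rewrite powR_ge0.
apply: (@le_trans _ _ (c * x `^ be)); last by rewrite lerDr mulr_ge0 ?powR_ge0.
have -> : be = (be - al) + al by rewrite subrK.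
rewrite powRD; last by rewrite (gt_eqF xp) implybT.
rewrite mulrA ler_wpM2r ?powR_ge0 //.
have hh : A / c <= x `^ (be - al).
  have d0 : be - al != 0 by rewrite gt_eqF // subr_gt0.
  have -> : A / c = x0 `^ (be - al).
    by rewrite -powRrM mulVf // powRr1 // divr_ge0 // ltW.
  by rewrite ge0_ler_powR ?nnegrE ?powR_ge0 // ltW // ?subr_gt0.
by move: hh; rewrite ler_pdivrMr // mulrC.
Qed.

(** Half of [c] absorbs the exponential of lower order, the other half the power. With [A = 0] and
    [al = 0] this compares a power with exp(c x^be). *)
Lemma exp_beats (A c al be h : R) : 0 <= A -> 0 < c -> 0 <= al -> al < be -> 0 <= h ->
  exists2 C, 0 < C & forall x, 0 <= x ->
    x `^ h * expR (A * x `^ al) <= C * expR (c * x `^ be).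
Proof.
move=> A0 c0 al0 albe h0.
have be0 : 0 < be by exact: le_lt_trans al0 albe.
have c2 : 0 < c / 2 by lra.
have [C1 C10 H1] := powR_ltC A0 c2 al0 albe.
have [C2 C20 H2] := @powR_le_exp (h / be) (c / 2) (divr_ge0 h0 (ltW be0)) c2.
exists (C2 * expR C1); first by rewrite mulr_gt0 ?expR_gt0.
move=> x x0.
have -> : C2 * expR C1 * expR (c * x `^ be) =
   (C2 * expR (c / 2 * x `^ be)) * (expR (C1 + c / 2 * x `^ be)).
  by rewrite [expR (C1 + _)]expRD {1}[c]splitr mulrDl expRD; ring.
apply: ler_pM; rewrite ?powR_ge0 ?expR_ge0 //; last by rewrite ler_expR H1.
have -> : x `^ h = (x `^ be) `^ (h / be) by rewrite -powRrM mulrC divfK // gt_eqF.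
by apply: H2; rewrite powR_ge0.
Qed.

(** As [a - 1 <= 0], z (x + y)^(a - 1) <= z^a for z = x and z = y; the two add up. This makes the
    weights [expw] submultiplicative. *)
Lemma powR_subadd x y a : 0 <= x -> 0 <= y -> 0 < a -> a <= 1 ->
  (x + y) `^ a <= x `^ a + y `^ a.
Proof.
move=> x0 y0 a0 a1.
have [->|xn] := eqVneq x 0; first by rewrite powR0 ?gt_eqF // !add0r.
have [->|yn] := eqVneq y 0; first by rewrite powR0 ?gt_eqF // !addr0.
have xp : 0 < x by rewrite lt_neqAle eq_sym xn.
have yp : 0 < y by rewrite lt_neqAle eq_sym yn.
have xy : 0 <= x + y by lra.
have key z : 0 < z -> z <= x + y -> z * (x + y) `^ (a - 1) <= z `^ a.
  move=> z0 zxy; rewrite -(@mulr_powRB1 _ z a (ltW z0) a0) ler_pM2l //.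
  have e : a - 1 = - (1 - a) by rewrite opprB.
  rewrite e !powRN lef_pV2 ?posrE ?powR_gt0 //; try lra.
  by rewrite ge0_ler_powR ?nnegrE //; lra.
rewrite -(mulr_powRB1 xy a0) mulrDl lerD // key //; lra.
Qed.

Lemma powR_le1D x a : 0 <= x -> 0 <= a -> a <= 1 -> x `^ a <= 1 + x.
Proof. by move=> x0 a0 a1; rewrite -[x in _ <= 1 + x]expr1 powR_le_1D. Qed.

Lemma exp_half_le x : 0 <= x -> x <= 1 -> expR (x / 2) <= 1 + x.
Proof.
move=> x0 x1.
have h : 1 - x / 2 <= expR (- (x / 2)) by apply: le_trans (expR_ge1Dx _).
have -> : expR (x / 2) = (expR (- (x / 2)))^-1 by rewrite expRN invrK.
apply: (@le_trans _ _ (1 - x / 2)^-1).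
  by rewrite lef_pV2 ?posrE ?expR_gt0 //; lra.
rewrite -[_^-1]mul1r ler_pdivrMr; first nra.
by lra.
Qed.

Lemma sum_geo_le (q : R) n : 0 <= q -> q < 1 -> \sum_(k < n) q ^+ k <= (1 - q)^-1.
Proof.
move=> q0 q1; have q10 : 0 < 1 - q by lra.
rewrite -[_^-1]mul1r ler_pdivlMr // mulrC.
have -> : (1 - q) * \sum_(k < n) q ^+ k = 1 - q ^+ n.
  by have := subrX1 q n; set S := \sum_(_ < _) _ => h; lra.
by have := exprn_ge0 n q0; lra.
Qed.

Lemma sum_exp_le x n : 0 < x -> x <= 1 -> \sum_(k < n) expR (- (x * k%:R)) <= 2 / x.
Proof.
move=> x0 x1.
have e (k : nat) : expR (- (x * k%:R)) = expR (- x) ^+ k.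
  by rewrite -mulNr expRM_natr.
under eq_bigr => k _ do rewrite e.
have hx : expR (- x) <= 1 - x / 2.
  have := @exp_half_le x (ltW x0) x1.
  have : 1 + x <= expR x by exact: expR_ge1Dx.
  rewrite expRN => h _.
  apply: (@le_trans _ _ (1 + x)^-1).
    by rewrite lef_pV2 ?posrE ?expR_gt0 //; lra.
  rewrite -[_^-1]mul1r ler_pdivrMr; first nra.
  by lra.
apply: le_trans (sum_geo_le n (expR_ge0 _) _) _; first by lra.
by rewrite -invf_div lef_pV2 ?posrE; lra.
Qed.

Lemma sum_invsq_le n : \sum_(k < n) (1 + k%:R)^-1 ^+ 2 <= 2 :> R.
Proof.
suff h : \sum_(k < n.+1) (1 + k%:R)^-1 ^+ 2 <= 2 - (1 + n%:R)^-1 :> R.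
  apply: le_trans (_ : _ <= \sum_(k < n.+1) (1 + k%:R)^-1 ^+ 2) _.
    by rewrite big_ord_recr lerDl sqr_ge0.
  by apply: le_trans h _; rewrite gerBl invr_ge0 addr_ge0.
elim: n => [|n ih]; first by rewrite big_ord1 addr0 invr1 expr1n; lra.
rewrite big_ord_recr /=; apply: le_trans (lerD ih (lexx _)) _.
rewrite -(natr1 n); set u : R := n%:R.
have u0 : 0 <= u by rewrite ler0n.
have -> : (1 + (u + 1))^-1 ^+ 2 = ((1 + (u + 1)) * (1 + (u + 1)))^-1.
  by rewrite expr2 invfM.
have e : (1 + u)^-1 - (1 + (u + 1))^-1 = ((1 + u) * (1 + (u + 1)))^-1.
  by field; rewrite !gt_eqF //; lra.
have : ((1 + (u + 1)) * (1 + (u + 1)))^-1 <= ((1 + u) * (1 + (u + 1)))^-1.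
  by rewrite lef_pV2 ?posrE; nra.
by lra.
Qed.

Lemma harmonic_le n : (0 < n)%N -> \sum_(k < n) (1 + k%:R)^-1 <= 1 + ln n%:R :> R.
Proof.
case: n => // n _; elim: n => [|n ih].
  by rewrite big_ord1 addr0 invr1 ln1 addr0.
rewrite big_ord_recr /=; apply: le_trans (lerD ih (lexx _)) _.
rewrite -addrA lerD2l.
have n1 : 0 < n.+1%:R :> R by rewrite ltr0n.
have n2 : 0 < n.+2%:R :> R by rewrite ltr0n.
have -> : 1 + n.+1%:R = n.+2%:R :> R by rewrite addrC natr1.
have h : ln (1 + (- n.+2%:R^-1)) <= - n.+2%:R^-1 :> R.
  apply: le_ln1Dx; rewrite ltrN2 invf_lt1 //.
  by rewrite -[1]/(1%:R) ltr_nat.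
have e : 1 + (- n.+2%:R^-1) = n.+1%:R / n.+2%:R :> R.
  by rewrite -(natr1 n.+1); set u := n.+1%:R in n1 *; field; rewrite gt_eqF //; lra.
move: h; rewrite e ln_div ?posrE //; set iv := _^-1; lra.
Qed.

(** Bernoulli's inequality is vacuous at exponent n, but at exponent n/2 it gives 1/2. Squaring, and
    one more factor at least 1/2 for odd n, leaves 1/8. *)
Lemma one_minus_inv_pow n : (2 <= n)%N -> 8^-1 <= (1 - n%:R^-1) ^+ n :> R.
Proof.
move=> n2; have n0 : 0 < n%:R :> R by rewrite ltr0n; lia.
have n2R : 2 <= n%:R :> R by rewrite ler_nat.
set u : R := n%:R^-1.
have u0 : 0 < u by rewrite invr_gt0.
have u2 : u <= 1 / 2 by rewrite div1r lef_pV2 ?posrE.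
have nu : n%:R * u = 1 by rewrite divff // gt_eqF.
have bern k : 1 - k%:R * u <= (1 - u) ^+ k.
  elim: k => [|k ih]; first by rewrite mul0r subr0.
  rewrite exprS -(natr1 k).
  have : (1 - u) * (1 - k%:R * u) <= (1 - u) * (1 - u) ^+ k.
    by rewrite ler_wpM2l //; lra.
  have : 0 <= k%:R * u by rewrite mulr_ge0 // ltW.
  by nra.
have hh : 1 / 2 <= (1 - u) ^+ n./2.
  apply: le_trans (bern _).
  suff : n./2%:R * u <= 1 / 2 by lra.
  have : 2 * n./2%:R <= n%:R :> R by rewrite -natrM ler_nat; lia.
  by nra.
have e : (1 - u) ^+ n = (1 - u) ^+ n./2 * (1 - u) ^+ n./2 * (1 - u) ^+ (odd n).
  by rewrite -!exprD; congr (_ ^+ _); lia.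
rewrite e; set z := (1 - u) ^+ n./2 in hh *.
have h1 : 2^-1 <= (1 - u) ^+ odd n.
  by case: (odd n); rewrite ?expr1 ?expr0; lra.
have h2 : 4^-1 <= z * z by nra.
by nra.
Qed.

(** Writing 1 + j as x^-1 (x (1 + j)) extracts x^(-2s); the remaining power is absorbed by half of
    the exponential decay, and the geometric sum contributes x^-1. The square root, with x of order
    1/N, is the source of N^(s + 1/2). *)
Lemma moment_sum s : 0 <= s -> exists2 C, 0 < C & forall x n, 0 < x -> x <= 1 ->
  \sum_(j < n) ((1 + j%:R) `^ s) ^+ 2 * ((1 + x) ^- j) ^+ 2 <= C * x `^ (- (2 * s + 1)).
Proof.
move=> s0.
have [C C0 H] := @powR_le_exp (2 * s) (1 / 2) ltac:(lra) ltac:(lra).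
exists (C * expR (1 / 2) * 4); first by rewrite !mulr_gt0 ?expR_gt0.
move=> x n x0 x1.
have step (j : nat) : ((1 + j%:R) `^ s) ^+ 2 * ((1 + x) ^- j) ^+ 2 <=
     C * expR (1 / 2) * x `^ (- (2 * s)) * expR (- (x / 2 * j%:R)).
  have j0 : 0 <= j%:R :> R by [].
  have -> : ((1 + j%:R) `^ s) ^+ 2 = x `^ (- (2 * s)) * (x * (1 + j%:R)) `^ (2 * s).
    rewrite powRM; try lra.
    rewrite mulrA -powRD; last by rewrite (gt_eqF x0) implybT.
    by rewrite addNr powRr0 mul1r [2 * s]mulrC powRrM powR_mulrn // powR_ge0.
  have h1 := H (x * (1 + j%:R)) ltac:(nra).
  have h2 : ((1 + x) ^- j) ^+ 2 <= expR (- (x * j%:R)).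
    rewrite -exprVn -exprM mulnC exprM -mulNr expRM_natr.
    apply: lerXn2r; rewrite ?nnegrE ?expR_ge0 //; first by rewrite sqr_ge0.
    rewrite exprVn expRN lef_pV2 ?posrE ?expR_gt0 ?exprn_gt0 //; try lra.
    have -> : x = 2%:R * (x / 2) by field.
    rewrite expRM_natl; apply: lerXn2r; rewrite ?nnegrE ?expR_ge0 //; try lra.
    by rewrite [2 * (x / 2)]mulrC divfK //; apply: exp_half_le; lra.
  rewrite -mulrA.
  have -> : C * expR (1 / 2) * x `^ (- (2 * s)) * expR (- (x / 2 * j%:R)) =
     x `^ (- (2 * s)) * ((C * expR (1 / 2 + x / 2 * j%:R)) * expR (- (x * j%:R))).
    have -> : expR (- (x / 2 * j%:R)) = expR (x / 2 * j%:R) * expR (- (x * j%:R)).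
      by rewrite -expRD; congr expR; field.
    by rewrite expRD; ring.
  rewrite ler_wpM2l ?powR_ge0 //; apply: ler_pM; rewrite ?powR_ge0 ?sqr_ge0 //.
  apply: le_trans h1 _; rewrite ler_pM2l // ler_expR; nra.
apply: (@le_trans _ _ (\sum_(j < n)
    C * expR (1 / 2) * x `^ (- (2 * s)) * expR (- (x / 2 * j%:R)))).
  by apply: ler_sum => j _; exact: step.
rewrite -mulr_sumr.
have hs := @sum_exp_le (x / 2) n ltac:(lra) ltac:(lra).
rewrite opprD powRD; last by rewrite (gt_eqF x0) implybT.
rewrite powR_inv1; last by lra.
have -> : C * expR (1 / 2) * 4 * (x `^ (- (2 * s)) / x) =
   C * expR (1 / 2) * x `^ (- (2 * s)) * (2 / (x / 2)).
  by field; rewrite gt_eqF.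
by rewrite ler_wpM2l // !mulr_ge0 ?powR_ge0 ?expR_ge0 // ltW.
Qed.

End RealEstimates.

(** * Roots of unity *)

Section RootsOfUnity.
Variable R : realType.
Local Notation C := R[i].

Definition rho (M : nat) : C := expi (2 * pi / M%:R).

Lemma rhoX M k : rho M ^+ k = expi (2 * pi * k%:R / M%:R).
Proof. by rewrite /rho -expiMn; congr (expi _); rewrite -[LHS]mulr_natr mulrAC. Qed.

Lemma rhoM M : (0 < M)%N -> rho M ^+ M = 1.
Proof.
by move=> M0; rewrite rhoX mulfK ?expi2pi // pnatr_eq0 -lt0n.
Qed.

Lemma rnorm_rho M k : rnorm (rho M ^+ k) = 1.
Proof. by rewrite rhoX rnorm_expi. Qed.

Lemma rho_neq0 M : rho M != 0.
Proof. by rewrite -rnorm_eq0 -[rho M]expr1 rnorm_rho oner_neq0. Qed.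

Lemma conj_rho M : (rho M)^*%C = (rho M)^-1.
Proof. by rewrite /rho conj_expi expiN. Qed.

Lemma conj_rhoX M n : (rho M ^+ n)^*%C = (rho M)^-1 ^+ n.
Proof. by rewrite rmorphXn; congr (_ ^+ _); exact: conj_rho. Qed.

Lemma rho_chord_le M k : rnorm (rho M ^+ k - 1) <= 2 * pi * k%:R / M%:R.
Proof.
rewrite rhoX; apply: le_trans (chord_le _) _; rewrite ger0_norm //.
by rewrite !mulr_ge0 ?invr_ge0 ?pi_ge0.
Qed.

Lemma rho_chord_ge M k : (k.*2 <= M)%N -> 2 * k%:R / M%:R <= rnorm (rho M ^+ k - 1).
Proof.
move=> kM; case: (posnP M) => [M0|M0].
  by rewrite M0 invr0 mulr0 rnorm_ge0.
have MR : 0 < M%:R :> R by rewrite ltr0n.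
have t0 : 0 <= 2 * pi * k%:R / M%:R :> R.
  by rewrite !mulr_ge0 ?invr_ge0 ?pi_ge0.
have kM' : 2 * k%:R <= M%:R :> R by rewrite -natrM ler_nat mul2n.
rewrite rhoX; apply: le_trans (chord_ge _); rewrite ger0_norm //.
  rewrite ler_pdivrMr // mulrAC divfK ?gt_eqF //.
  have := pi_ge2 R; have : 0 <= k%:R :> R by []; nra.
rewrite ler_pdivrMr //; have := pi_ge0 R; nra.
Qed.

Lemma rho_eq1 M k : (0 < M)%N -> (rho M ^+ k == 1) = (M %| k)%N.
Proof.
move=> M0; have MR : 0 < M%:R :> R by rewrite ltr0n.
apply/idP/idP => [|/dvdnP[c ->]]; last by rewrite mulnC exprM rhoM // expr1n.
have e : rho M ^+ k = rho M ^+ (k %% M).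
  by rewrite {1}(divn_eq k M) exprD mulnC exprM rhoM // expr1n mul1r.
rewrite e; apply: contraTT => nd.
have k0 : (0 < k %% M)%N by rewrite lt0n; apply: contra nd => /eqP h; apply/eqP.
have kM : (k %% M < M)%N by rewrite ltn_mod.
move: k0 kM; move: (k %% M)%N => l l0 lM.
have main j : (0 < j)%N -> (j.*2 <= M)%N -> rho M ^+ j != 1.
  move=> j0 jM; rewrite -subr_eq0 -rnorm_eq0 gt_eqF //.
  apply: lt_le_trans (rho_chord_ge jM).
  by rewrite divr_gt0 // mulr_gt0 // ltr0n.
case: (leqP l.*2 M) => hl; first exact: main.
apply/negP => /eqP h.
have : rho M ^+ (M - l) != 1 by apply: main; lia.
have := rhoM M0; rewrite -{2}(subnK (ltnW lM)) exprD h mulr1 => ->.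
by rewrite eqxx.
Qed.

Lemma sum_root (x : C) M : x ^+ M = 1 ->
  \sum_(j < M) x ^+ j = if x == 1 then M%:R else 0.
Proof.
move=> xM; case: eqP => [->|/eqP x1].
  by under eq_bigr => j _ do rewrite expr1n; rewrite sumr_const card_ord.
have := subrX1 x M; rewrite xM subrr => /esym /eqP.
by rewrite mulf_eq0 subr_eq0 (negbTE x1) => /eqP.
Qed.

Lemma rho_orth M k i : (0 < M)%N ->
  \sum_(j < M) (rho M ^+ j) ^+ k * ((rho M)^-1 ^+ j) ^+ i =
  if k == i %[mod M] then M%:R else 0.
Proof.
move=> M0.
have e (j : nat) : (rho M ^+ j) ^+ k * ((rho M)^-1 ^+ j) ^+ i =
    (rho M ^+ k * (rho M)^-1 ^+ i) ^+ j.
  by rewrite exprMn -!exprM ![(_ * j)%N]mulnC.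
under eq_bigr => j _ do rewrite e.
rewrite sum_root; last first.
  by rewrite exprMn -!exprM ![(_ * M)%N]mulnC !exprM exprVn rhoM // invr1 !expr1n mulr1.
congr (if _ then _ else _).
have ri l : rho M ^+ l != 0 by rewrite expf_neq0 // rho_neq0.
have -> : (rho M ^+ k * (rho M)^-1 ^+ i == 1) = (rho M ^+ k == rho M ^+ i).
  by rewrite exprVn -[X in _ = (_ == X)]mul1r -(can2_eq (divfK (ri i)) (mulfK (ri i))).
clear e; wlog ik : k i / (i <= k)%N => [h|].
  by case/orP: (leq_total i k) => /h // hh; rewrite eq_sym hh eq_sym.
rewrite eqn_mod_dvd // -rho_eq1 // -{1}(subnK ik) exprD.
by rewrite -[X in _ == X]mul1r (inj_eq (mulIf (ri i))).
Qed.

(** Aliasing: samples at the M-th roots of unity cannot separate coefficients whose indices agree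
    modulo M, so the inverse transform returns their sum. *)
Lemma dft_fold M (p : {poly C}) i : (0 < M)%N ->
  \sum_(j < M) p.[rho M ^+ j] * ((rho M)^-1 ^+ j) ^+ i =
  M%:R * \sum_(k < size p | (k == i %[mod M])%N) p`_k.
Proof.
move=> M0.
under eq_bigr => j _ do rewrite horner_coef mulr_suml.
rewrite exchange_big /= mulr_sumr [RHS]big_mkcond /=.
apply: eq_bigr => k _.
under eq_bigr => j _ do rewrite -mulrA.
rewrite -mulr_sumr rho_orth //.
by case: ifP => _; rewrite ?mulr0 // mulrC.
Qed.

Lemma parseval M (p : {poly C}) : (0 < M)%N -> (size p <= M)%N ->
  \sum_(j < M) rnorm (p.[rho M ^+ j]) ^+ 2 = M%:R * \sum_(k < size p) rnorm (p`_k) ^+ 2.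
Proof.
move=> M0 pM; apply: realC_inj.
rewrite rmorphM /= rmorph_nat !rmorph_sum /= mulr_sumr.
under eq_bigr => j _ do rewrite sqr_rnorm.
under [RHS]eq_bigr => k _ do rewrite sqr_rnorm.
have step (j : 'I_M) : p.[rho M ^+ j] * (p.[rho M ^+ j])^*%C =
    \sum_(k < size p) (p`_k)^*%C * (p.[rho M ^+ j] * ((rho M)^-1 ^+ j) ^+ k).
  rewrite {2}horner_coef rmorph_sum /= mulr_sumr; apply: eq_bigr => k _.
  by rewrite rmorphM /= -!exprM conj_rhoX mulrCA.
under eq_bigr => j _ do rewrite step.
rewrite exchange_big /=; apply: eq_bigr => k _.
rewrite -mulr_sumr dft_fold // (big_pred1 k) /=; first by rewrite mulrCA [_^*%C * _]mulrC.
move=> l /=; rewrite !modn_small //; first exact: leq_trans pM.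
exact: leq_trans pM.
Qed.

(** The squared Hardy norm on the circle of radius [t], the mean of |p|^2 there
    ([parseval_radius]). *)
Definition sqnorm (t : R) (p : {poly C}) : R :=
  \sum_(k < size p) (rnorm (p`_k) * t ^+ k) ^+ 2.

Lemma parseval_radius M t (p : {poly C}) : 0 <= t -> (0 < M)%N -> (size p <= M)%N ->
  \sum_(j < M) rnorm (p.[t%:C * rho M ^+ j]) ^+ 2 = M%:R * sqnorm t p.
Proof.
move=> t0 M0 pM.
pose q := \poly_(k < size p) (p`_k * t%:C ^+ k).
have qM : (size q <= M)%N by apply: leq_trans pM; exact: size_poly.
have eq z : q.[z] = p.[t%:C * z].
  rewrite horner_poly horner_coef; apply: eq_bigr => k _.
  by rewrite exprMn mulrA.
under eq_bigr => j _ do rewrite -eq.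
rewrite parseval //; congr (_ * _).
have -> : \sum_(k < size q) rnorm q`_k ^+ 2 = \sum_(k < size p) rnorm q`_k ^+ 2.
  have sqp : (size q <= size p)%N by exact: size_poly.
  rewrite (big_ord_widen _ (fun k => rnorm q`_k ^+ 2) sqp) big_mkcond /=.
  apply: eq_bigr => k _; case: ltnP => // h.
  by rewrite nth_default // rnorm0 expr0n.
apply: eq_bigr => k _; rewrite coef_poly ltn_ord rnormM rnormX.
by rewrite rnormR.
Qed.

Lemma sqnorm_le t A (p : {poly C}) : 0 <= t ->
  (forall z, rnorm z = 1 -> rnorm (p.[t%:C * z]) <= A) -> sqnorm t p <= A ^+ 2.
Proof.
move=> t0 h.
have M0 : (0 < (size p).+1)%N by [].
have MR : 0 < (size p).+1%:R :> R by rewrite ltr0n.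
rewrite -(ler_pM2l MR) -parseval_radius //.
have -> : (size p).+1%:R * A ^+ 2 = \sum_(j < (size p).+1) A ^+ 2.
  by rewrite sumr_const card_ord mulr_natl.
apply: ler_sum => j _; have hj := h _ (rnorm_rho (size p).+1 j).
by apply: lerXn2r; rewrite ?nnegrE ?rnorm_ge0 // (le_trans (rnorm_ge0 _) hj).
Qed.

Lemma sqnormM_le t A (f p : {poly C}) : 0 <= t ->
  (forall z, rnorm z = 1 -> rnorm (f.[t%:C * z]) <= A) ->
  sqnorm t (f * p) <= A ^+ 2 * sqnorm t p.
Proof.
move=> t0 h; pose M := (size (f * p)%R + size p).+1.
have M0 : (0 < M)%N by [].
have MR : 0 < M%:R :> R by rewrite ltr0n.
rewrite -(ler_pM2l MR) mulrCA -!parseval_radius //; try by rewrite /M; lia.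
rewrite mulr_sumr; apply: ler_sum => j _.
rewrite hornerM rnormM exprMn ler_wpM2r ?sqr_ge0 //.
have hj := h _ (rnorm_rho M j).
by apply: lerXn2r; rewrite ?nnegrE ?rnorm_ge0 // (le_trans (rnorm_ge0 _) hj).
Qed.

Lemma coef_le_sqnorm t A (p : {poly C}) k : 0 < t -> 0 <= A ->
  sqnorm t p <= A ^+ 2 -> rnorm (p`_k) <= A / t ^+ k.
Proof.
move=> t0 A0 h; have tk : 0 < t ^+ k by rewrite exprn_gt0.
rewrite ler_pdivlMr //.
case: (ltnP k (size p)) => kp; last by rewrite nth_default // rnorm0 mul0r.
rewrite -(@ler_pXn2r _ 2) ?nnegrE ?mulr_ge0 ?rnorm_ge0 // ?(ltW tk) //.
apply: le_trans h; rewrite /sqnorm (bigD1 (Ordinal kp)) //= lerDl.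
by apply: sumr_ge0 => i _; rewrite sqr_ge0.
Qed.

End RootsOfUnity.

(** |i - d| in [nat]: one of the two truncated differences is 0. *)
Definition dst (i d : nat) : nat := (i - d + (d - i))%N.

Lemma mod_close a b M : (dst a b < M)%N -> a = b %[mod M] -> a = b.
Proof.
wlog ba : a b / (b <= a)%N => [h|].
  case/orP: (leq_total b a) => [|ab] hd e; first by move/h; apply.
  by apply/esym/h => //; rewrite /dst addnC.
move=> hd /eqP; rewrite eqn_mod_dvd // => /dvdnP[[|c] hc]; first by lia.
by move: hd; rewrite /dst hc mulSn; lia.
Qed.

Section Folding.
Variable R : realType.
Local Notation C := R[i].

Lemma card_dst n d K : (#|[pred i : 'I_n | (dst i d <= K)%N]| <= K.*2.+1)%N.
Proof.
rewrite -[X in (_ <= X)%N]card_ord.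
apply: (@leq_card_in _ _ (fun i : 'I_n => inord (i + K - d) : 'I_(K.*2.+1))).
  move=> i j; rewrite !inE /dst => hi hj /(congr1 val) /=.
  by rewrite !inordK; try lia; move=> h; apply: val_inj => /=; lia.
Qed.

(** A coefficient within K of [d] is a discrete Fourier coefficient of size at most [eta], minus its
    aliases. The aliases lie farther than K from [d] because M > 2K, so their weight [Om K] may be
    raised to their own; and a far coefficient is an alias of at most one near index. Hence the
    factor 2 on the tail: once for itself, once as an alias. *)
Lemma fold_sum_le (Om : nat -> R) (p : {poly C}) (eta : R) (d K M : nat) :
  (forall k, 0 <= Om k) -> {homo Om : k l / (k <= l)%N >-> k <= l} ->
  (K.*2 < M)%N -> 0 <= eta ->
  (forall j, (j < M)%N -> rnorm (p.[rho R M ^+ j]) <= eta) ->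
  \sum_(i < size p) rnorm (p`_i) * Om (dst i d) <=
  K.*2.+1%:R * eta * Om K +
  2 * \sum_(i < size p | (K < dst i d)%N) rnorm (p`_i) * Om (dst i d).
Proof.
move=> Om0 Omh KM eta0 hp.
have M0 : (0 < M)%N by lia.
have MR : 0 < M%:R :> R by rewrite ltr0n.
set n := size p.
have alias (i : 'I_n) : rnorm (p`_i) <=
    eta + \sum_(k < n | (k == i %[mod M])%N && (k != i)) rnorm (p`_k).
  have := dft_fold p i M0; rewrite (bigD1 i) //=.
  set S := \sum_(k < _ | _) p`_k => h.
  have hS : rnorm S <= \sum_(k < n | (k == i %[mod M])%N && (k != i)) rnorm (p`_k).
    exact: rnorm_sum.
  have h2 : rnorm (p`_i + S) <= eta.
    rewrite -(ler_pM2l MR) -[X in X * rnorm _](@rnorm_nat R) -rnormM -h.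
    apply: le_trans (rnorm_sum _ _ _) _.
    have -> : M%:R * eta = \sum_(j < M) eta by rewrite sumr_const card_ord mulr_natl.
    apply: ler_sum => j _; rewrite rnormM -exprM exprVn rnormV rnorm_rho invr1 mulr1.
    exact: hp.
  have := rnorm_ge_dist (p`_i) (- S); rewrite rnormN opprK; lra.
rewrite (bigID (fun i : 'I_n => (K < dst i d)%N)) /=.
rewrite [2 * _]mulr_natl mulr2n addrA [X in _ <= X]addrC lerD2l.
under eq_bigl => i do rewrite -leqNgt.
apply: (@le_trans _ _ (\sum_(i < n | (dst i d <= K)%N) (eta +
   \sum_(k < n | (k == i %[mod M])%N && (k != i)) rnorm (p`_k)) * Om K)).
  apply: ler_sum => i hi; apply: ler_pM; rewrite ?rnorm_ge0 ?Om0 //; exact: Omh.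
rewrite -mulr_suml big_split /= mulrDl; apply: lerD.
  rewrite sumr_const ler_wpM2r ?Om0 // -[eta *+ _]mulr_natl ler_wpM2r //.
  by rewrite ler_nat card_dst.
rewrite (exchange_big_dep xpredT) //= mulr_suml.
rewrite [X in _ <= X]big_mkcond /=; apply: ler_sum => k _.
case: ltnP => hk; last first.
  rewrite big1 ?mul0r // => i /andP[hi /andP[/eqP ki /eqP nki]].
  by case: nki; apply: val_inj => /=; apply: (mod_close (M := M)) => //; move: hi hk; rewrite /dst; lia.
rewrite sumr_const.
have c1 : (#|[pred i : 'I_n | (dst i d <= K)%N && ((k == i %[mod M])%N && (k != i))]| <= 1)%N.
  apply/card_le1P => /= i; rewrite !inE => /andP[hi /andP[/eqP ki nki]] j; rewrite !inE.
  apply/idP/idP => [/andP[hj /andP[/eqP kj _]]|/eqP -> ]; last by rewrite hi ki eqxx nki.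
  apply/eqP/val_inj => /=; apply: (mod_close (M := M)); last by rewrite -ki kj.
  by move: hi hj; rewrite /dst; lia.
apply: ler_pM; rewrite ?mulrn_wge0 ?rnorm_ge0 ?Om0 //; last by rewrite Omh // ltnW.
by rewrite -[_ *+ _]mulr_natr ler_piMr ?rnorm_ge0 // lern1.
Qed.

End Folding.

(** * Weighted coefficient norms and bump polynomials *)

Lemma size_mul_le (S : nzSemiRingType) (p q : {poly S}) a b :
  (size p <= a)%N -> (size q <= b)%N -> (size (p * q)%R <= (a + b).-1)%N.
Proof.
move=> pa qb; apply: leq_trans (size_polyMleq _ _) _.
by rewrite -!subn1 leq_sub2r // leq_add.
Qed.

Section Weights.
Variable R : realType.
Local Notation C := R[i].
Implicit Types p q : {poly C}.

(* Weighted sum of the coefficients of the Laurent polynomial [X^-d p]. *)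
Definition wnorm (v : nat -> R) (d : nat) (p : {poly C}) : R :=
  \sum_(i < size p) rnorm (p`_i) * v (dst i d).

Lemma wnorm_wide v d (p : {poly C}) n : (size p <= n)%N ->
  wnorm v d p = \sum_(i < n) rnorm (p`_i) * v (dst i d).
Proof.
move=> h; rewrite /wnorm (big_ord_widen _ (fun i => rnorm p`_i * v (dst i d)) h).
rewrite big_mkcond /=; apply: eq_bigr => i _; case: ltnP => // hi.
by rewrite nth_default // rnorm0 mul0r.
Qed.

Variable v : nat -> R.
Hypothesis v0 : forall k, 0 <= v k.

Lemma wnorm_ge0 d p : 0 <= wnorm v d p.
Proof. by apply: sumr_ge0 => i _; rewrite mulr_ge0 ?rnorm_ge0. Qed.

Lemma wnormD d p q : wnorm v d (p + q) <= wnorm v d p + wnorm v d q.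
Proof.
pose n := (size (p + q)%R + size p + size q)%N.
rewrite !(@wnorm_wide _ _ _ n) /n; try by lia.
rewrite -big_split /=; apply: ler_sum => i _.
by rewrite coefD -mulrDl ler_wpM2r // rnormD.
Qed.

Lemma wnorm0 d : wnorm v d 0 = 0.
Proof. by rewrite /wnorm size_poly0 big_ord0. Qed.

Lemma wnorm_sum d I (r : seq I) (P : pred I) F :
  wnorm v d (\sum_(i <- r | P i) F i) <= \sum_(i <- r | P i) wnorm v d (F i).
Proof.
elim/big_rec2: _ => [|i y x _ h]; first by rewrite wnorm0.
by apply: le_trans (wnormD _ _ _) _; rewrite lerD2l.
Qed.

Hypothesis vM : forall k l, v (k + l) <= v k * v l.
Hypothesis vh : {homo v : k l / (k <= l)%N >-> k <= l}.

(** Since [dst (i + k) (d1 + d2) <= dst i d1 + dst k d2], a nondecreasing submultiplicative weight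
    makes the Laurent polynomials a Beurling algebra. *)
Lemma wnormM d1 d2 p q : wnorm v (d1 + d2) (p * q) <= wnorm v d1 p * wnorm v d2 q.
Proof.
have mono (c : C) i : wnorm v (d1 + d2) (c *: 'X^i * q) <=
    rnorm c * v (dst i d1) * wnorm v d2 q.
  have sz : (size (c *: 'X^i * q)%R <= i + size q)%N.
    apply: (@size_mul_le _ _ _ i.+1) => //.
    by apply: leq_trans (size_scale_leq _ _) _; rewrite size_polyXn.
  rewrite (wnorm_wide _ _ sz) big_split_ord /= big1 ?add0r; last first.
    move=> k _; rewrite -scalerAl coefZ coefXnM ltn_ord mulr0 rnorm0 mul0r //.
  rewrite mulr_sumr; apply: ler_sum => k _.
  rewrite -scalerAl coefZ coefXnM ltnNge leq_addr /= addKn rnormM.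
  rewrite -!mulrA ler_wpM2l ?rnorm_ge0 // mulrCA ler_wpM2l ?rnorm_ge0 //.
  by apply: le_trans (vM _ _); apply: vh; rewrite /dst; lia.
rewrite -{1}(coefK p) poly_def mulr_suml.
apply: le_trans (wnorm_sum _ _ _ _) _.
rewrite [wnorm v d1 p]/wnorm mulr_suml; apply: ler_sum => i _; exact: mono.
Qed.

Lemma wnormX0 p m : v 0%N <= 1 -> wnorm v 0 (p ^+ m) <= wnorm v 0 p ^+ m.
Proof.
move=> v1; elim: m => [|m ih].
  by rewrite !expr0 /wnorm size_poly1 big_ord1 coefC /= rnorm1 mul1r.
rewrite !exprS -[X in wnorm v X]add0n; apply: le_trans (wnormM _ _ _ _) _.
by rewrite ler_wpM2l ?wnorm_ge0.
Qed.

Lemma wnorm_tail (Om : nat -> R) d p K e :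
  (forall k, (K < k)%N -> Om k <= e * v k) ->
  0 <= e ->
  \sum_(i < size p | (K < dst i d)%N) rnorm (p`_i) * Om (dst i d) <= e * wnorm v d p.
Proof.
move=> h e0; rewrite /wnorm mulr_sumr [X in X <= _]big_mkcond /=.
apply: ler_sum => i _; case: ifP => hi; last by rewrite !mulr_ge0 ?rnorm_ge0.
by rewrite mulrCA ler_wpM2l ?rnorm_ge0 // h.
Qed.

End Weights.

Section ExpWeight.
Variable R : realType.
Variables (a b : R).
Hypotheses (a0 : 0 <= a) (b0 : 0 < b) (b1 : b <= 1).

(** Summability against this weight is the Fourier side of Gevrey regularity of order 1/b. For b < 1
    it still allows functions of small support, which b = 1 would not. *)
Definition expw (k : nat) : R := expR (a * k%:R `^ b).

Lemma expw_ge0 k : 0 <= expw k. Proof. exact: expR_ge0. Qed.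

Lemma expw_homo : {homo expw : k l / (k <= l)%N >-> k <= l}.
Proof.
move=> k l kl; rewrite ler_expR ler_wpM2l // ge0_ler_powR ?nnegrE ?ler_nat //.
exact: ltW.
Qed.

Lemma expwM k l : expw (k + l) <= expw k * expw l.
Proof.
by rewrite -expRD ler_expR -mulrDr ler_wpM2l // natrD powR_subadd.
Qed.

Lemma expw0 : expw 0 = 1.
Proof. by rewrite /expw powR0 ?gt_eqF // mulr0 expR0. Qed.

End ExpWeight.

Section Bump.
Variable R : realType.
Local Notation C := R[i].
Implicit Types (q : {poly C}) (l : nat).

(** Nonnegativity in [R[i]] includes being real. Once [q.[1] = 1], the coefficients form a
    probability vector, whence |q| <= 1 on the circle. *)
Definition pospoly q : Prop := forall i, 0 <= q`_i.

Lemma pospolyM q1 q2 : pospoly q1 -> pospoly q2 -> pospoly (q1 * q2).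
Proof. by move=> h1 h2 i; rewrite coefM; apply: sumr_ge0 => j _; rewrite mulr_ge0. Qed.

Lemma pospoly1 : pospoly 1.
Proof. by move=> i; rewrite coefC; case: ifP. Qed.

Lemma pospolyX q n : pospoly q -> pospoly (q ^+ n).
Proof.
move=> h; elim: n => [|n ih]; first by rewrite expr0; exact: pospoly1.
by rewrite exprS; exact: pospolyM.
Qed.

Lemma pospoly_coef_sum q : pospoly q -> q.[1] = 1 ->
  \sum_(i < size q) rnorm (q`_i) = 1.
Proof.
move=> h q1; apply: realC_inj; rewrite rmorph_sum /= -[RHS]q1 horner_coef.
by apply: eq_bigr => i _; rewrite expr1n mulr1 -rnormE ger0_norm.
Qed.

Lemma pospoly_le1 q y : pospoly q -> q.[1] = 1 -> rnorm y = 1 -> rnorm (q.[y]) <= 1.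
Proof.
move=> h q1 y1; rewrite horner_coef; apply: le_trans (rnorm_sum _ _ _) _.
rewrite -(pospoly_coef_sum h q1); apply: ler_sum => i _.
by rewrite rnormM rnormX y1 expr1n mulr1.
Qed.

Definition box l : {poly C} := (l%:R^-1)%:P * \sum_(j < l) 'X^j.

Lemma box_pos l : pospoly (box l).
Proof.
move=> i; rewrite coefCM coef_sum mulr_ge0 ?invr_ge0 //.
by apply: sumr_ge0 => j _; rewrite coefXn.
Qed.

Lemma box_at1 l : (0 < l)%N -> (box l).[1] = 1.
Proof.
move=> l0; rewrite hornerM hornerC horner_sum.
under eq_bigr => j _ do rewrite hornerXn expr1n.
by rewrite sumr_const card_ord mulVf // pnatr_eq0 -lt0n.
Qed.

Lemma size_box l : (size (box l) <= l)%N.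
Proof.
apply: (@size_mul_le _ _ _ 1); first exact: size_polyC_leq1.
apply: leq_trans (size_sum _ _ _) _.
by apply/bigmax_leqP => j _; rewrite size_polyXn.
Qed.

Lemma box_decay l y : (0 < l)%N -> rnorm y = 1 -> y != 1 ->
  rnorm ((box l).[y]) <= 2 / (l%:R * rnorm (y - 1)).
Proof.
move=> l0 y1 yn.
have n0 : 0 < rnorm (y - 1).
  by rewrite lt_neqAle rnorm_ge0 eq_sym rnorm_eq0 subr_eq0 yn.
have lR : 0 < l%:R :> R by rewrite ltr0n.
rewrite hornerM hornerC horner_sum.
under eq_bigr => j _ do rewrite hornerXn.
rewrite rnormM rnormV rnorm_nat invfM mulrCA ler_pM2l ?invr_gt0 //.
rewrite ler_pdivlMr // mulrC -rnormM -subrX1.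
by apply: le_trans (rnormB _ _) _; rewrite rnormX y1 expr1n rnorm1.
Qed.

Lemma size_expleq q n : (size (q ^+ n) <= (size q).-1 * n + 1)%N.
Proof. by have := size_poly_exp_leq q n; lia. Qed.

(* A polynomial version of a Gevrey cut-off: a product of box averages, with
   2^(pt) of them of width about 2^-((p+1)t) for each dyadic scale t. *)
Lemma bump_poly p : (0 < p)%N -> exists2 c : R, 0 < c <= 1 / 16 &
  forall r K, 0 < r -> r <= 1 -> exists q,
  [/\ pospoly q, q.[1] = 1,
      forall i, q`_i != 0 -> 2 * pi * i%:R / K.*2.+1%:R <= r &
      forall k y, (k <= K)%N -> rnorm y = 1 ->
        2 * k%:R / K.*2.+1%:R <= rnorm (y - 1) ->
        rnorm (q.[y]) <= 2 * expR (- (2 * c * (r * k%:R) `^ (p%:R / p.+1%:R)))].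
Proof.
move=> p0.
set b : R := p%:R / p.+1%:R.
have p1R : 0 < p.+1%:R :> R by rewrite ltr0n.
have b0 : 0 < b by rewrite divr_gt0 ?ltr0n.
have b1 : b <= 1 by rewrite ler_pdivrMr // mul1r ler_nat.
(* [D] is 64 * 2^(p+1): if t is the last scale with 64 * 2^((p+1)t) <= x, then x / D <= 2^((p+1)t).
   The bound 1/16 on [c] is the one that [geometric_wnorm] asks for. *)
pose D : R := 32 * 2 ^+ p.+2.
have D0 : 0 < D by rewrite mulr_gt0 // exprn_gt0.
have ln2 : 0 < ln (2 : R) by rewrite ln_gt0 // ltr1n.
exists (Num.min (1 / 16) (ln 2 / 2 * (D^-1) `^ b)).
  rewrite lt_min ge_min lexx /= andbT; apply/andP; split; first lra.
  by rewrite mulr_gt0 ?powR_gt0 ?invr_gt0 // divr_gt0.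
set c := Num.min _ _.
have cle : 2 * c <= ln 2 * (D^-1) `^ b.
  have : c <= ln 2 / 2 * (D^-1) `^ b by rewrite /c ge_min lexx orbT.
  by lra.
move=> r K r0 r1; set M := K.*2.+1.
have MR : 0 < M%:R :> R by rewrite ltr0n.
(* Scale t contributes 2^(pt) factors of degree at most [len t], in total M r 2^-t / 32. So q has
   degree at most M r / 16 and its coefficients occupy an arc of length at most r. *)
pose len (t : nat) : R := M%:R * r / 32 / 2 ^+ (p.+1 * t).
have len0 t : 0 <= len t by rewrite !mulr_ge0 ?invr_ge0 ?exprn_ge0 // ltW.
pose l (t : nat) := (Num.truncn (len t)).+1.
have lle t : (l t).-1%:R <= len t by have /andP[] := truncn_itv (len0 t).
have lge t : len t <= (l t)%:R by have /andP[_ /ltW] := truncn_itv (len0 t).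
pose q := \prod_(t < M) box (l t) ^+ (2 ^ (p * t)).
have boxX1 t : (box (l t) ^+ (2 ^ (p * t))).[1] = 1.
  by rewrite horner_exp box_at1 // expr1n.
have qp : pospoly q.
  apply: big_ind => [||t _]; [exact: pospoly1|exact: pospolyM|].
  exact/pospolyX/box_pos.
have q1 : q.[1] = 1 by rewrite horner_prod big1.
have qs : (size q).-1%:R <= M%:R * r / 16 :> R.
  have h : (size q <= (\sum_(t < M) (l t).-1 * 2 ^ (p * t))%N + 1)%N.
    rewrite /q; elim/big_rec2: _ => [|t x y _ ih]; first by rewrite size_poly1.
    apply: leq_trans (size_mul_le (size_expleq _ _) ih) _.
    rewrite addnA addn1 /= addnAC leq_add2r leq_add2r leq_mul2r.
    by apply/orP; right; rewrite -subn1 leq_subLR; exact: size_box.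
  apply: (@le_trans _ _ (\sum_(t < M) (l t).-1 * 2 ^ (p * t))%N%:R).
    by rewrite ler_nat -subn1 leq_subLR addnC.
  rewrite natr_sum.
  apply: (@le_trans _ _ (\sum_(t < M) M%:R * r / 32 * 2^-1 ^+ t)).
    apply: ler_sum => t _; rewrite natrM.
    apply: (@le_trans _ _ (len t * (2 ^ (p * t))%:R)); first by rewrite ler_wpM2r.
    rewrite /len natrX mulSn exprD exprVn.
    have A0 : 2 ^+ (p * t) != 0 :> R by rewrite expf_neq0.
    have B0 : 2 ^+ t != 0 :> R by rewrite expf_neq0.
    rewrite le_eqVlt; apply/orP; left; apply/eqP.
    by move: A0 B0; set A := 2 ^+ (p * t); set B := 2 ^+ t => A0 B0; field; rewrite A0 B0.
  rewrite -mulr_sumr.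
  have := @sum_geo_le R 2^-1 M ltac:(lra) ltac:(lra).
  set S := \sum_(_ < _) _ => hS.
  have hS2 : S <= 2 by apply: le_trans hS _; rewrite [X in X <= _](_ : _ = 2) //; field.
  have x0 : 0 <= M%:R * r by rewrite mulr_ge0 // ltW.
  nra.
exists q; split => //.
  move=> i qi.
  have iq : (i < size q)%N.
    by rewrite ltnNge; apply: contra qi => h; rewrite nth_default.
  rewrite ler_pdivrMr //.
  have hi : i%:R <= M%:R * r / 16 :> R.
    by apply: le_trans qs; rewrite ler_nat -ltnS (ltn_predK iq).
  have i0 : 0 <= i%:R :> R by [].
  have pi4 : pi <= 4 :> R by have := pihalf_lt2 R; lra.
  have := pi_ge0 R; nra.
move=> k y kK y1 hy.
set x : R := r * k%:R.
have x0 : 0 <= x by rewrite mulr_ge0 // ltW.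
suff main : rnorm q.[y] <= 2 * expR (- (ln 2 * (D^-1 * x) `^ b)).
  apply: le_trans main _; rewrite ler_pM2l // ler_expR lerN2.
  have -> : (D^-1 * x) `^ b = D^-1 `^ b * x `^ b.
    by rewrite powRM // invr_ge0 ltW.
  by rewrite mulrA ler_wpM2r ?powR_ge0.
(* Below the first scale no box is known to halve; |q| <= 1 suffices there because the factor 2
   offsets exp(-ln 2). *)
have [xs|xs] := ltP x (2 * 32).
  apply: le_trans (pospoly_le1 qp q1 y1) _.
  have : (D^-1 * x) `^ b <= 1 `^ b.
    rewrite ge0_ler_powR ?nnegrE ?mulr_ge0 ?invr_ge0 // ?ltW //.
    rewrite mulrC ltr_pdivrMr // mul1r; apply: lt_le_trans xs _.
    rewrite /D mulrC ler_pM2l //.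
    by rewrite -[X in X <= _]expr1 ler_eXn2l // ltr1n.
  rewrite powR1 => h.
  apply: (@le_trans _ _ (2 * expR (- ln 2))); last first.
    by rewrite ler_pM2l // ler_expR lerN2 ler_piMr // ltW.
  by rewrite expRN lnK ?posrE // divff.
have kp : (0 < k)%N.
  by rewrite lt0n; apply/eqP => h; move: xs; rewrite /x h mulr0; lra.
have kR : 0 < k%:R :> R by rewrite ltr0n.
(* the last scale at which all the boxes halve the value *)
have exP : exists t, (32 * 2 * 2 ^+ (p.+1 * t) <= x :> R).
  by exists 0%N; rewrite muln0 expr0 mulr1; lra.
have ubP t : (32 * 2 * 2 ^+ (p.+1 * t) <= x :> R) -> (t <= K)%N.
  move=> ht; have xk : x <= k%:R by rewrite /x ler_piMl.
  have : t%:R <= 2 ^+ (p.+1 * t) :> R.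
    rewrite -natrX ler_nat; apply: ltnW; apply: leq_trans (ltn_expl t (ltnSn 1)) _.
    by rewrite leq_exp2l // leq_pmull.
  have P0 : 0 <= 2 ^+ (p.+1 * t) :> R by rewrite exprn_ge0.
  rewrite -(ler_nat R) => h; apply: (@le_trans _ _ k%:R); last by rewrite ler_nat.
  nra.
case: (@ex_maxnP (fun t => (32 * 2 * 2 ^+ (p.+1 * t) <= x :> R)) K exP ubP) => t ht hmax.
have tM : (t < M)%N by rewrite /M ltnS (leq_trans (ubP t ht)) // -addnn leq_addr.
have hnext : x < 32 * 2 * 2 ^+ (p.+1 * t.+1).
  by rewrite ltNge; apply/negP => /hmax; rewrite ltnn.
have yn : y != 1.
  apply/eqP => e; move: hy; rewrite e subrr rnorm0 leNgt => /negP; apply.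
  by rewrite divr_gt0 // mulr_gt0.
(* By the choice of t, [len t * (2 * k%:R / M%:R)] equals 2 x / (32 * 2^((p+1)t)) >= 4, so the decay
   estimate gives at most 2/4. *)
have hb : rnorm ((box (l t)).[y]) <= 2^-1.
  apply: le_trans (box_decay _ y1 yn) _ => //.
  have lt0 : 0 < (l t)%:R :> R by rewrite ltr0n.
  have yp : 0 < rnorm (y - 1).
    by rewrite lt_neqAle rnorm_ge0 eq_sym rnorm_eq0 subr_eq0 yn.
  rewrite ler_pdivrMr ?mulr_gt0 //.
  rewrite -ler_pdivrMl // invrK.
  apply: (@le_trans _ _ (len t * (2 * k%:R / M%:R))); last first.
    by apply: ler_pM; rewrite // ?divr_ge0 ?mulr_ge0.
  have -> : len t * (2 * k%:R / M%:R) = 2 * x / 32 / 2 ^+ (p.+1 * t).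
    rewrite /len /x; field; rewrite (gt_eqF MR) andbT.
    by rewrite expf_neq0.
  by rewrite ler_pdivlMr ?exprn_gt0 //; lra.
have hq : rnorm q.[y] <= 2^-1 ^+ (2 ^ (p * t)).
  rewrite horner_prod rnorm_prod (bigD1 (Ordinal tM)) //=.
  rewrite horner_exp rnormX.
  apply: (@le_trans _ _ (2^-1 ^+ (2 ^ (p * t)) * 1)); last by rewrite mulr1.
  apply: ler_pM; rewrite ?exprn_ge0 ?rnorm_ge0 //.
  - by apply: prodr_ge0 => j _; rewrite rnorm_ge0.
  - by apply: lerXn2r; rewrite ?nnegrE ?rnorm_ge0 //; lra.
  apply: prodr_ile1 => j _; rewrite rnorm_ge0 /=.
  by apply: pospoly_le1; [exact/pospolyX/box_pos|exact: boxX1|].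
have hpow : (D^-1 * x) `^ b <= 2 ^+ (p * t).
  have -> : 2 ^+ (p * t) = (2 ^+ (p.+1 * t)) `^ b :> R.
    rewrite -!powR_mulrn ?exprn_ge0 // -powRrM; congr (_ `^ _).
    by rewrite /b !natrM; field; rewrite gt_eqF.
  rewrite ge0_ler_powR ?nnegrE ?mulr_ge0 ?exprn_ge0 ?invr_ge0 // ?ltW //.
  rewrite ltr_pdivrMl //; apply: lt_le_trans hnext _.
  rewrite /D mulnS exprD [2 ^+ p.+2]exprS; lra.
apply: le_trans hq _.
have -> : 2^-1 ^+ (2 ^ (p * t)) = expR (- (ln 2 * 2 ^+ (p * t))) :> R.
  by rewrite -mulNr -natrX expRM_natr expRN lnK ?posrE.
apply: (@le_trans _ _ (1 * expR (- (ln 2 * (D^-1 * x) `^ b)))); last first.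
  by rewrite ler_wpM2r ?expR_ge0 // ler1n.
by rewrite mul1r ler_expR lerN2 ler_wpM2l // ltW.
Qed.

End Bump.

(** * Cut-offs at roots of unity *)

Section Cutoff.
Variable R : realType.
Local Notation C := R[i].
Variables (K : nat) (q : {poly C}).
Local Notation M := (K.*2.+1).
Local Notation rho := (rho R M).

(** As K + 1 = -K modulo M, this is rho^(K - i): the index i stands for the frequency i - K, and
    among i < M the node is 1 exactly for i = K. *)
Definition node (i : nat) : C := (rho^-1) ^+ (i + K.+1).

(* Up to the factor 'X^K, the trigonometric polynomial of degree K taking the
   value q`_l at rho ^+ (a + l) and 0 at the other M-th roots of unity. *)
Definition cutpt (a : nat) : {poly C} :=
  \poly_(i < M) (M%:R^-1 * node i ^+ a * q.[node i]).

Definition cutset (u : pred nat) : {poly C} := \sum_(a < M | u a) cutpt a.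

Lemma rnorm_node i : rnorm (node i) = 1.
Proof. by rewrite rnormX rnormV -[rho]expr1 rnorm_rho invr1 expr1n. Qed.

Lemma nodeM i : node i ^+ M = 1.
Proof. by rewrite /node -exprM mulnC exprM exprVn rhoM // invr1 expr1n. Qed.

Lemma node_chord i : (i < M)%N -> 2 * (dst i K)%:R / M%:R <= rnorm (node i - 1).
Proof.
move=> iM.
have rV k : rnorm (rho^-1 ^+ k - 1) = rnorm (rho ^+ k - 1).
  by rewrite -conj_rhoX -(rnorm_conj (rho ^+ k - 1)) rmorphB rmorph1.
rewrite rV.
case: (leqP K i) => iK.
  have -> : (i + K.+1 = M + dst i K)%N by rewrite /dst; lia.
  by rewrite exprD rhoM // mul1r; apply: rho_chord_ge; rewrite /dst; lia.
have e : rho ^+ (i + K.+1) * rho ^+ dst i K = 1.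
  by rewrite -exprD -(rhoM R (ltn0Sn K.*2)); congr (_ ^+ _); rewrite /dst; lia.
have -> : rnorm (rho ^+ (i + K.+1) - 1) = rnorm (rho ^+ dst i K - 1).
  rewrite [RHS]rnormBC -[LHS]mulr1 -(rnorm_rho R M (dst i K)) -rnormM mulrBl e mul1r //.
by apply: rho_chord_ge; rewrite /dst; lia.
Qed.

Lemma cutpt_coef a i : (i < M)%N -> (cutpt a)`_i = M%:R^-1 * node i ^+ a * q.[node i].
Proof. by move=> h; rewrite coef_poly h. Qed.

Lemma size_cutset u : (size (cutset u) <= M)%N.
Proof.
apply: leq_trans (size_sum _ _ _) _.
by apply/bigmax_leqP => j _; exact: size_poly.
Qed.

Lemma cutset1 a : (a < M)%N -> cutset (pred1 a) = cutpt a.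
Proof. by move=> h; rewrite /cutset (big_pred1 (Ordinal h)). Qed.

Lemma cutset_coef_le u i : rnorm ((cutset u)`_i) <= rnorm (q.[node i]).
Proof.
case: (ltnP i M) => hi; last first.
  by rewrite nth_default ?rnorm0 ?rnorm_ge0 // (leq_trans (size_cutset u)).
rewrite /cutset coef_sum; apply: le_trans (rnorm_sum _ _ _) _.
apply: (@le_trans _ _ (\sum_(a < M) M%:R^-1 * rnorm q.[node i])).
  rewrite [X in X <= _]big_mkcond /=; apply: ler_sum => a _.
  case: ifP => _; last by rewrite mulr_ge0 ?rnorm_ge0.
  by rewrite cutpt_coef // !rnormM rnormV rnorm_nat rnormX rnorm_node expr1n mulr1.
by rewrite sumr_const card_ord -[_ *+ _]mulr_natl mulrA divff ?mul1r // pnatr_eq0.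
Qed.

(** Partition of unity: summing the powers of [node i] over a leaves only the frequency 0, at i = K.
    The monomial of degree K stands for 1, the shift by K being undone in [laurent]. *)
Lemma cutset_all : q.[1] = 1 -> \sum_(a < M) cutpt a = 'X^K.
Proof.
move=> q1; apply/polyP => i; rewrite coef_sum coefXn.
case: (ltnP i M) => hi; last first.
  rewrite big1 ?gtn_eqF //; first by lia.
  by move=> a _; rewrite coef_poly ltnNge hi.
under eq_bigr => a _ do rewrite cutpt_coef // mulrAC.
rewrite -mulr_sumr (sum_root (nodeM i)).
have -> : (node i == 1) = (i == K).
  rewrite /node exprVn invr_eq1 rho_eq1 //.
  apply/idP/eqP => [/dvdnP[c hc]|->]; last by apply/dvdnP; exists 1%N; lia.
  have c1 : c = 1%N by nia.
  by lia.
case: eqP => [->|_]; last by rewrite mulr0.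
have -> : node K = 1.
  rewrite /node; have -> : (K + K.+1 = M)%N by lia.
  by rewrite exprVn rhoM // invr1.
by rewrite q1 mulr1 mulVf // pnatr_eq0.
Qed.

Lemma cutsetC u : q.[1] = 1 -> cutset u + cutset (predC u) = 'X^K.
Proof. by move=> q1; rewrite -cutset_all // [RHS](bigID (fun a : 'I_M => u a)). Qed.

(** Orthogonality of characters: the value at rho^j collects the l with a + l = j modulo M, and the
    remaining power of rho^-1 is the value at that point of the monomial of degree K. *)
Lemma cutpt_value a j : (cutpt a).[rho ^+ j] =
  \sum_(l < size q | (j == a + l %[mod M])%N) q`_l * (rho^-1) ^+ (K.+1 * (a + l)).
Proof.
rewrite horner_poly.
have step (i : 'I_M) : M%:R^-1 * node i ^+ a * q.[node i] * rho ^+ j ^+ i =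
   \sum_(l < size q) M%:R^-1 * q`_l * rho^-1 ^+ (K.+1 * (a + l)) *
     ((rho ^+ i) ^+ j * (rho^-1 ^+ i) ^+ (a + l)).
  rewrite horner_coef mulr_sumr mulr_suml; apply: eq_bigr => l _.
  have -> : node i ^+ l = rho^-1 ^+ (K.+1 * l) * (rho^-1 ^+ i) ^+ l.
    by rewrite /node exprD exprMn mulrC -!exprM.
  have -> : node i ^+ a = rho^-1 ^+ (K.+1 * a) * (rho^-1 ^+ i) ^+ a.
    by rewrite /node exprD exprMn mulrC -!exprM.
  have -> : rho ^+ j ^+ i = (rho ^+ i) ^+ j by rewrite -!exprM mulnC.
  rewrite mulnDr !exprD; ring.
under eq_bigr => i _ do rewrite step.
rewrite exchange_big /= [RHS]big_mkcond /=; apply: eq_bigr => l _.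
rewrite -mulr_sumr rho_orth //.
case: ifP => _; last by rewrite mulr0.
by rewrite mulrC !mulrA divff ?mul1r // pnatr_eq0.
Qed.

Lemma cutset_neq0 u j : (cutset u).[rho ^+ j] != 0 ->
  exists a l, [/\ (a < M)%N, u a, q`_l != 0 & (j = a + l %[mod M])%N].
Proof.
move=> h; apply: contrapT => no; case/eqP: h.
rewrite /cutset horner_sum big1 // => a ua; rewrite cutpt_value big1 // => l /eqP jl.
case: (eqVneq q`_l 0) => [->|ql]; first by rewrite mul0r.
by case: no; exists a, l; split.
Qed.

(** For fixed l at most one a below M satisfies a + l = j modulo M, so the moduli add up to at most
    the total mass 1 of q. *)
Lemma cutset_le1 u j : pospoly q -> q.[1] = 1 -> rnorm ((cutset u).[rho ^+ j]) <= 1.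
Proof.
move=> qp q1; rewrite /cutset horner_sum; apply: le_trans (rnorm_sum _ _ _) _.
apply: (@le_trans _ _ (\sum_(a < M) \sum_(l < size q | (j == a + l %[mod M])%N) rnorm q`_l)).
  rewrite [X in X <= _]big_mkcond /=; apply: ler_sum => a _.
  case: ifP => _; last by apply: sumr_ge0 => l _; exact: rnorm_ge0.
  rewrite cutpt_value; apply: le_trans (rnorm_sum _ _ _) _; apply: ler_sum => l _.
  by rewrite rnormM rnormX rnormV -[rho]expr1 rnorm_rho invr1 expr1n mulr1.
rewrite (exchange_big_dep xpredT) //= -(pospoly_coef_sum qp q1).
apply: ler_sum => l _; rewrite sumr_const -[_ *+ _]mulr_natr ler_piMr ?rnorm_ge0 // lern1.
have c1 : (#|[pred a : 'I_M | (j == a + l %[mod M])%N]| <= 1)%N; last exact: c1.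
apply/card_le1P => /= a; rewrite !inE => /eqP ha b; rewrite !inE.
apply/idP/idP => [/eqP hb|/eqP -> ]; last by apply/eqP.
apply/eqP/val_inj => /=; apply: (mod_close (M := M)).
  by have := ltn_ord a; have := ltn_ord b; rewrite /dst; lia.
by apply/eqP; rewrite -(eqn_modDr l) -hb -ha.
Qed.

End Cutoff.

Lemma sum_dst_le (R : realType) (f : nat -> R) n d : (forall k, 0 <= f k) ->
  (d < n)%N -> \sum_(i < n) f (dst i d) <= 2 * \sum_(k < n) f k.
Proof.
move=> f0 dn.
have part m : (m <= n)%N -> \sum_(k < m) f k <= \sum_(k < n) f k.
  move=> mn; rewrite (big_ord_widen _ f mn) big_mkcond /=.
  by apply: ler_sum => k _; case: ifP.
have -> : \sum_(i < n) f (dst i d) = \sum_(i < d + (n - d)) f (dst i d).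
  by rewrite subnKC // ltnW.
rewrite big_split_ord /= mulr_natl mulr2n; apply: lerD.
  rewrite (reindex_inj rev_ord_inj) /=.
  apply: le_trans (part d.+1 dn); rewrite big_ord_recl ler_wpDl //.
  apply: ler_sum => i _; rewrite lift0 le_eqVlt; apply/orP; left; apply/eqP; congr f.
  by rewrite /dst /=; have := ltn_ord i; lia.
apply: le_trans (part (n - d)%N (leq_subr _ _)); apply: ler_sum => i _.
by rewrite le_eqVlt; apply/orP; left; apply/eqP; congr f; rewrite /dst; lia.
Qed.

Section CutoffNorm.
Variable R : realType.
Local Notation C := R[i].

(** The bump decays like exp(-2c(rk)^b). The weight takes back half of the exponent; the other half
    dominates r^2 (1 + k)^2, whose inverse is summable in k. What remains is r^-2, independent of K
    and of [u]. *)
Lemma cutset_wnorm (c b : R) : 0 < c -> 0 < b -> b <= 1 -> exists2 A, 0 < A &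
  forall (r : R) K (q : {poly C}), 0 < r -> r <= 1 ->
  (forall k y, (k <= K)%N -> rnorm y = 1 ->
        2 * k%:R / K.*2.+1%:R <= rnorm (y - 1) ->
        rnorm (q.[y]) <= 2 * expR (- (2 * c * (r * k%:R) `^ b))) ->
  forall u, wnorm (expw (c * r `^ b) b) K (cutset K q u) <= A / r ^+ 2.
Proof.
move=> c0 b0 b1.
have [A A0 HA] := @exp_beats R 0 c 0 b 2 (lexx 0) c0 (lexx 0) b0 (ler0n _ 2).
exists (16 * (1 + A)); first by lra.
move=> r K q r0 r1 hq u.
rewrite (wnorm_wide _ _ (size_cutset K q u)).
pose f (k : nat) : R := 2 * (2 * (1 + A) / r ^+ 2) * (1 + k%:R)^-1 ^+ 2.
have f0 k : 0 <= f k.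
  by rewrite !mulr_ge0 ?invr_ge0 ?sqr_ge0 //; lra.
have r20 : 0 < r ^+ 2 by rewrite exprn_gt0.
apply: (@le_trans _ _ (\sum_(i < K.*2.+1) f (dst i K))).
  apply: ler_sum => i _.
  have dK : (dst i K <= K)%N by have := ltn_ord i; rewrite /dst; lia.
  have h1 := hq _ _ dK (@rnorm_node R K i) (@node_chord R K i (ltn_ord i)).
  have h2 := le_trans (cutset_coef_le K q u i) h1.
  move: h2 dK; move: (dst i K) => k h2 _.
  have k0 : 0 <= k%:R :> R by [].
  rewrite /expw.
  have -> : c * r `^ b * k%:R `^ b = c * (r * k%:R) `^ b.
    by rewrite powRM ?mulrA // ltW.
  set x := r * k%:R in h2 *.
  have x0 : 0 <= x by rewrite mulr_ge0 // ltW.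
  apply: (@le_trans _ _ (2 * expR (- (2 * c * x `^ b)) * expR (c * x `^ b))).
    by rewrite ler_wpM2r ?expR_ge0.
  rewrite -mulrA -expRD.
  have -> : - (2 * c * x `^ b) + c * x `^ b = - (c * x `^ b) by ring.
  rewrite /f -mulrA ler_pM2l // expRN.
  have hx := HA x x0; rewrite mul0r expR0 mulr1 powR_mulrn // in hx.
  have E1 : 1 <= expR (c * x `^ b).
    by rewrite -expR0 ler_expR mulr_ge0 ?powR_ge0 // ltW.
  set E := expR (c * x `^ b) in hx E1 *.
  have hk : (r * (1 + k%:R)) ^+ 2 <= 2 * (1 + A) * E.
    have -> : r * (1 + k%:R) = r + x by rewrite /x; ring.
    have : (r + x) ^+ 2 <= (1 + x) ^+ 2 by clear -r0 r1 x0; apply: lerXn2r; rewrite ?nnegrE; lra.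
    have := sqr_ge0 (1 - x); clearbody E x; clear -hx E1; lra.
  rewrite -[E^-1]mul1r ler_pdivrMr; last exact: lt_le_trans ltr01 E1.
  have k1 : 0 < 1 + k%:R :> R by rewrite ltr_wpDr.
  have -> : 2 * (1 + A) / r ^+ 2 * (1 + k%:R)^-1 ^+ 2 * E =
    (2 * (1 + A) * E) / (r * (1 + k%:R)) ^+ 2.
    by field; rewrite (gt_eqF r0) (gt_eqF k1).
  by rewrite ler_pdivlMr ?exprn_gt0 ?mulr_gt0 // mul1r.
have hs n : \sum_(k < n) f k <= 2 * (2 * (1 + A) / r ^+ 2) * 2.
  rewrite /f -mulr_sumr ler_wpM2l ?sum_invsq_le // !mulr_ge0 ?invr_ge0 ?(ltW r20) //; lra.
have KM : (K < K.*2.+1)%N by lia.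
apply: le_trans (sum_dst_le f0 KM) _.
apply: le_trans (_ : _ <= 2 * (2 * (2 * (1 + A) / r ^+ 2) * 2)) _; first by rewrite ler_pM2l.
by rewrite le_eqVlt; apply/orP; left; apply/eqP; field; rewrite gt_eqF.
Qed.

End CutoffNorm.

(** * Polynomials in an operator *)

Section Distance.
Variable R : realType.
Local Notation C := R[i].
Variable E : set C.
Hypothesis E0 : E !=set0.

Let D (z : C) := [set complex.Re `|z - w| | w in E].

Lemma dist_has_inf z : has_inf (D z).
Proof.
have [w Ew] := E0; split; first by exists (rnorm (z - w)), w.
by exists 0 => _ [u _ <-]; exact: (rnorm_ge0 (z - u)).
Qed.

Lemma dist_le z w : E w -> dist z E <= rnorm (z - w).
Proof. by move=> Ew; apply: ge_inf; [exact: (dist_has_inf z).2|exists w]. Qed.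

Lemma dist_ge0 z : 0 <= dist z E.
Proof.
have [w Ew] := E0; apply: lb_le_inf; first by exists (rnorm (z - w)), w.
by move=> _ [u _ <-]; exact: (rnorm_ge0 (z - u)).
Qed.

Lemma dist_lt z e : dist z E < e -> exists2 w, E w & rnorm (z - w) < e.
Proof.
move=> h; have e0 : 0 < e - dist z E by rewrite subr_gt0.
have [_ [w Ew <-]] := inf_adherent e0 (dist_has_inf z).
by rewrite -/(dist z E) [dist z E + _]addrC subrK => hw; exists w.
Qed.

Lemma dist_lip z w : dist z E <= dist w E + rnorm (z - w).
Proof.
rewrite leNgt; apply/negP => h.
have [u Eu hu] := @dist_lt w (dist z E - rnorm (z - w)) ltac:(lra).
have := dist_le z Eu.
have -> : z - u = (z - w) + (w - u) by rewrite addrA subrK.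
by have := rnormD (z - w) (w - u); lra.
Qed.

Lemma dist_mem z : E z -> dist z E = 0.
Proof.
move=> Ez; apply/eqP; rewrite eq_le dist_ge0 andbT.
by apply: le_trans (dist_le z Ez) _; rewrite subrr rnorm0.
Qed.

End Distance.

Section Calculus.
Variables (R : realType) (X : normedModType R[i]).
Local Notation C := R[i].
Implicit Types (A : {linear X -> X}) (p q : {poly C}) (x y : X).

Definition opoly A p x : X := \sum_(i < size p) p`_i *: iter i A x.

Lemma opoly_wide A p x n : (size p <= n)%N -> opoly A p x = \sum_(i < n) p`_i *: iter i A x.
Proof.
move=> h; rewrite /opoly (big_ord_widen _ (fun i => p`_i *: iter i A x) h).
rewrite big_mkcond /=; apply: eq_bigr => i _; case: ltnP => // hi.
by rewrite nth_default // scale0r.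
Qed.

Lemma opolyD A p q x : opoly A (p + q) x = opoly A p x + opoly A q x.
Proof.
pose n := (size (p + q)%R + size p + size q)%N.
have h1 : (size (p + q)%R <= n)%N by rewrite /n -addnA leq_addr.
have h2 : (size p <= n)%N by rewrite /n addnAC leq_addl.
have h3 : (size q <= n)%N by rewrite /n leq_addl.
rewrite !(opoly_wide _ _ h1) (opoly_wide _ _ h2) (opoly_wide _ _ h3) -big_split /=.
by apply: eq_bigr => i _; rewrite coefD scalerDl.
Qed.

Lemma opolyZ A c p x : opoly A (c *: p) x = c *: opoly A p x.
Proof.
rewrite (opoly_wide _ _ (size_scale_leq c p)) scaler_sumr.
by apply: eq_bigr => i _; rewrite coefZ scalerA.
Qed.

Lemma opoly0 A x : opoly A 0 x = 0.
Proof. by rewrite /opoly size_poly0 big_ord0. Qed.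

Lemma opoly_sum A I (r : seq I) (P : pred I) F x :
  opoly A (\sum_(i <- r | P i) F i) x = \sum_(i <- r | P i) opoly A (F i) x.
Proof. by elim/big_rec2: _ => [|i y z _ <-]; rewrite ?opoly0 ?opolyD. Qed.

Lemma opolyXM A p x : opoly A ('X * p) x = A (opoly A p x).
Proof.
have h : (size ('X * p)%R <= (size p).+1)%N.
  by apply: leq_trans (size_mul_le (eq_leq (size_polyX _)) (leqnn _)) _.
rewrite (opoly_wide _ _ h) big_ord_recl coefXM /= scale0r add0r linear_sum.
by apply: eq_bigr => i _; rewrite coefXM /= linearZ.
Qed.

Lemma opolyC A c x : opoly A c%:P x = c *: x.
Proof. by rewrite (opoly_wide _ _ (size_polyC_leq1 c)) big_ord1 coefC. Qed.

Lemma opoly1 A x : opoly A 1 x = x.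
Proof. by rewrite -[1]/(1%:P) opolyC scale1r. Qed.

Lemma opolyXsubC A l x : opoly A ('X - l%:P) x = A x - l *: x.
Proof. by rewrite -polyCN opolyD opolyC scaleNr -['X]mulr1 opolyXM opoly1. Qed.

Lemma iter_linear A n : exists B : {linear X -> X}, forall x, iter n A x = B x.
Proof.
elim: n => [|n [B hB]]; first by exists idfun.
by exists (A \o B) => x /=; rewrite hB.
Qed.

Lemma iter_linearD A n x y : iter n A (x + y) = iter n A x + iter n A y.
Proof. by have [B hB] := iter_linear A n; rewrite !hB linearD. Qed.

Lemma iter_linearZ A n c x : iter n A (c *: x) = c *: iter n A x.
Proof. by have [B hB] := iter_linear A n; rewrite !hB linearZ. Qed.

Lemma iter_linear_sum A n I (r : seq I) (P : pred I) (F : I -> X) :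
  iter n A (\sum_(i <- r | P i) F i) = \sum_(i <- r | P i) iter n A (F i).
Proof. by have [B hB] := iter_linear A n; rewrite !hB linear_sum; under eq_bigr do rewrite -hB. Qed.

Lemma opoly_comm A p x : opoly A p (A x) = A (opoly A p x).
Proof.
rewrite /opoly linear_sum; apply: eq_bigr => i _.
by rewrite linearZ /= -iterSr.
Qed.

Lemma opolyM A p q x : opoly A (p * q) x = opoly A p (opoly A q x).
Proof.
elim/poly_ind: p q x => [|p c ih] q x; first by rewrite mul0r !opoly0.
rewrite mulrDl !opolyD -mulrA ih opolyXM mul_polyC opolyZ opolyC.
by congr (_ + _); rewrite (mulrC p) opolyXM opoly_comm.
Qed.

Lemma opolyXn A n x : opoly A 'X^n x = iter n A x.
Proof.
elim: n => [|n ih]; first by rewrite expr0 -[1]/(1%:P) opolyC scale1r.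
by rewrite exprS opolyXM ih.
Qed.

End Calculus.

Section Laurent.
Variables (R : realType) (X : normedModType R[i]) (T Tinv : {linear X -> X}).
Local Notation C := R[i].
Hypotheses (TK : cancel T Tinv) (TinvK : cancel Tinv T).
Implicit Types (p q : {poly C}) (x y : X).

(** The operator T^-d p(T). Keeping the shift [d] apart lets ordinary polynomials stand for Laurent
    polynomials. *)
Definition laurent (d : nat) p x : X := iter d Tinv (opoly T p x).

Lemma iterTK n : cancel (iter n T) (iter n Tinv).
Proof. by elim: n => // n ih x; rewrite iterSr (iterS n T) TK ih. Qed.

Lemma opoly_Tinv d p x : opoly T p (iter d Tinv x) = iter d Tinv (opoly T p x).
Proof.
elim: d => // d ih; rewrite !iterS -ih.
by rewrite -[LHS]TK -opoly_comm TinvK.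
Qed.

Lemma laurentM d1 d2 p q x :
  laurent (d1 + d2) (p * q) x = laurent d1 p (laurent d2 q x).
Proof. by rewrite /laurent iterD opolyM opoly_Tinv. Qed.

Lemma laurentXn d x : laurent d 'X^d x = x.
Proof. by rewrite /laurent opolyXn iterTK. Qed.

Lemma laurent0 p x : laurent 0 p x = opoly T p x.
Proof. by []. Qed.

Variable Om : nat -> R.
Hypotheses (hT : forall k x, rnorm (iter k T x) <= Om k * rnorm x)
  (hTinv : forall k x, rnorm (iter k Tinv x) <= Om k * rnorm x).

Lemma laurent_le d p x : rnorm (laurent d p x) <= wnorm Om d p * rnorm x.
Proof.
rewrite /laurent /opoly iter_linear_sum; apply: le_trans (rnorm_sum _ _ _) _.
rewrite /wnorm mulr_suml; apply: ler_sum => i _.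
rewrite iter_linearZ rnormZ -mulrA ler_wpM2l ?rnorm_ge0 //.
case: (leqP d i) => di.
  rewrite -{1}(subnKC di) iterD iterTK.
  by apply: le_trans (hT _ _) _; rewrite /dst (eqP di) addn0.
rewrite -{1}(subnK (ltnW di)) iterD iterTK.
apply: le_trans (hTinv _ _) _.
by have -> : dst i d = (d - i)%N by rewrite /dst; lia.
Qed.

End Laurent.

(** * Cutting off the spectrum *)

Section Vanishing.
Variable R : realType.

Lemma exp_vanish (A c al be h e : R) :
  0 <= A -> 0 < c -> 0 <= al -> al < be -> 0 <= h -> 0 < e ->
  exists2 x0, 1 <= x0 & forall x, x0 <= x ->
    x `^ h * expR (A * x `^ al) * expR (- (c * x `^ be)) <= e.
Proof.
move=> A0 c0 al0 albe h0 e0.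
have [C C0 H] := @exp_beats R A c al be (h + 1) A0 c0 al0 albe ltac:(lra).
exists (1 + C / e); first by rewrite lerDl divr_ge0 // ltW.
move=> x hx; have x0 : 0 < x.
  by apply: lt_le_trans hx; rewrite ltr_wpDr // divr_ge0 // ltW.
have := H x (ltW x0).
rewrite powRD; last by rewrite (gt_eqF x0) implybT.
rewrite powRr1 ?(ltW x0) // expRN.
set P := x `^ h; set Q := expR _; set W := expR _ => hh.
have W0 : 0 < W by exact: expR_gt0.
rewrite ler_pdivrMr //.
have hC : C <= e * x.
  by rewrite mulrC -ler_pdivrMr //; apply: le_trans hx; rewrite lerDr.
have : P * Q * x <= e * W * x by nra.
by rewrite ler_pM2r.
Qed.

Lemma nat_ceil (x : R) : 0 <= x -> exists m : nat, x <= m%:R <= x + 1.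
Proof.
move=> x0; exists (Num.truncn x).+1.
have /andP[h1 /ltW h2] := truncn_itv x0.
by rewrite h2 -natr1 lerD2r.
Qed.

End Vanishing.

Lemma wnorm_le (R : realType) (v w : nat -> R) d (p : {poly R[i]}) :
  (forall k, v k <= w k) -> wnorm v d p <= wnorm w d p.
Proof. by move=> h; apply: ler_sum => i _; rewrite ler_wpM2l ?rnorm_ge0. Qed.

(** The M pieces of the partition of unity are summed here. [G1] carries the coefficient tails and
    [G2] the values at the roots of unity. As M <= 3k, and M occurs twice beside [G2], a factor k^2
    in the two smallness hypotheses is enough. *)
Lemma far_sum_le (R : realType) (k M C0 C1 A1 A2 W G1 G2 e : R) :
  1 <= k -> 0 <= M -> M <= 3 * k -> 0 <= C0 -> 0 <= C1 -> 0 <= A1 -> 0 <= A2 ->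
  0 <= W -> 0 <= G1 -> 0 <= G2 ->
  k ^+ 2 * G1 * (6 * C1 * A1 * A2 + 6 * C1 * C1 * A1 * A2 * W) <= e / 2 ->
  k ^+ 2 * G2 * (9 * C1 * A2 * C0) <= e / 2 ->
  M * (2 * C1 * A1 * A2 * G1 + C1 * A2 * (M * C0 * G2 + 2 * C1 * A1 * W * G1)) <= e.
Proof.
move=> k1 M0 Mk C00 C10 A10 A20 W0 G10 G20 h1 h2.
have k0 : 0 <= 3 * k by lra.
apply: (@le_trans _ _ (3 * k * (2 * C1 * A1 * A2 * G1 +
   C1 * A2 * (3 * k * C0 * G2 + 2 * C1 * A1 * W * G1)))).
  apply: ler_pM => //; first by rewrite !(addr_ge0, mulr_ge0).
  rewrite lerD2l ler_wpM2l ?mulr_ge0 // lerD2r ler_wpM2r // ler_wpM2r //.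
have P1 : 0 <= 2 * C1 * A1 * A2 * G1 by rewrite !mulr_ge0.
have P2 : 0 <= C1 * A2 * (2 * C1 * A1 * W * G1) by rewrite !mulr_ge0.
set Y1 := 2 * C1 * A1 * A2 * G1 in P1 *.
set Y2 := C1 * A2 * (2 * C1 * A1 * W * G1) in P2.
set Y3 := C1 * A2 * (C0 * G2).
have -> : C1 * A2 * (3 * k * C0 * G2 + 2 * C1 * A1 * W * G1) = 3 * k * Y3 + Y2.
  by rewrite /Y3 /Y2; ring.
have e1 : k ^+ 2 * G1 * (6 * C1 * A1 * A2 + 6 * C1 * C1 * A1 * A2 * W) =
   3 * k * (k * (Y1 + Y2)) by rewrite /Y1 /Y2; ring.
have e2 : k ^+ 2 * G2 * (9 * C1 * A2 * C0) = 3 * k * (3 * k * Y3) by rewrite /Y3; ring.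
rewrite e1 in h1; rewrite e2 in h2.
have : 3 * k * (Y1 + Y2) <= 3 * k * (k * (Y1 + Y2)).
  by rewrite ler_wpM2l // ler_peMl // addr_ge0.
have -> : 3 * k * (Y1 + (3 * k * Y3 + Y2)) = 3 * k * (Y1 + Y2) + 3 * k * (3 * k * Y3) by ring.
lra.
Qed.

Definition bump (R : realType) (c b r : R) (K : nat) (q : {poly R[i]}) : Prop :=
  [/\ pospoly q, q.[1] = 1,
      forall i, q`_i != 0 -> 2 * pi * i%:R / K.*2.+1%:R <= r &
      forall k y, (k <= K)%N -> rnorm y = 1 ->
        2 * k%:R / K.*2.+1%:R <= rnorm (y - 1) ->
        rnorm (q.[y]) <= 2 * expR (- (2 * c * (r * k%:R) `^ b))].

Section Small.
Variables (R : realType) (X : normedModType R[i]) (T Tinv : {linear X -> X}).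
Local Notation C := R[i].
Hypotheses (TK : cancel T Tinv) (TinvK : cancel Tinv T).
Variable E : set C.
Hypothesis E0 : E !=set0.
Hypothesis below : forall l : C, rnorm l = 1 -> ~ E l ->
  exists2 B : R, 0 < B & forall y, rnorm y <= B * rnorm (T y - l *: y).

(** The pointwise bound at expi t survives, with its constant doubled, for |u - t| < 1/(2B), and
    compactness of [0, 2 pi] makes it uniform. A point closer than [r0] to E has a neighbourhood on
    which the premise fails. The constant is a parameter tending to +oo. *)
Lemma below_uniform (r0 : R) : 0 < r0 -> exists2 B : R, 1 <= B &
  forall l : C, rnorm l = 1 -> r0 <= dist l E ->
  forall y, rnorm y <= B * rnorm (T y - l *: y).
Proof.
move=> r0_gt0.
pose P (B t : R) := r0 <= dist (expi t) E ->
  forall y, rnorm y <= B * rnorm (T y - expi t *: y).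
have cov : near_covering (`[0%R, 2 * pi]%classic : set R).
  by apply/compact_near_coveringP; exact: segment_compact.
pose F : set_system R := +oo.
have loc (t : R) : `[0%R, 2 * pi]%classic t -> \near t & F, P F t.
  move=> _.
  have [far|near] := leP r0 (dist (expi t) E).
    have nE : ~ E (expi t).
      by move=> Et; move: far; rewrite dist_mem // leNgt r0_gt0.
    have [B B0 hB] := below (rnorm_expi t) nE.
    have B20 : 0 < (2 * B)^-1 by rewrite invr_gt0 mulr_gt0.
    exists (ball t (2 * B)^-1, [set b | 2 * B < b]) => /=.
      split; first exact: nbhsx_ballx.
      by exists (2 * B); split; [rewrite num_real|].
    move=> [u b] /= [hu hb] _ y.
    have hd : rnorm (expi t - expi u) <= (2 * B)^-1.
      by apply: le_trans (expi_lip t u) _; exact: ltW.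
    have h1 : rnorm (T y - expi t *: y) <=
        rnorm (T y - expi u *: y) + (2 * B)^-1 * rnorm y.
      have -> : T y - expi t *: y = (T y - expi u *: y) - (expi t - expi u) *: y.
        by rewrite scalerBl opprB addrA subrK.
      apply: le_trans (rnormB _ _) _; rewrite lerD2l rnormZ ler_wpM2r ?rnorm_ge0 //.
    have h2 := hB y.
    have h3 : B * ((2 * B)^-1 * rnorm y) = rnorm y / 2.
      by field; rewrite gt_eqF.
    have h4 : rnorm y <= 2 * B * rnorm (T y - expi u *: y).
      have : B * rnorm (T y - expi t *: y) <=
        B * (rnorm (T y - expi u *: y) + (2 * B)^-1 * rnorm y) by rewrite ler_wpM2l // ltW.
      rewrite mulrDr h3; lra.
    by apply: le_trans h4 _; rewrite ler_wpM2r ?rnorm_ge0 // ltW.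
  have e0 : 0 < r0 - dist (expi t) E by rewrite subr_gt0.
  exists (ball t (r0 - dist (expi t) E), setT) => /=.
    by split; [exact: nbhsx_ballx|exact: filterT].
  move=> [u b] /= [hu _]; rewrite /P leNgt => /negP[].
  apply: le_lt_trans (dist_lip E0 (expi u) (expi t)) _.
  have := expi_lip u t; rewrite distrC.
  by move: hu; rewrite /ball /=; lra.
have [B0 [_ hB]] := cov R F P _ loc.
exists (Num.max 1 (B0 + 1)); first by rewrite le_max lexx.
move=> l l1 hl y.
have [t /andP[t0 t1] el] := circle_expi l1.
have hb : B0 < Num.max 1 (B0 + 1) by rewrite lt_max ltrDl ltr01 orbT.
move: hl; rewrite el => hl; apply: (hB _ hb t _ hl y).
by rewrite /= in_itv /= t0 ltW.
Qed.

Variables (C0 beta : R).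
Hypotheses (C0_gt0 : 0 < C0) (beta_gt0 : 0 < beta).
Let Om k := C0 * expR (k%:R `^ beta).
Hypotheses (hT : forall k x, rnorm (iter k T x) <= Om k * rnorm x)
  (hTinv : forall k x, rnorm (iter k Tinv x) <= Om k * rnorm x).

Let Om_ge0 k : 0 <= Om k.
Proof. by rewrite mulr_ge0 ?expR_ge0 // ltW. Qed.

Let Om_homo : {homo Om : k l / (k <= l)%N >-> k <= l}.
Proof.
move=> k l kl; rewrite ler_pM2l // ler_expR ge0_ler_powR ?nnegrE ?ler_nat //.
exact: ltW.
Qed.

Lemma laurent_fold d (p : {poly C}) (eta : R) K M x :
  (K.*2 < M)%N -> 0 <= eta ->
  (forall j, (j < M)%N -> rnorm (p.[rho R M ^+ j]) <= eta) ->
  forall (v : nat -> R) e, (forall k, 0 <= v k) -> 0 <= e ->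
  (forall k, (K < k)%N -> Om k <= e * v k) ->
  rnorm (laurent T Tinv d p x) <=
    (K.*2.+1%:R * eta * Om K + 2 * (e * wnorm v d p)) * rnorm x.
Proof.
move=> KM eta0 hp v e v0 e0 hv.
apply: le_trans (laurent_le TK hT hTinv d p x) _.
rewrite ler_wpM2r ?rnorm_ge0 //.
apply: le_trans (fold_sum_le d Om_ge0 Om_homo KM eta0 hp) _.
by rewrite lerD2l ler_pM2l // wnorm_tail.
Qed.

Variables (c b : R).
Hypotheses (c_gt0 : 0 < c) (b_gt0 : 0 < b) (b_le1 : b <= 1) (beta_b : beta < b).

(** Of the exponent a k^b of the weight, one half dominates k^beta up to a constant, since beta < b;
    the other half is the gain exp(-(a/2) K^b). *)
Lemma Om_tail (a : R) : 0 < a -> exists2 C1, 0 < C1 & forall K k, (K <= k)%N ->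
  Om k <= C1 * expR (- (a / 2 * K%:R `^ b)) * expw a b k.
Proof.
move=> a0.
have [D D0 HD] := @powR_ltC R 1 (a / 2) beta b ler01 ltac:(lra) (ltW beta_gt0) beta_b.
exists (C0 * expR D); first by rewrite mulr_gt0 ?expR_gt0.
move=> K k Kk; rewrite /Om -!mulrA ler_pM2l // /expw -!expRD ler_expR.
have := HD k%:R (ler0n _ _); rewrite mul1r.
have : K%:R `^ b <= k%:R `^ b by rewrite ge0_ler_powR ?nnegrE ?ler_nat // ltW.
by nra.
Qed.

(* Far from [E] the operators [T - l] are bounded below, uniformly; a cut-off
   chi of width tau < 1/B near l satisfies |chi(T)y| <= B^m |((z-l)^m chi)(T)y|,
   and (z-l)^m chi is as small as tau^m at the roots of unity. *)
Lemma far_small (r e : R) : 0 < r -> r <= 1 -> 0 < e ->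
  (forall tau K, 0 < tau -> tau <= 1 -> exists q, bump c b tau K q) ->
  exists K0, forall K q, (K0 <= K)%N -> bump c b (r / 2) K q ->
  forall x, rnorm (laurent T Tinv K
      (cutset K q [pred a | r <= dist (rho R K.*2.+1 ^+ a) E]) x) <= e * rnorm x.
Proof.
move=> r0 r1 e0 hbump.
have [B B1 hB] := @below_uniform (r / 4) ltac:(lra).
(* [tau <= (2 * B)^-1] makes B^m tau^m <= 2^-m; [tau <= r / 8] keeps the cut-off well within r/4 of
   its centre, as the case near E requires. *)
pose tau := Num.min (r / 8) (2 * B)^-1.
have tau0 : 0 < tau by rewrite lt_min invr_gt0; apply/andP; split; lra.
have tau8 : tau <= r / 8 by rewrite ge_min lexx.
have tauB : B * tau <= 1 / 2.
  have : tau <= (2 * B)^-1 by rewrite ge_min lexx orbT.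
  rewrite -(ler_pM2l (lt_le_trans ltr01 B1)) => h; apply: le_trans h _.
  by rewrite le_eqVlt; apply/orP; left; apply/eqP; field; rewrite gt_eqF //; lra.
have rh0 : 0 < r / 2 by lra.
have rh1 : r / 2 <= 1 by lra.
have tau1 : tau <= 1 by lra.
have taur : tau <= r / 2 by lra.
have tau4 : tau <= r / 4 by lra.
clearbody tau.
pose a := c * tau `^ b.
have a0 : 0 < a by rewrite mulr_gt0 ?powR_gt0.
pose v := expw a b.
have v0 k : 0 <= v k by exact: expw_ge0.
have vM := expwM (ltW a0) b_gt0 b_le1.
have vh := expw_homo (ltW a0) b_gt0.
have [C1 C10 hC1] := Om_tail a0.
have [A A0 hA] := cutset_wnorm c_gt0 b_gt0 b_le1.
pose A1 := A / tau ^+ 2; pose A2 := A / (r / 2) ^+ 2.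
have A10 : 0 < A1 by rewrite divr_gt0 // exprn_gt0.
have A20 : 0 < A2 by rewrite divr_gt0 // exprn_gt0 //; lra.
have hA1 := hA tau; have hA2 := hA (r / 2); rewrite -/A1 in hA1; rewrite -/A2 in hA2.
clearbody A1 A2.
(* Bounds the weighted norm of each linear factor, so that m of them cost V^m. *)
pose V := 2 * v 1%N.
have V1 : 1 <= V.
  have : 1 <= v 1%N by rewrite -(expw0 a b_gt0); apply: vh.
  by rewrite /V; lra.
have Vx (l : C) : rnorm l = 1 -> wnorm v 0 ('X - l%:P) <= V.
  move=> l1; have -> : wnorm v 0 ('X - l%:P) =
      rnorm ('X - l%:P)`_0 * v 0%N + rnorm ('X - l%:P)`_1 * v 1%N.
    by rewrite /wnorm size_XsubC big_ord_recl big_ord1.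
  rewrite !coefB !coefX !coefC sub0r subr0 rnormN l1 rnorm1 !mul1r.
  have : v 0%N <= v 1%N by apply: vh.
  by rewrite /V; move: (v 0%N) (v 1%N) => v0' v1'; lra.
clearbody V.
have Bp : 0 < B by lra.
have Vp : 0 < V by lra.
have BV0 : 0 < B * V by rewrite mulr_gt0.
have Bge0 := ltW Bp.
have Vge0 := ltW Vp.
have C1ge0 := ltW C10; have A1ge0 := ltW A10; have A2ge0 := ltW A20; have C0ge0 := ltW C0_gt0.
(* The multiplicity m will be about K^b1. Since beta < b1, 2^-m beats exp(K^beta); since b1 < b,
   (BV)^m is beaten by the tail gain exp(-(a/2) K^b). *)
pose b1 := (beta + b) / 2.
have hb1 : 0 < b1 by rewrite divr_gt0 // addr_gt0.
have b1l : beta < b1 by rewrite ltr_pdivlMr // mulrDr mulr1 ltrD2l.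
have b1r : b1 < b by rewrite ltr_pdivrMr // mulrDr mulr1 ltrD2r.
pose La := ln (B * V).
have BV1 : 1 <= B * V by rewrite -[1]mulr1; apply: ler_pM.
have La0 : 0 <= La by rewrite ln_ge0.
pose D1 := 6 * C1 * A1 * A2 + 6 * C1 * C1 * A1 * A2 * (B * V).
pose D2 := 9 * C1 * A2 * C0.
have D10 : 0 < D1.
  by rewrite addr_gt0 // !mulr_gt0.
have D20 : 0 < D2 by rewrite !mulr_gt0.
have ln2 : 0 < ln (2 : R) by rewrite ln_gt0 // ltr1n.
have [x1 x11 Hx1] := @exp_vanish R La (a / 2) b1 b 2 (e / 2 / D1) La0
  (divr_gt0 a0 (ltr0Sn _ 1)) (ltW hb1) b1r (ler0n R 2) ltac:(by rewrite !divr_gt0).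
have [x2 x21 Hx2] := @exp_vanish R 1 (ln 2) beta b1 2 (e / 2 / D2) ler01 ln2
  (ltW beta_gt0) b1l (ler0n R 2) ltac:(by rewrite !divr_gt0).
have [K0 hK0] := nat_above (Num.max x1 x2).
exists K0 => K q K0K [qp q1 qs qd] x.
have KR : Num.max x1 x2 <= K%:R by apply: le_trans hK0 _; rewrite ler_nat.
have Kx1 : x1 <= K%:R by apply: le_trans KR; rewrite le_max lexx.
have Kx2 : x2 <= K%:R by apply: le_trans KR; rewrite le_max lexx orbT.
have K1 : 1 <= K%:R :> R by exact: le_trans x11 Kx1.
have [m /andP[m1 m2]] := @nat_ceil R (K%:R `^ b1) (powR_ge0 _ _).
have [qt [tp t1 ts td]] := hbump tau K tau0 tau1.
set M := K.*2.+1.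
set u := [pred a | _]; set W := cutset K q u.
have MR : 0 < M%:R :> R by rewrite ltr0n.
have M3 : M%:R <= 3 * K%:R :> R.
  have K1n : (1 <= K)%N by move: K1; rewrite -[1]/(1%:R) ler_nat.
  by rewrite -natrM ler_nat /M; clear -K1n; lia.
pose eK := C1 * expR (- (a / 2 * K%:R `^ b)).
have eK0 : 0 <= eK by rewrite mulr_ge0 ?expR_ge0 // ltW.
have heK k : (K < k)%N -> Om k <= eK * v k by move=> /ltnW; exact: hC1.
have wW : wnorm v K W <= A2.
  apply: le_trans _ (hA2 K q rh0 rh1 qd u).
  apply: wnorm_le => k; rewrite ler_expR ler_wpM2r ?powR_ge0 //.
  by rewrite ler_pM2l // ge0_ler_powR ?nnegrE ?(ltW b_gt0) ?(ltW tau0) ?(ltW rh0).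
have wchi j : (j < M)%N -> wnorm v K (cutpt K qt j) <= A1.
  by move=> jM; rewrite -cutset1 //; apply: hA1.
have nW y : rnorm (laurent T Tinv K W y) <= C1 * A2 * rnorm y.
  apply: le_trans (laurent_le TK hT hTinv K W y) _.
  rewrite ler_wpM2r ?rnorm_ge0 //; apply: (@le_trans _ _ (C1 * wnorm v K W)).
    rewrite /wnorm mulr_sumr; apply: ler_sum => i _; rewrite [X in _ <= X]mulrCA ler_wpM2l ?rnorm_ge0 //.
    have := hC1 0%N (dst i K) (leq0n _).
    by rewrite powR0 ?gt_eqF // mulr0 oppr0 expR0 mulr1.
  by rewrite ler_pM2l.
have KM : (K.*2 < M)%N by [].
have shift j k l w : (j = k + l %[mod M])%N -> 2 * pi * l%:R / M%:R <= w ->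
   rnorm (rho R M ^+ j - rho R M ^+ k) <= w.
  move=> jk hw; have -> : rho R M ^+ j = rho R M ^+ (k + l).
    have red n : rho R M ^+ n = rho R M ^+ (n %% M).
      by rewrite {1}(divn_eq n M) exprD mulnC exprM rhoM // expr1n mul1r.
    by rewrite red jk -red.
  rewrite exprD -{2}[rho R M ^+ k]mulr1 -mulrBr rnormM rnorm_rho mul1r.
  exact: le_trans (rho_chord_le _ _ _) hw.
(* W is assembled from points at distance at least r from E, and the bump moves a point by at most
   r/2. *)
have Wzero j : dist (rho R M ^+ j) E < r / 2 -> W.[rho R M ^+ j] = 0.
  move=> hj; apply/eqP; apply: contraTT hj => /cutset_neq0[k [l [kM]]].
  rewrite /u /= => uk ql jk; rewrite -leNgt.
  rewrite -(lerD2r (r / 2)) -splitr.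
  apply: le_trans uk (le_trans (dist_lip E0 (rho R M ^+ k) (rho R M ^+ j)) _).
  by rewrite lerD2l rnormBC; exact: shift jk (qs _ ql).
have chinz j k : (k < M)%N -> (cutpt K qt k).[rho R M ^+ j] != 0 ->
    rnorm (rho R M ^+ j - rho R M ^+ k) <= tau.
  move=> kM; rewrite -cutset1 // => /cutset_neq0[k' [l [_]]].
  by rewrite /= => /eqP -> ql jk; exact: shift jk (ts _ ql).
have chile j k : (k < M)%N -> rnorm (cutpt K qt k).[rho R M ^+ j] <= 1.
  by move=> kM; rewrite -cutset1 //; exact: cutset_le1.
pose G1 := expR (La * K%:R `^ b1) * expR (- (a / 2 * K%:R `^ b)).
pose G2 := expR (K%:R `^ beta) * expR (- (ln 2 * K%:R `^ b1)).
have G10 : 0 <= G1 by rewrite mulr_ge0 ?expR_ge0.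
have G20 : 0 <= G2 by rewrite mulr_ge0 ?expR_ge0.
have U1 : 0 <= 2 * C1 * A1 * A2 * G1.
  exact: mulr_ge0 (mulr_ge0 (mulr_ge0 (mulr_ge0 (ler0n _ 2) C1ge0) A1ge0) A2ge0) G10.
have U2 : 0 <= M%:R * C0 * G2 + 2 * C1 * A1 * (B * V) * G1.
  exact: addr_ge0 (mulr_ge0 (mulr_ge0 (ltW MR) C0ge0) G20)
    (mulr_ge0 (mulr_ge0 (mulr_ge0 (mulr_ge0 (ler0n _ 2) C1ge0) A1ge0) (ltW BV0)) G10).
have U3 : 0 <= C1 * A2 by exact: mulr_ge0.
have eKG : eK <= C1 * G1.
  apply: ler_wpM2l; first exact: C1ge0.
  rewrite -[leLHS]mul1r; apply: ler_wpM2r; first exact: expR_ge0.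
  by rewrite -expR0 ler_expR mulr_ge0 ?powR_ge0.
have piece k : (k < M)%N ->
   rnorm (laurent T Tinv K (cutpt K qt k) (laurent T Tinv K W x)) <=
   (2 * C1 * A1 * A2 * G1 + C1 * A2 * (M%:R * C0 * G2 + 2 * C1 * A1 * (B * V) * G1)) * rnorm x.
  move=> kM; set chi := cutpt K qt k.
  (* Far from E the operator T - l is inverted m times. Near E the product of the cut-off with W
     vanishes at every M-th root of unity, so that only the coefficient tail remains. *)
  have [far|near] := leP (r / 4) (dist (rho R M ^+ k) E).
    set l := rho R M ^+ k in far.
    have l1 : rnorm l = 1 by rewrite rnorm_rho.
    set y := laurent T Tinv K W x.
    have powB n z : rnorm z <= B ^+ n * rnorm (opoly T (('X - l%:P) ^+ n) z).
      elim: n z => [|n ih] z; first by rewrite !expr0 opoly1 mul1r.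
      apply: le_trans (ih z) _; rewrite exprSr -mulrA ler_wpM2l ?exprn_ge0 //.
      have := hB _ l1 far (opoly T (('X - l%:P) ^+ n) z).
      by rewrite exprS opolyM opolyXsubC.
    have h1 := powB m (laurent T Tinv K chi y).
    have e1 : opoly T (('X - l%:P) ^+ m) (laurent T Tinv K chi y) =
        laurent T Tinv K (('X - l%:P) ^+ m * chi) y.
      by rewrite -[X in laurent _ _ X]add0n laurentM.
    rewrite e1 in h1.
    have root j : (j < M)%N -> rnorm (('X - l%:P) ^+ m * chi).[rho R M ^+ j] <= tau ^+ m.
      move=> jM; rewrite hornerM horner_exp hornerXsubC rnormM rnormX.
      have [->|nz] := eqVneq (chi.[rho R M ^+ j]) 0.
        by rewrite rnorm0 mulr0 exprn_ge0 // ltW.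
      rewrite -[X in _ <= X]mulr1; apply: ler_pM; rewrite ?exprn_ge0 ?rnorm_ge0 //.
        by apply: lerXn2r; rewrite ?nnegrE ?rnorm_ge0 ?(ltW tau0) //; exact: chinz.
      exact: chile.
    have h2 := @laurent_fold K (('X - l%:P) ^+ m * chi) (tau ^+ m) K M y KM
      (exprn_ge0 _ (ltW tau0)) root v eK v0 eK0 heK.
    have w1 : wnorm v K (('X - l%:P) ^+ m * chi) <= V ^+ m * A1.
      rewrite -[X in wnorm v X]add0n; apply: le_trans (wnormM v0 vM vh _ _ _ _) _.
      apply: ler_pM; rewrite ?wnorm_ge0 //; last exact: wchi.
      apply: le_trans (wnormX0 v0 vM vh _ _ _) _; first by rewrite /v expw0.
      by apply: lerXn2r; rewrite ?nnegrE ?wnorm_ge0 ?Vx.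
    have mR : 2^-1 ^+ m <= expR (- (ln 2 * K%:R `^ b1)).
      have -> : 2^-1 ^+ m = expR (- (ln 2 * m%:R)) :> R.
        by rewrite -mulNr expRM_natr expRN lnK ?posrE.
      by rewrite ler_expR lerN2 ler_pM2l.
    have bv : (B * V) ^+ m <= B * V * expR (La * K%:R `^ b1).
      have -> : (B * V) ^+ m = expR (La * m%:R) by rewrite expRM_natr lnK.
      rewrite -(@lnK R (B * V)) ?posrE // -/La -expRD ler_expR.
      by rewrite -[X in _ <= X + _]mulr1 -mulrDr ler_wpM2l // addrC.
    have bt : B ^+ m * tau ^+ m <= 2^-1 ^+ m.
      by rewrite -exprMn; apply: lerXn2r; rewrite ?nnegrE ?mulr_ge0 ?(ltW tau0) // -div1r.
    have Bm0 : 0 <= B ^+ m by rewrite exprn_ge0.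
    have t1' : B ^+ m * (M%:R * tau ^+ m * Om K) <= M%:R * C0 * G2.
      have -> : B ^+ m * (M%:R * tau ^+ m * Om K) = (B ^+ m * tau ^+ m) * (M%:R * Om K) by ring.
      have -> : M%:R * C0 * G2 = expR (- (ln 2 * K%:R `^ b1)) * (M%:R * Om K).
        by rewrite /Om /G2; ring.
      by apply: ler_wpM2r; [exact: mulr_ge0 (ler0n _ _) (Om_ge0 K)|exact: le_trans bt mR].
    have t2' : B ^+ m * (2 * (eK * wnorm v K (('X - l%:P) ^+ m * chi))) <=
       2 * C1 * A1 * (B * V) * G1.
      apply: (@le_trans _ _ (B ^+ m * (2 * (eK * (V ^+ m * A1))))).
        by rewrite ler_wpM2l // ler_pM2l // ler_wpM2l.
      have -> : B ^+ m * (2 * (eK * (V ^+ m * A1))) = (B * V) ^+ m * (2 * eK * A1).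
        by rewrite exprMn; ring.
      have -> : 2 * C1 * A1 * (B * V) * G1 =
        (B * V * expR (La * K%:R `^ b1)) * (2 * eK * A1) by rewrite /G1 /eK; ring.
      by apply: ler_wpM2r bv; exact: mulr_ge0 (mulr_ge0 (ler0n _ 2) eK0) A1ge0.
    have ny := nW x; rewrite -/y in ny.
    apply: le_trans h1 _.
    apply: (@le_trans _ _ ((M%:R * C0 * G2 + 2 * C1 * A1 * (B * V) * G1) * rnorm y)).
      apply: (@le_trans _ _ (B ^+ m * ((M%:R * tau ^+ m * Om K +
         2 * (eK * wnorm v K (('X - l%:P) ^+ m * chi))) * rnorm y))).
        by rewrite ler_wpM2l.
      rewrite [leLHS]mulrA; apply: ler_wpM2r; first exact: rnorm_ge0.
        by rewrite mulrDr; exact: lerD t1' t2'.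
    set Z := M%:R * C0 * G2 + _.
    have Z0 : 0 <= Z := U2.
    apply: (@le_trans _ _ (Z * (C1 * A2 * rnorm x))); first by rewrite ler_wpM2l.
    have -> : Z * (C1 * A2 * rnorm x) = (C1 * A2 * Z) * rnorm x by ring.
    by apply: ler_wpM2r; [exact: rnorm_ge0|rewrite lerDr].
  rewrite -laurentM //.
  have root j : (j < M)%N -> rnorm (chi * W).[rho R M ^+ j] <= 0.
    move=> jM; rewrite hornerM.
    have [->|nz] := eqVneq (chi.[rho R M ^+ j]) 0; first by rewrite mul0r rnorm0.
    rewrite Wzero ?mulr0 ?rnorm0 //.
    apply: le_lt_trans (dist_lip E0 (rho R M ^+ j) (rho R M ^+ k)) _.
    have -> : r / 2 = r / 4 + r / 4 by field.
    exact: ltr_leD near (le_trans (chinz _ _ kM nz) tau4).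
  have := @laurent_fold (K + K) (chi * W) 0 K M x KM (lexx 0) root v eK v0 eK0 heK.
  rewrite mulr0 mul0r add0r => h; apply: le_trans h _; rewrite ler_wpM2r ?rnorm_ge0 //.
  have w2 : wnorm v (K + K) (chi * W) <= A1 * A2.
    apply: le_trans (wnormM v0 vM vh _ _ _ _) _.
    by apply: ler_pM; rewrite ?wnorm_ge0 // wchi.
  apply: (@le_trans _ _ (2 * C1 * A1 * A2 * G1)).
    apply: (@le_trans _ _ (2 * ((C1 * G1) * (A1 * A2)))).
      by rewrite ler_pM2l //; apply: ler_pM; rewrite ?wnorm_ge0.
    by rewrite le_eqVlt; apply/orP; left; apply/eqP; ring.
  by rewrite lerDl; exact: mulr_ge0 U3 U2.
have -> : laurent T Tinv K W x =
    \sum_(k < M) laurent T Tinv K (cutpt K qt k) (laurent T Tinv K W x).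
  rewrite -[LHS](laurentXn TK K) -(cutset_all K t1) /laurent opoly_sum.
  exact: iter_linear_sum.
apply: le_trans (rnorm_sum _ _ _) _.
set Z := 2 * C1 * A1 * A2 * G1 + _ in piece.
apply: (@le_trans _ _ (\sum_(k < M) Z * rnorm x)).
  by apply: ler_sum => k _; exact: piece.
rewrite sumr_const card_ord -[_ *+ _]mulr_natl mulrA ler_wpM2r ?rnorm_ge0 //.
have hz1 := Hx1 _ Kx1; have hz2 := Hx2 _ Kx2.
rewrite powR_mulrn // -mulrA -/G1 in hz1.
rewrite powR_mulrn // -mulrA mul1r -/G2 in hz2.
have D1' : K%:R ^+ 2 * G1 * D1 <= e / 2 by rewrite -ler_pdivlMr.
have D2' : K%:R ^+ 2 * G2 * D2 <= e / 2 by rewrite -ler_pdivlMr.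
exact: (far_sum_le K1 (ltW MR) M3 C0ge0 C1ge0 A1ge0 A2ge0 (ltW BV0) G10 G20 D1' D2').
Qed.

End Small.

Section PhiNorm.
Variable R : realType.
Local Notation C := R[i].

(** First (1 + r/2)^-k <= exp(-rk/4). As b <= 1 and c <= 1/16, the weight is at most 2 exp(rk/8),
    which leaves exp(-rk/8) to sum. *)
Lemma geometric_wnorm (c b r : R) (f : {poly C}) : 0 < c -> c <= 1 / 16 -> 0 < b -> b <= 1 ->
  0 < r -> r <= 1 -> (forall k, rnorm (f`_k) <= 2 / (1 + r / 2) ^+ k) ->
  wnorm (expw (c * (r / 2) `^ b) b) 0 f <= 64 / r.
Proof.
move=> c0 c1 b0 b1 r0 r1 hf.
have e98 : expR (1 / 16) <= 2 :> R.
  have := @exp_half_le R (1 / 8) ltac:(lra) ltac:(lra).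
  have -> : 1 / 8 / 2 = 1 / 16 :> R by field.
  lra.
apply: (@le_trans _ _ (\sum_(k < size f) 4 * expR (- (r / 8 * k%:R)))).
  apply: ler_sum => k _.
  have -> : dst k 0 = k by rewrite /dst; lia.
  have k0 : 0 <= k%:R :> R by [].
  have h1 : (1 + r / 2) ^- k <= expR (- (r / 4 * k%:R)).
    rewrite expRN expRM_natr lef_pV2 ?posrE ?exprn_gt0 ?expR_gt0 //; last by lra.
    apply: lerXn2r; rewrite ?nnegrE ?expR_ge0 //; first by lra.
    have := @exp_half_le R (r / 2) ltac:(lra) ltac:(lra).
    by have -> : r / 2 / 2 = r / 4 by field.
  have h2 : expw (c * (r / 2) `^ b) b k <= 2 * expR (r / 8 * k%:R).
    rewrite /expw.
    have -> : c * (r / 2) `^ b * k%:R `^ b = c * (r / 2 * k%:R) `^ b.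
      by rewrite (@powRM _ (r / 2) k%:R) ?mulrA //; lra.
    apply: (@le_trans _ _ (expR (1 / 16) * expR (r / 8 * k%:R))); last first.
      by rewrite ler_wpM2r ?expR_ge0.
    rewrite -expRD ler_expR.
    have rk : 0 <= r / 2 * k%:R by rewrite mulr_ge0 //; lra.
    have := powR_le1D rk (ltW b0) b1; set Y := _ `^ b => hY.
    have : c * Y <= 1 / 16 * (1 + r / 2 * k%:R) by apply: ler_pM => //; rewrite ?powR_ge0 // ltW.
    have : 0 <= r * k%:R by rewrite mulr_ge0 // ltW.
    lra.
  apply: (@le_trans _ _ (2 * expR (- (r / 4 * k%:R)) * (2 * expR (r / 8 * k%:R)))).
    apply: ler_pM; rewrite ?rnorm_ge0 ?expR_ge0 //.
    by apply: le_trans (hf k) _; rewrite ler_pM2l.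
  have -> : - (r / 8 * k%:R) = - (r / 4 * k%:R) + r / 8 * k%:R by field.
  by rewrite expRD le_eqVlt; apply/orP; left; apply/eqP; ring.
rewrite -mulr_sumr.
have := @sum_exp_le R (r / 8) (size f) ltac:(lra) ltac:(lra).
have -> : 64 / r = 4 * (2 / (r / 8)) by field; rewrite gt_eqF.
by move=> h; rewrite ler_pM2l.
Qed.

End PhiNorm.

Section Small.
Variables (R : realType) (X : normedModType R[i]) (T Tinv : {linear X -> X}).
Local Notation C := R[i].
Hypotheses (TK : cancel T Tinv) (TinvK : cancel Tinv T).
Variable E : set C.
Hypothesis E0 : E !=set0.
Hypothesis below : forall l : C, rnorm l = 1 -> ~ E l ->
  exists2 B : R, 0 < B & forall y, rnorm y <= B * rnorm (T y - l *: y).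
Variables (C0 beta : R).
Hypotheses (C0_gt0 : 0 < C0) (beta_gt0 : 0 < beta).
Let Om k := C0 * expR (k%:R `^ beta).
Hypotheses (hT : forall k x, rnorm (iter k T x) <= Om k * rnorm x)
  (hTinv : forall k x, rnorm (iter k Tinv x) <= Om k * rnorm x).

Section Bump.
Variables (c b : R).
Hypotheses (c_gt0 : 0 < c) (c_le : c <= 1 / 16) (b_gt0 : 0 < b) (b_le1 : b <= 1)
  (beta_b : beta < b).
Hypothesis hbump : forall tau K, 0 < tau -> tau <= 1 -> exists q, bump c b tau K q.

Lemma phi_bound : exists2 A, 0 < A & forall (r : R) (f : {poly C}) eta e K1,
  0 < r -> r <= 1 -> 0 <= eta -> 0 <= e ->
  (forall k, rnorm (f`_k) <= 2 / (1 + r / 2) ^+ k) ->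
  (forall z, rnorm z = 1 -> dist z E < 2 * r -> rnorm (f.[z]) <= eta) ->
  (forall k, (K1 < k)%N -> Om k <= e * expw (c * (r / 2) `^ b) b k) ->
  forall x, rnorm (opoly T f x) <=
    (K1.*2.+1%:R * eta * Om K1 + 2 * (e * (A / r ^+ 3))) * rnorm x.
Proof.
have [A A0 hA] := cutset_wnorm c_gt0 b_gt0 b_le1.
(* From the product of 64/r ([geometric_wnorm]) and A/(r/2)^2 ([cutset_wnorm]). *)
exists (4 ^+ 4 * A); first by rewrite mulr_gt0 // exprn_gt0.
move=> r f eta e K1 r0 r1 eta0 e0 hf hnear htail x.
pose v := expw (c * (r / 2) `^ b) b.
have a0 : 0 <= c * (r / 2) `^ b by rewrite mulr_ge0 ?powR_ge0 // ltW.
have v0 k : 0 <= v k by exact: expw_ge0.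
have vM := expwM a0 b_gt0 b_le1.
have vh := expw_homo a0 b_gt0.
have rh0 : 0 < r / 2 by lra.
have rh1 : r / 2 <= 1 by lra.
set Z := _ + _ * (_ * _).
rewrite leNgt; apply/negP => contra.
pose g := rnorm (opoly T f x) - Z * rnorm x.
have g0 : 0 < g by rewrite subr_gt0.
pose F := wnorm Om 0 f + 1.
have F0 : 0 < F by rewrite ltr_wpDl // wnorm_ge0 // => k; rewrite mulr_ge0 ?expR_ge0 // ltW.
have x0 : 0 < rnorm x + 1 by rewrite ltr_wpDl ?rnorm_ge0.
pose e1 := g / 2 / F / (rnorm x + 1).
have e10 : 0 < e1 by rewrite !divr_gt0.
have [K0 far] := far_small TK TinvK E0 below C0_gt0 beta_gt0 hT hTinv c_gt0 b_gt0 b_le1 beta_b r0 r1 e10 hbump.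
pose K := (K0 + K1)%N.
have [q bq] := hbump K rh0 rh1.
have {}far := far K q (leq_addr _ _) bq x.
have [qp q1 qs qd] := bq.
set u := [pred a | _] in far.
pose W := cutset K q (predC u).
have fsplit : opoly T f x = laurent T Tinv K (f * W) x +
    opoly T f (laurent T Tinv K (cutset K q u) x).
  rewrite -(laurent0 T Tinv f (laurent _ _ _ _ _)) -laurentM // add0n.
  rewrite /laurent -iter_linearD -opolyD -mulrDr.
  have -> : W + cutset K q u = 'X^K by rewrite addrC; exact: cutsetC.
  by rewrite opolyM -opoly_Tinv // opolyXn iterTK.
have near : rnorm (laurent T Tinv K (f * W) x) <= Z * rnorm x.
  have root j : (j < K.*2.+1)%N -> rnorm (f * W).[rho R K.*2.+1 ^+ j] <= eta.
    move=> jM; rewrite hornerM rnormM.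
    have [->|nz] := eqVneq (W.[rho R K.*2.+1 ^+ j]) 0; first by rewrite rnorm0 mulr0.
    rewrite -[eta]mulr1; apply: ler_pM; rewrite ?rnorm_ge0 //; last exact: cutset_le1.
    (* A root where W does not vanish is within r/2 of a point at distance less than r from E, which
       fits under 2r. *)
    apply: hnear; first exact: rnorm_rho.
    have [k [l [kM]]] := cutset_neq0 nz.
    rewrite /u /= -ltNge => uk ql jk.
    have red n : rho R K.*2.+1 ^+ n = rho R K.*2.+1 ^+ (n %% K.*2.+1).
      by rewrite {1}(divn_eq n K.*2.+1) exprD mulnC exprM rhoM // expr1n mul1r.
    have ej : rho R K.*2.+1 ^+ j = rho R K.*2.+1 ^+ k * rho R K.*2.+1 ^+ l.
      by rewrite -exprD red jk -red.
    have := dist_lip E0 (rho R K.*2.+1 ^+ j) (rho R K.*2.+1 ^+ k).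
    rewrite {2}ej -{3}[rho R K.*2.+1 ^+ k]mulr1 -mulrBr rnormM rnorm_rho mul1r.
    have := le_trans (rho_chord_le R K.*2.+1 l) (qs _ ql); lra.
  have K1K : (K1.*2 < K.*2.+1)%N by rewrite ltnS leq_double leq_addl.
  have := laurent_fold TK C0_gt0 beta_gt0 hT hTinv K x K1K eta0 root v0 e0 htail.
  move=> h; apply: le_trans h _; rewrite ler_wpM2r ?rnorm_ge0 // lerD2l ler_pM2l //.
  rewrite ler_wpM2l // -[X in wnorm v X]add0n.
  apply: le_trans (wnormM v0 vM vh _ _ _ _) _.
  have h1 := geometric_wnorm c_gt0 c_le b_gt0 b_le1 r0 r1 hf.
  have h2 := hA (r / 2) K q rh0 rh1 qd (predC u).
  apply: le_trans (ler_pM (wnorm_ge0 v0 _ _) (wnorm_ge0 v0 _ _) h1 h2) _.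
  by rewrite le_eqVlt; apply/orP; left; apply/eqP; field; rewrite gt_eqF.
have far2 : rnorm (opoly T f (laurent T Tinv K (cutset K q u) x)) <= g / 2.
  rewrite -(laurent0 T Tinv); apply: le_trans (laurent_le TK hT hTinv 0 f _) _.
  have e2 : g / 2 = F * (e1 * (rnorm x + 1)).
    by rewrite /e1; field; rewrite !gt_eqF.
  rewrite e2; apply: ler_pM; rewrite ?rnorm_ge0 //.
  - by apply: wnorm_ge0 => k; rewrite mulr_ge0 ?expR_ge0 // ltW.
  - by rewrite /F lerDl.
  by apply: le_trans far _; rewrite ler_pM2l // lerDl.
have := rnormD (laurent T Tinv K (f * W) x) (opoly T f (laurent T Tinv K (cutset K q u) x)).
rewrite -fsplit /g in far2 *; rewrite -/g in far2.
have eg : rnorm (opoly T f x) = g + Z * rnorm x by rewrite /g subrK.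
lra.
Qed.

End Bump.

Hypothesis beta_lt1 : beta < 1.

Lemma phi_small (gam s q1 : R) : beta / (1 - beta) < gam -> 0 <= s -> 0 < q1 -> q1 < 1 ->
  exists N0 : nat, forall N m (f : {poly C}), (N0 <= N)%N -> (0 < N)%N ->
  N%:R `^ gam <= 2 * m%:R ->
  (forall k, rnorm (f`_k) <= 2 / (1 + N%:R^-1 / 2) ^+ k) ->
  (forall z, rnorm z = 1 -> dist z E < 2 * N%:R^-1 -> rnorm (f.[z]) <= 2 * q1 ^+ m) ->
  forall x, N%:R `^ s * rnorm (opoly T f x) <= rnorm x.
Proof.
move=> hgam s0 q10 q11.
have b1 : 0 < 1 - beta by rewrite subr_gt0.
have gam0 : 0 < gam by apply: le_lt_trans hgam; rewrite divr_ge0 // ltW.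
(* Folding takes place at K1 of order N^kap. [kap * beta < gam] lets q1^m beat the norm of T^-K1;
   [kap * (1 - beta) > 1] leaves room for some b < 1 with b < kap (b - beta), which makes the weight
   of width 1/N beat exp(k^beta) beyond K1. *)
pose kap := ((1 - beta)^-1 + gam / beta) / 2.
have k1 : (1 - beta)^-1 < gam / beta.
  rewrite ltr_pdivlMr // mulrC; exact: hgam.
have kapl : (1 - beta)^-1 < kap by rewrite ltr_pdivlMr // mulrDr mulr1 ltrD2l.
have kapr : kap < gam / beta by rewrite ltr_pdivrMr // mulrDr mulr1 ltrD2r.
clearbody kap.
have kapb : kap * beta < gam by rewrite -ltr_pdivlMr.
have kap1 : 1 < kap * (1 - beta) by rewrite -ltr_pdivrMr // div1r.
have kapg1 : 1 < kap.
  by apply: lt_trans kapl; rewrite invf_gt1 // gtrBl.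
have kap0 : 0 < kap by lra.
(* b < kap (b - beta) is equivalent to b > bb, and p >= 1/(1 - bb) gives p/(p + 1) > bb. *)
pose bb := kap * beta / (kap - 1).
have bb1 : bb < 1 by rewrite ltr_pdivrMr; lra.
have bb0 : 0 < bb by rewrite divr_gt0 ?mulr_gt0 // subr_gt0.
have [p hp] := nat_above (1 - bb)^-1.
have p0 : (0 < p)%N.
  rewrite lt0n; apply/eqP => e; move: hp; rewrite e leNgt invr_gt0 subr_gt0 bb1 //.
have pR : 0 < p%:R :> R by rewrite ltr0n.
have p1R : 0 < p.+1%:R :> R by rewrite ltr0n.
pose b : R := p%:R / p.+1%:R.
have b_gt0 : 0 < b by rewrite divr_gt0.
have b_le1 : b <= 1 by rewrite ler_pdivrMr // mul1r ler_nat.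
have bbb : bb < b.
  rewrite ltr_pdivlMr // -natr1.
  have : 1 <= p%:R * (1 - bb) by rewrite -ler_pdivrMr ?div1r ?subr_gt0.
  lra.
have hkb : b < kap * (b - beta).
  have : kap * beta < b * (kap - 1) by rewrite -ltr_pdivrMr ?subr_gt0.
  lra.
have beta_b : beta < b.
  have : 0 < kap * (b - beta) by lra.
  by rewrite pmulr_rgt0 // subr_gt0.
have [c /andP[c0 c16] hc] := @bump_poly R p p0.
have hbump tau K : 0 < tau -> tau <= 1 -> exists q, bump c b tau K q.
  by move=> t0 t1; exact: hc.
have [A A0 HA] := phi_bound c0 c16 b_gt0 b_le1 beta_b hbump.
pose c1 := - ln q1 / 2.
have c10 : 0 < c1 by rewrite divr_gt0 // oppr_gt0 ln_lt0 ?q10.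
have kb0 : 0 < kap * beta by rewrite mulr_gt0.
have [x1 x11 H1] := @exp_vanish R 2 c1 (kap * beta) gam (s + kap) (2 * (10 * C0))^-1
  (ler0n R 2) c10 (ltW kb0) kapb (addr_ge0 s0 (ltW kap0)) ltac:(by rewrite invr_gt0 !mulr_gt0).
have [x2 x21 H2] := @exp_vanish R 0 1 0 (kap * beta) (s + 3) (2 * (2 * C0 * A))^-1
  (lexx 0) ltr01 (lexx 0) kb0 (addr_ge0 s0 (ler0n R 3)) ltac:(by rewrite invr_gt0 !mulr_gt0).
pose de := kap * (b - beta) - b.
have de0 : 0 < de by rewrite subr_gt0.
pose x3 := (2 * 2 `^ b / c) `^ de^-1.
have [N0 hN0] := nat_above (Num.max (Num.max x1 x2) x3).
exists N0 => N m f N0N Np hm hf hnear x.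
have NR : Num.max (Num.max x1 x2) x3 <= N%:R by apply: le_trans hN0 _; rewrite ler_nat.
move: NR; rewrite !ge_max => /andP[/andP[Nx1 Nx2] Nx3].
set n : R := N%:R in hm hf hnear Nx1 Nx2 Nx3 *.
have n1 : 1 <= n by apply: le_trans x11 Nx1.
have n0 : 0 < n := lt_le_trans ltr01 n1.
have nk1 : 1 <= n `^ kap by rewrite -(powRr0 n) ler_powR // ltW.
have [K1 /andP[K1l K1r]] := @nat_ceil R (n `^ kap) (powR_ge0 _ _).
have K1n : K1%:R <= 2 * n `^ kap.
  by rewrite mulr_natl mulr2n; apply: le_trans K1r _; rewrite lerD2l.
(* The weight is shown to beat twice k^beta beyond K1; the second copy leaves this factor
   exp(-N^(kap beta)), which absorbs N^(s + 3). *)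
pose e := C0 * expR (- n `^ (kap * beta)).
have e0 : 0 <= e by rewrite mulr_ge0 ?expR_ge0 // ltW.
have tail k : (K1 < k)%N -> Om k <= e * expw (c * (n^-1 / 2) `^ b) b k.
  move=> K1k; rewrite /Om /e /expw -mulrA ler_pM2l // -expRD ler_expR.
  have kR : n `^ kap <= k%:R by apply: le_trans K1l _; rewrite ler_nat ltnW.
  have kp : 0 < k%:R :> R := lt_le_trans (lt_le_trans ltr01 nk1) kR.
  have h1 : n `^ (kap * beta) <= k%:R `^ beta.
    by rewrite powRrM ge0_ler_powR ?nnegrE ?powR_ge0 // ltW.
  suff h2 : 2 * k%:R `^ beta <= c * (n^-1 / 2) `^ b * k%:R `^ b.
    by rewrite addrC lerBrDr; apply: le_trans h2; rewrite mulr_natl mulr2n lerD2l.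
  have -> : k%:R `^ b = k%:R `^ (b - beta) * k%:R `^ beta.
    by rewrite -powRD ?subrK // (gt_eqF kp) implybT.
  rewrite mulrA ler_wpM2r ?powR_ge0 //.
  have h3 : n `^ (kap * (b - beta)) <= k%:R `^ (b - beta).
    by rewrite powRrM ge0_ler_powR ?nnegrE ?powR_ge0 ?subr_ge0 // ltW.
  apply: (@le_trans _ _ (c * (n^-1 / 2) `^ b * n `^ (kap * (b - beta)))); last first.
    by rewrite ler_wpM2l // mulr_ge0 ?powR_ge0 // ltW.
  have -> : (n^-1 / 2) `^ b = n `^ (- b) / 2 `^ b.
    rewrite powRM ?invr_ge0 ?(ltW n0) //; congr (_ * _).
      by rewrite powRN -powR_inv1 ?(ltW n0) // -powRrM mulN1r powRN.
    by rewrite -powR_inv1 // -powRrM mulN1r powRN.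
  have -> : c * (n `^ (- b) / 2 `^ b) * n `^ (kap * (b - beta)) = c / 2 `^ b * n `^ de.
    rewrite /de powRD; last by rewrite (gt_eqF n0) implybT.
    by field; rewrite gt_eqF // powR_gt0.
  have : 2 * 2 `^ b / c <= n `^ de.
    have -> : 2 * 2 `^ b / c = x3 `^ de.
      by rewrite /x3 -powRrM mulVf ?gt_eqF // powRr1 // divr_ge0 ?mulr_ge0 ?powR_ge0 // ltW.
    by rewrite ge0_ler_powR ?nnegrE ?powR_ge0 // ltW.
  rewrite ler_pdivrMr // => h4.
  have P2 : 0 < 2 `^ b :> R by rewrite powR_gt0.
  by rewrite mulrAC ler_pdivlMr // [c * _]mulrC.
have eta0 : 0 <= 2 * q1 ^+ m by rewrite mulr_ge0 ?exprn_ge0 // ltW.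
have r0 : 0 < n^-1 by rewrite invr_gt0.
have r1 : n^-1 <= 1 by rewrite invf_le1.
have := HA n^-1 f (2 * q1 ^+ m) e K1 r0 r1 eta0 e0 hf hnear tail x.
set Z := _ + _ * (_ * _) => hZ.
have ns0 : 0 <= n `^ s by exact: powR_ge0.
suff : n `^ s * Z <= 1.
  move=> h; apply: (@le_trans _ _ (n `^ s * (Z * rnorm x))).
    by rewrite ler_wpM2l.
  by rewrite mulrA ler_piMl ?rnorm_ge0.
have part1 : n `^ s * (K1.*2.+1%:R * (2 * q1 ^+ m) * Om K1) <= 1 / 2.
  have hK : K1.*2.+1%:R <= 5 * n `^ kap.
    have -> : 5 * n `^ kap = 2 * (2 * n `^ kap) + n `^ kap by ring.
    by rewrite -natr1 -mul2n natrM; apply: lerD nk1; rewrite ler_pM2l.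
  have hO : Om K1 <= C0 * expR (2 * n `^ (kap * beta)).
    rewrite ler_pM2l // ler_expR.
    apply: (@le_trans _ _ ((2 * n `^ kap) `^ beta)).
      apply: ge0_ler_powR; rewrite ?nnegrE; [exact: ltW|exact: ler0n| |].
        exact: mulr_ge0 (ler0n _ 2) (powR_ge0 _ _).
      exact: K1n.
    rewrite powRM ?powR_ge0 // -powRrM ler_wpM2r ?powR_ge0 //.
    by apply: ler1_powR; [rewrite ler1n|exact: ltW].
  have hq : q1 ^+ m <= expR (- (c1 * n `^ gam)).
    have -> : q1 ^+ m = expR (ln q1 * m%:R) by rewrite expRM_natr lnK.
    have l0 : ln q1 < 0 by rewrite ln_lt0 // q10.
    have -> : - (c1 * n `^ gam) = ln q1 * (n `^ gam / 2) by rewrite /c1; field.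
    by rewrite ler_expR ler_nM2l // ler_pdivrMr // mulrC.
  have hO0 : 0 <= Om K1 by rewrite mulr_ge0 ?expR_ge0 // ltW.
  have hh := H1 n Nx1.
  apply: (@le_trans _ _ (n `^ s * (5 * n `^ kap * (2 * expR (- (c1 * n `^ gam))) *
      (C0 * expR (2 * n `^ (kap * beta)))))).
    rewrite ler_wpM2l //; apply: ler_pM => //; first by rewrite mulr_ge0.
    by apply: ler_pM; rewrite ?mulr_ge0 ?exprn_ge0 ?(ltW q10) // ler_pM2l.
  have -> : n `^ s * (5 * n `^ kap * (2 * expR (- (c1 * n `^ gam))) *
      (C0 * expR (2 * n `^ (kap * beta)))) =
      (n `^ (s + kap) * expR (2 * n `^ (kap * beta)) * expR (- (c1 * n `^ gam))) * (10 * C0).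
    by rewrite powRD; [ring|rewrite (gt_eqF n0) implybT].
  rewrite -ler_pdivlMr ?mulr_gt0 //; apply: le_trans hh _.
  by rewrite le_eqVlt; apply/orP; left; apply/eqP; field; rewrite gt_eqF.
have part2 : n `^ s * (2 * (e * (A / n^-1 ^+ 3))) <= 1 / 2.
  have hh := H2 n Nx2; rewrite mul0r expR0 mulr1 mul1r in hh.
  have -> : n `^ s * (2 * (e * (A / n^-1 ^+ 3))) =
      (n `^ (s + 3) * expR (- n `^ (kap * beta))) * (2 * C0 * A).
    rewrite powRD; last by rewrite (gt_eqF n0) implybT.
    rewrite powR_mulrn ?(ltW n0) // /e; field; rewrite gt_eqF //.
  rewrite -ler_pdivlMr ?mulr_gt0 //; apply: le_trans hh _.
  by rewrite le_eqVlt; apply/orP; left; apply/eqP; field; rewrite !gt_eqF.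
by rewrite /Z mulrDr [leRHS]splitr; exact: lerD.
Qed.

End Small.

(** * Products small near given points *)

Section Factors.
Variable R : realType.
Local Notation C := R[i].

(* truncation of the power series of 1/(s - z * conj zeta) *)
Definition geop (L : nat) (s zeta : C) : {poly C} :=
  \sum_(k < L) (s^-1 ^+ k.+1 * zeta^*%C ^+ k) *: 'X^k.

Definition lin (s zeta : C) : {poly C} := s%:P - zeta^*%C *: 'X.

Lemma lin_geop L s zeta : s != 0 ->
  lin s zeta * geop L s zeta = 1 - (s^-1 * zeta^*%C) ^+ L *: 'X^L.
Proof.
move=> s0; pose y : {poly C} := (s^-1 * zeta^*%C) *: 'X.
have e1 : lin s zeta = s *: (1 - y).
  rewrite /lin /y scalerBr scalerA mulrA divff // mul1r.
  by rewrite -[s%:P]mulr1 mul_polyC.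
have e2 : geop L s zeta = s^-1 *: \sum_(k < L) y ^+ k.
  rewrite scaler_sumr; apply: eq_bigr => k _.
  by rewrite /y exprZn scalerA exprMn exprS mulrA.
rewrite e1 e2 -scalerAl -scalerAr scalerA divff // scale1r.
have e3 := subrX1 y L.
rewrite -[LHS]opprK -mulNr opprB -e3 opprB; congr (_ - _).
by rewrite /y exprZn.
Qed.

Lemma horner_lin s zeta z : (lin s zeta).[z] = s - z * zeta^*%C.
Proof. by rewrite !hornerE mulrC. Qed.

(* With w = z * conj zeta, [bfac] is close to (1+r-w)/(1+2r-w) near the unit disc,
   and [cfac] to its inverse. *)
Definition bfac (r : R) L zeta := 1 - r%:C *: geop L (1 + 2 * r)%:C zeta.
Definition cfac (r : R) L zeta := 1 + r%:C *: geop L (1 + r)%:C zeta.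

(** Before truncation the factors are S1/S2 and S2/S1, inverse to each other because S2 = S1 + r.
    Multiplying by S1 S2, which has no zero at the origin, reduces the claim to the geometric sums,
    whose remainders are multiples of the monomial of degree L. *)
Lemma bcfac (r : R) L zeta : 0 < r -> 'X^L %| bfac r L zeta * cfac r L zeta - 1.
Proof.
move=> r0.
have s2 : (1 + 2 * r)%:C != 0 by rewrite (inj_eq (@realC_inj R)) gt_eqF //; lra.
have s1 : (1 + r)%:C != 0 by rewrite (inj_eq (@realC_inj R)) gt_eqF //; lra.
set S2 := lin (1 + 2 * r)%:C zeta; set S1 := lin (1 + r)%:C zeta.
have h2 := lin_geop L zeta s2; have h1 := lin_geop L zeta s1.
rewrite -/S2 in h2; rewrite -/S1 in h1.
set g2 := geop L _ zeta in h2; set g1 := geop L _ zeta in h1.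
set e2 := (_ ^+ L) in h2; set e1 := (_ ^+ L) in h1.
have hS : S2 = S1 + r%:C%:P.
  rewrite /S2 /S1 /lin addrAC -polyCD -rmorphD; congr (_%:P - _).
  by congr (_%:C); ring.
have cop : coprimep 'X^L (S1 * S2).
  rewrite coprimep_expl // coprimep_sym coprimepX /root hornerM !horner_lin.
  by rewrite mul0r !subr0 mulf_neq0.
rewrite -(Gauss_dvdpr _ cop) /bfac /cfac -/g1 -/g2.
clear cop; clearbody S1 S2 g1 g2 e1 e2.
rewrite -(mul_polyC _ g2) -(mul_polyC _ g1) -(mul_polyC e1) -(mul_polyC e2) in h1 h2 *.
set rr : {poly C} := r%:C%:P in hS *.
have -> : S1 * S2 * ((1 - rr * g2) * (1 + rr * g1) - 1) =
   - rr * S1 * (S2 * g2) + rr * S2 * (S1 * g1) - rr ^+ 2 * (S2 * g2) * (S1 * g1) by ring.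
rewrite h1 h2 hS; set f1 := e1%:P; set f2 := e2%:P.
have -> : - rr * S1 * (1 - f2 * 'X^L) + rr * (S1 + rr) * (1 - f1 * 'X^L) -
    rr ^+ 2 * (1 - f2 * 'X^L) * (1 - f1 * 'X^L) =
    (rr * S1 * f2 - rr * (S1 + rr) * f1 + rr ^+ 2 * (f1 + f2 - f1 * f2 * 'X^L)) * 'X^L by ring.
exact: dvdp_mulIr.
Qed.

Lemma rnorm_re_le (x : C) (r : R) : 0 <= r -> 0 <= complex.Re x ->
  rnorm x ^+ 2 + 2 * r * complex.Re x + r ^+ 2 = rnorm (x + r%:C) ^+ 2.
Proof. by case: x => a b r0 /= a0; rewrite !sqr_rnormE /=; ring. Qed.

Lemma Re_le_rnorm (x : C) : complex.Re x <= rnorm x.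
Proof.
apply: le_trans (ler_norm _) _.
rewrite -(@ler_pXn2r _ 2) ?nnegrE ?rnorm_ge0 // real_normK ?num_real //.
by rewrite sqr_rnormE lerDl sqr_ge0.
Qed.

Section Estimates.
Variables (r : R) (L : nat) (zeta : C).
Hypotheses (r0 : 0 < r) (r1 : r <= 1) (z1 : rnorm zeta = 1).
(** The ratio of the largest radius used to the pole of the rational factor; th^L bounds the
    truncation error. *)
Let th := (1 + r / 2) / (1 + 2 * r).

Lemma rnorm_rot z : rnorm (z * zeta^*%C) = rnorm z.
Proof. by rewrite rnormM rnorm_conj z1 mulr1. Qed.

Lemma bfacE z : (1 + 2 * r)%:C - z * zeta^*%C != 0 ->
  (bfac r L zeta).[z] = (((1 + r)%:C - z * zeta^*%C) +
    r%:C * ((1 + 2 * r)%:C^-1 * (z * zeta^*%C)) ^+ L) / ((1 + 2 * r)%:C - z * zeta^*%C).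
Proof.
move=> nz; have r0' := r0; have r1' := r1.
have s2 : (1 + 2 * r)%:C != 0 by rewrite (inj_eq (@realC_inj R)) gt_eqF //; lra.
have h := congr1 (fun p => p.[z]) (lin_geop L zeta s2).
move: h; rewrite hornerM horner_lin hornerD hornerN hornerZ hornerXn hornerC => h.
have -> : ((1 + 2 * r)%:C^-1 * (z * zeta^*%C)) ^+ L =
   ((1 + 2 * r)%:C^-1 * zeta^*%C) ^+ L * z ^+ L by rewrite -exprMn mulrA mulrAC.
rewrite /bfac hornerD hornerN hornerZ hornerC.
apply: (mulIf nz); rewrite divfK //.
have -> : (1 + r)%:C = (1 + 2 * r)%:C - r%:C by rewrite -rmorphB; congr (_%:C); ring.
move: h; set G := (geop _ _ _).[z]; set S := _ - _ => h.
have -> : (1 - r%:C * G) * S = S - r%:C * (S * G) by ring.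
rewrite h /S; ring.
Qed.

Lemma bfac_gen z : rnorm z <= 1 + r / 2 ->
  rnorm ((bfac r L zeta).[z]) <=
   rnorm ((1 + r)%:C - z * zeta^*%C) / rnorm ((1 + 2 * r)%:C - z * zeta^*%C) + th ^+ L.
Proof.
have r0' := r0; have r1' := r1.
move=> hz; set w := z * zeta^*%C.
have w1 : rnorm w <= 1 + r / 2 by rewrite /w rnorm_rot.
have d : 3 / 2 * r <= rnorm ((1 + 2 * r)%:C - w).
  have := rnorm_ge_dist ((1 + 2 * r)%:C : C) w.
  by rewrite rnormR; lra.
have d0 : 0 < rnorm ((1 + 2 * r)%:C - w) by lra.
have nz : (1 + 2 * r)%:C - w != 0 by rewrite -rnorm_eq0 gt_eqF.
rewrite bfacE // rnormM rnormV -/w.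
have h1 : rnorm (r%:C * ((1 + 2 * r)%:C^-1 * w) ^+ L) <= r * th ^+ L.
  rewrite rnormM rnormR ?(ltW r0) // ler_pM2l // rnormX.
  apply: lerXn2r; rewrite ?nnegrE ?rnorm_ge0 ?divr_ge0 //; try lra.
  by rewrite rnormM rnormV rnormR; [rewrite mulrC ler_wpM2r // invr_ge0; lra|lra].
apply: (@le_trans _ _ ((rnorm ((1 + r)%:C - w) + r * th ^+ L) / rnorm ((1 + 2 * r)%:C - w))).
  rewrite ler_wpM2r ?invr_ge0 ?rnorm_ge0 //.
  by apply: le_trans (rnormD _ _) _; rewrite lerD2l.
rewrite mulrDl lerD2l ler_pdivrMr // mulrC ler_wpM2l ?exprn_ge0 ?divr_ge0 //; lra.
Qed.

Let Rew z : rnorm z <= 1 + r / 2 -> r / 2 <= complex.Re ((1 + r)%:C - z * zeta^*%C).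
Proof.
have r0' := r0; have r1' := r1.
move=> hz; have := Re_le_rnorm (z * zeta^*%C); rewrite rnorm_rot.
by case: (z * zeta^*%C) => a b /=; lra.
Qed.

Let addr_shift z : (1 + 2 * r)%:C - z * zeta^*%C = ((1 + r)%:C - z * zeta^*%C) + r%:C.
Proof. by have r0' := r0; rewrite addrAC -rmorphD; congr (_%:C - _); ring. Qed.

Lemma bfac_le z : rnorm z <= 1 + r / 2 -> rnorm ((bfac r L zeta).[z]) <= 1 + th ^+ L.
Proof.
have r0' := r0; have r1' := r1.
move=> hz; apply: le_trans (bfac_gen hz) _; rewrite lerD2r.
have hR := Rew hz; set x := (1 + r)%:C - _ in hR *.
have h := @rnorm_re_le x r (ltW r0) ltac:(lra).
have xn := rnorm_ge0 x.
have x2 : rnorm x <= rnorm (x + r%:C).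
  rewrite -(@ler_pXn2r _ 2) ?nnegrE ?rnorm_ge0 // -h.
  have : 0 <= r * complex.Re x by rewrite mulr_ge0; lra.
  have := sqr_ge0 r; lra.
rewrite addr_shift -/x ler_pdivrMr; first by rewrite mul1r.
apply: lt_le_trans x2; apply: lt_le_trans (Re_le_rnorm _); lra.
Qed.

(** For x = 1 + r - w, |x| <= 11 r and Re x >= r. So |x + r|^2 >= |x|^2 + 3 r^2, and |x / (x + r)|^2
    <= 121/124 < (99/100)^2. *)
Lemma bfac_near z : rnorm z = 1 -> rnorm (z - zeta) <= 10 * r ->
  rnorm ((bfac r L zeta).[z]) <= 99 / 100 + th ^+ L.
Proof.
have r0' := r0; have r1' := r1.
move=> hz hn; have hz' : rnorm z <= 1 + r / 2 by lra.
apply: le_trans (bfac_gen hz') _; rewrite lerD2r addr_shift.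
have zz : zeta * zeta^*%C = 1 by rewrite -sqr_rnorm z1 expr1n.
have e1 : (1 + r)%:C - z * zeta^*%C = r%:C - (z - zeta) * zeta^*%C.
  by rewrite rmorphD /= mulrBl zz; ring.
have x11 : rnorm ((1 + r)%:C - z * zeta^*%C) <= 11 * r.
  rewrite e1; apply: le_trans (rnormB _ _) _.
  have -> : 11 * r = r + 10 * r by ring.
  by rewrite rnorm_rot rnormR ?(ltW r0) // lerD2l.
have hR : r <= complex.Re ((1 + r)%:C - z * zeta^*%C).
  have := Re_le_rnorm (z * zeta^*%C); rewrite rnorm_rot hz.
  by case: (z * zeta^*%C) => a b /=; lra.
set x := (1 + r)%:C - _ in hR x11 *.
have h := @rnorm_re_le x r (ltW r0) ltac:(lra).
have xn := rnorm_ge0 x.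
have yn := rnorm_ge0 (x + r%:C).
have xr : r <= rnorm x by apply: le_trans (Re_le_rnorm _).
have y0 : 0 < rnorm (x + r%:C).
  rewrite lt_neqAle yn andbT eq_sym -sqrf_eq0 -h gt_eqF //.
  have : 0 <= r * complex.Re x by rewrite mulr_ge0; lra.
  have : 0 < r ^+ 2 by rewrite exprn_gt0.
  by have := sqr_ge0 (rnorm x); lra.
rewrite ler_pdivrMr //.
have q0 : 0 <= 99 / 100 * rnorm (x + r%:C) by apply: mulr_ge0 => //; lra.
rewrite -(@ler_pXn2r _ 2) ?nnegrE //.
rewrite exprMn -h.
have h2 : r ^+ 2 <= r * complex.Re x by rewrite expr2 ler_pM2l.
have h3 : rnorm x ^+ 2 <= (11 * r) ^+ 2 by apply: lerXn2r; rewrite ?nnegrE //; lra.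
have h4 : rnorm x ^+ 2 <= 121 * r ^+ 2.
  by apply: le_trans h3 _; rewrite le_eqVlt; apply/orP; left; apply/eqP; ring.
have -> : (99 / 100) ^+ 2 = 9801 / 10000 :> R by field.
move: h2 h4 (sqr_ge0 r); rewrite -[2 * r * _]mulrA.
move: (rnorm x ^+ 2) (r ^+ 2) (r * complex.Re x) => u v w; lra.
Qed.

(** The 2 in 2r bounds the numerator 1 - (w/(1 + r))^L of the truncated series. *)
Lemma cfac_le z : rnorm z <= 1 ->
  rnorm ((cfac r L zeta).[z]) <= 1 + 2 * r / rnorm ((1 + r)%:C - z * zeta^*%C).
Proof.
have r0' := r0; have r1' := r1.
move=> hz; set w := z * zeta^*%C.
have w1 : rnorm w <= 1 by rewrite /w rnorm_rot.
have d0 : 0 < rnorm ((1 + r)%:C - w).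
  by have := rnorm_ge_dist ((1 + r)%:C : C) w; rewrite rnormR; lra.
have nz : (1 + r)%:C - w != 0 by rewrite -rnorm_eq0 gt_eqF.
have s1 : (1 + r)%:C != 0 by rewrite (inj_eq (@realC_inj R)) gt_eqF //; lra.
have h := congr1 (fun p => p.[z]) (lin_geop L zeta s1).
move: h; rewrite hornerM horner_lin hornerD hornerN hornerZ hornerXn hornerC -/w => h.
rewrite /cfac hornerD hornerZ hornerC; apply: le_trans (rnormD _ _) _.
rewrite rnorm1 lerD2l rnormM rnormR ?(ltW r0) //.
rewrite [2 * r]mulrC -mulrA ler_pM2l // ler_pdivlMr // mulrC -rnormM h.
apply: le_trans (rnormB _ _) _; rewrite rnorm1.
have -> : ((1 + r)%:C^-1 * zeta^*%C) ^+ L * z ^+ L = ((1 + r)%:C^-1 * w) ^+ L.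
  by rewrite -exprMn /w [z * _]mulrC mulrA.
have : rnorm (((1 + r)%:C^-1 * w) ^+ L) <= 1; last lra.
rewrite rnormX exprn_ile1 ?rnorm_ge0 // rnormM rnormV rnormR; last by lra.
by rewrite mulrC ler_pdivrMr; lra.
Qed.

End Estimates.

Lemma dvdp1_mul n (p q : {poly C}) : 'X^n %| p - 1 -> 'X^n %| q - 1 -> 'X^n %| p * q - 1.
Proof.
move=> hp hq; have -> : p * q - 1 = p * (q - 1) + (p - 1) by ring.
by apply: dvdp_add => //; rewrite dvdp_mull.
Qed.

Lemma dvdp1_exp n (p : {poly C}) m : 'X^n %| p - 1 -> 'X^n %| p ^+ m - 1.
Proof.
move=> hp; elim: m => [|m ih]; first by rewrite expr0 subrr dvdp0.
by rewrite exprS dvdp1_mul.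
Qed.

Lemma prod_le_pow (I : eqType) (s : seq I) (F : I -> R) c :
  (forall i, i \in s -> 0 <= F i <= c) -> \prod_(i <- s) F i <= c ^+ size s.
Proof.
elim: s => [|i s ih] h; first by rewrite big_nil expr0.
have /andP[h1 h2] := h i (mem_head _ _).
rewrite big_cons exprS; apply: ler_pM => //.
  rewrite big_seq; apply: prodr_ge0 => j js.
  by have /andP[] := h j (mem_behead (s := i :: s) js).
by apply: ih => j js; apply: h; rewrite inE js orbT.
Qed.

(* [f] is bounded by 2 slightly beyond the unit disc and tiny near [Z]; [P] is
   the truncation of 1/f at order n, bounded because 1/f is on |z| = 1 - 1/n. *)
Lemma interpolant (n m : nat) (r D : R) (Z : seq C) :
  (2 <= n)%N -> 0 < r -> r <= n%:R^-1 -> (forall w, w \in Z -> rnorm w = 1) ->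
  (forall z, rnorm z = 1 - n%:R^-1 ->
     \sum_(w <- Z) m%:R * (2 * r / rnorm ((1 + r)%:C - z * w^*%C)) <= D) ->
  exists f P H : {poly C},
  [/\ f * P = 1 + 'X^n * H /\ (size P <= n)%N,
      forall k, rnorm (f`_k) <= 2 / (1 + r / 2) ^+ k,
      forall z, rnorm z = 1 -> (exists2 w, w \in Z & rnorm (z - w) <= 10 * r) ->
        rnorm (f.[z]) <= 2 * (199 / 200) ^+ m,
      sqnorm (1 + r / 2) (f * P) <= (32 * expR D) ^+ 2 &
      forall k, rnorm (P`_k) <= 16 * expR D].
Proof.
move=> n2 r0 rn Z1 hD.
have n0 : 0 < n%:R :> R by rewrite ltr0n; lia.
have n2R : 2 <= n%:R :> R by rewrite ler_nat.
have nV : n%:R^-1 <= 1 / 2 :> R by rewrite div1r lef_pV2 ?posrE.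
have nV0 : 0 < n%:R^-1 :> R by rewrite invr_gt0.
have r1 : r <= 1 by lra.
pose th : R := (1 + r / 2) / (1 + 2 * r).
have th0 : 0 <= th by rewrite divr_ge0; lra.
have th1 : th < 1 by rewrite ltr_pdivrMr; lra.
pose cnt : R := (size Z)%:R * m%:R.
have cnt0 : 0 <= cnt by rewrite mulr_ge0.
(* A truncation error small enough for two uses: (1 + th^L)^cnt <= exp(1/2) <= 2 for all factors
   together, and 99/100 + th^L <= 199/200 for a factor attached to a near point. *)
pose dl : R := (200 * (cnt + 1))^-1.
have c200 : 0 < 200 * (cnt + 1) by lra.
have dl0 : 0 < dl by rewrite invr_gt0.
have [L0 hL0] : exists L0, th ^+ L0 <= dl.
  have := @cvg_geometric R 1 th; rewrite ger0_norm // => /(_ th1).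
  move=> /cvgrPdist_le /(_ _ dl0) [L0 _ h]; exists L0.
  by have := h L0 (leqnn _); rewrite sub0r normrN /geometric /= mul1r ger0_norm // exprn_ge0.
pose L := (L0 + n)%N.
have thL : th ^+ L <= dl.
  rewrite /L exprD -[dl]mulr1; apply: ler_pM; rewrite ?exprn_ge0 //.
  by rewrite exprn_ile1 // ltW.
have thL0 : 0 <= th ^+ L by rewrite exprn_ge0.
have dl200 : th ^+ L <= 1 / 200.
  by apply: le_trans thL _; rewrite /dl div1r lef_pV2 ?posrE //; clear -cnt0; lra.
have cntL : cnt * th ^+ L <= 1 / 2.
  apply: (@le_trans _ _ (cnt * dl)); first by rewrite ler_wpM2l.
  have c1 : 0 < 200 * (cnt + 1) by lra.
  by rewrite /dl ler_pdivrMr //; lra.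
have e2 : expR (1 / 2) <= 2 :> R by have := @exp_half_le R 1 ler01 (lexx _); lra.
have pow2 : (1 + th ^+ L) ^+ m ^+ size Z <= 2.
  apply: le_trans e2; apply: (@le_trans _ _ (expR (th ^+ L) ^+ m ^+ size Z)).
    apply: lerXn2r; rewrite ?nnegrE ?exprn_ge0 ?expR_ge0 ?addr_ge0 //.
    by apply: lerXn2r; rewrite ?nnegrE ?expR_ge0 ?addr_ge0 ?expR_ge1Dx.
  by rewrite -exprM -expRM_natr ler_expR natrM; move: cntL; rewrite /cnt; lra.
pose f := \prod_(w <- Z) bfac r L w ^+ m.
pose Q := \prod_(w <- Z) cfac r L w ^+ m.
pose P := take_poly n Q.
have dvd : 'X^n %| f * P - 1.
  have h1 : 'X^L %| f * Q - 1.
    rewrite /f /Q -big_split /=; elim/big_rec: _ => [|w p _ ih]; first by rewrite subrr dvdp0.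
    by apply: dvdp1_mul => //; rewrite -exprMn; apply: dvdp1_exp; exact: bcfac.
  have h2 : 'X^n %| f * Q - 1.
    by apply: dvdp_trans h1; rewrite dvdp_exp2l // /L leq_addl.
  have -> : f * P - 1 = (f * Q - 1) - f * drop_poly n Q * 'X^n.
    have eQ : Q = P + drop_poly n Q * 'X^n by rewrite /P poly_take_drop.
    rewrite {1}eQ; ring.
  by rewrite dvdp_sub // dvdp_mull.
have [H eH] := dvdpP _ _ dvd.
have fev z : f.[z] = \prod_(w <- Z) (bfac r L w).[z] ^+ m.
  by rewrite /f horner_prod; apply: eq_bigr => w _; rewrite horner_exp.
have fn z : rnorm (f.[z]) = \prod_(w <- Z) rnorm (bfac r L w).[z] ^+ m.
  by rewrite fev rnorm_prod; apply: eq_bigr => w _; rewrite rnormX.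
have f2 z : rnorm z <= 1 + r / 2 -> rnorm (f.[z]) <= 2.
  move=> hz; apply: le_trans pow2; rewrite fn.
  apply: prod_le_pow => w wZ; rewrite exprn_ge0 ?rnorm_ge0 //=.
  apply: lerXn2r; rewrite ?nnegrE ?rnorm_ge0 ?addr_ge0 //.
  by apply: bfac_le => //; exact: Z1.
have [q1 q1E [q10 q1le]] : exists2 q1 : R, q1 = 199 / 200 & 0 <= q1 /\ 99 / 100 + 1 / 200 <= q1.
  by exists (199 / 200); [reflexivity|split; clear; lra].
rewrite -q1E.
have fnear z : rnorm z = 1 -> (exists2 w, w \in Z & rnorm (z - w) <= 10 * r) ->
    rnorm (f.[z]) <= 2 * q1 ^+ m.
  move=> z1 [w wZ hw]; rewrite fn (perm_big _ (perm_to_rem wZ)) /= big_cons.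
  have h1 : rnorm (bfac r L w).[z] ^+ m <= q1 ^+ m.
    apply: lerXn2r; rewrite ?nnegrE ?rnorm_ge0 //.
    apply: (@le_trans _ _ (99 / 100 + th ^+ L)); last by clear -dl200 q1le; lra.
    by apply: bfac_near => //; exact: Z1.
  have h2 : \prod_(u <- rem w Z) rnorm (bfac r L u).[z] ^+ m <= 2.
    apply: le_trans (_ : _ <= (1 + th ^+ L) ^+ m ^+ size (rem w Z)) _.
      apply: prod_le_pow => u /mem_rem uZ; rewrite exprn_ge0 ?rnorm_ge0 //=.
      apply: lerXn2r; rewrite ?nnegrE ?rnorm_ge0 ?addr_ge0 //.
      by apply: bfac_le => //; [exact: Z1|rewrite z1; clear -r0; lra].
    apply: le_trans pow2; apply: ler_weXn2l.
      by rewrite exprn_ege1 // lerDl.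
    by rewrite size_rem // leq_pred.
  rewrite mulrC; apply: ler_pM => //.
    by apply: prodr_ge0 => u _; rewrite exprn_ge0 // rnorm_ge0.
  by rewrite exprn_ge0 // rnorm_ge0.
(* For k <= n, t0^k >= 1/8 and (1 + r/2)^k <= 2, so the Hardy norm of P at radius 1 + r/2 is at most
   16 times that of Q at radius t0; |f| <= 2 turns 16 into 32. *)
pose t0 : R := 1 - n%:R^-1.
have t00 : 0 < t0 by rewrite /t0; clear -nV; lra.
have sqQ : sqnorm t0 Q <= expR D ^+ 2.
  apply: sqnorm_le; first exact: ltW.
  move=> z z1; set y := t0%:C * z.
  have y1 : rnorm y = t0 by rewrite rnormM z1 mulr1 rnormR // ltW.
  rewrite /Q horner_prod rnorm_prod.
  apply: (@le_trans _ _ (\prod_(w <- Z) expR (m%:R * (2 * r / rnorm ((1 + r)%:C - y * w^*%C))))).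
    rewrite big_seq [X in _ <= X]big_seq; apply: ler_prod => w wZ.
    rewrite rnorm_ge0 /= horner_exp rnormX expRM_natl.
    apply: lerXn2r; rewrite ?nnegrE ?rnorm_ge0 ?expR_ge0 //.
    apply: le_trans (expR_ge1Dx _).
    by apply: cfac_le => //; [exact: Z1|rewrite y1 /t0; clear -nV0; lra].
  by rewrite -expR_sum ler_expR; exact: hD.
have Pk k : rnorm (P`_k) * t0 ^+ k <= expR D.
  have := coef_le_sqnorm k t00 (expR_ge0 D) sqQ; rewrite ler_pdivlMr ?exprn_gt0 //.
  apply: le_trans; rewrite ler_wpM2r ?exprn_ge0 ?(ltW t00) //.
  by rewrite /P coef_take_poly; case: ifP => _ //; rewrite rnorm0 rnorm_ge0.
have t0n k : (k <= n)%N -> 8^-1 <= t0 ^+ k.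
  move=> kn; apply: le_trans (one_minus_inv_pow R n2) _.
  by apply: ler_wiXn2l => //; rewrite /t0; clear -nV nV0; lra.
have tn k : (k <= n)%N -> (1 + r / 2) ^+ k <= 2.
  move=> kn; apply: le_trans e2.
  apply: (@le_trans _ _ (expR (r / 2) ^+ k)).
    by apply: lerXn2r; rewrite ?nnegrE ?expR_ge0 ?expR_ge1Dx //; clear -r0; lra.
  rewrite -expRM_natl ler_expR.
  have h : k%:R * r <= 1.
    apply: (@le_trans _ _ (n%:R * n%:R^-1)); last by rewrite divff // gt_eqF.
    by apply: ler_pM; rewrite ?ler_nat ?(ltW r0).
  by rewrite mulrA; clear -h; lra.
have sP : (size P <= n)%N by exact: size_take_poly.
exists f, P, H; split.
- by split => //; rewrite ['X^n * H]mulrC -eH addrC subrK.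
- move=> k; have tt0 : 0 < 1 + r / 2 by clear -r0; lra.
  apply: coef_le_sqnorm => //; apply: sqnorm_le; first exact: ltW.
  by move=> z z1; apply: f2; rewrite rnormM z1 mulr1 rnormR // ltW.
- exact: fnear.
- apply: le_trans (sqnormM_le (A := 2) P _ _) _; first by clear -r0; lra.
    by move=> z z1; apply: f2; rewrite rnormM z1 mulr1 rnormR //; clear -r0; lra.
  have -> : (32 * expR D) ^+ 2 = 2 ^+ 2 * (16 ^+ 2 * expR D ^+ 2) by ring.
  rewrite ler_pM2l ?exprn_gt0 //.
  apply: (@le_trans _ _ (16 ^+ 2 * sqnorm t0 Q)); last by rewrite ler_pM2l // exprn_gt0.
  have h1 : sqnorm (1 + r / 2) P <= 16 ^+ 2 * sqnorm t0 P.
    rewrite /sqnorm mulr_sumr; apply: ler_sum => k _; rewrite -exprMn.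
    have kn : (k <= n)%N by apply: ltnW; apply: leq_trans (ltn_ord k) sP.
    have a1 := tn k kn; have a2 := t0n k kn.
    have b1 : 0 <= (1 + r / 2) ^+ k by apply: exprn_ge0; clear -r0; lra.
    have b2 : 0 <= t0 ^+ k := exprn_ge0 _ (ltW t00).
    apply: lerXn2r; rewrite ?nnegrE; first exact: mulr_ge0 (rnorm_ge0 _) b1.
      exact: mulr_ge0 (ler0n _ 16) (mulr_ge0 (rnorm_ge0 _) b2).
    by rewrite mulrCA; apply: ler_wpM2l; [exact: rnorm_ge0 | clear -a1 a2; lra].
  apply: le_trans h1 _; rewrite ler_pM2l ?exprn_gt0 //.
  have h2 : (size P <= size Q + n)%N by rewrite (leq_trans sP) // leq_addl.
  rewrite /sqnorm (big_ord_widen _ (fun k => (rnorm P`_k * t0 ^+ k) ^+ 2) h2).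
  rewrite (big_ord_widen _ (fun k => (rnorm Q`_k * t0 ^+ k) ^+ 2) (leq_addr n (size Q))).
  rewrite big_mkcond [X in _ <= X]big_mkcond /=; apply: ler_sum => k _.
  case: ifP => kP; last by case: ifP => _; rewrite ?sqr_ge0.
  case: ltnP => kQ.
    rewrite /P coef_take_poly; case: ifP => // _.
    by rewrite rnorm0 mul0r expr0n sqr_ge0.
  by rewrite /P coef_take_poly nth_default // if_same rnorm0 mul0r expr0n.
move=> k; case: (leqP k n) => kn.
  have := Pk k; have := t0n k kn; have := rnorm_ge0 P`_k; have := expR_ge0 D; clear; nra.
by rewrite nth_default ?rnorm0 ?mulr_ge0 ?expR_ge0 // (leq_trans sP) // ltnW.
Qed.

End Factors.

(** * The estimate at one scale *)

Lemma half_absorb (R : realType) (u y h w : R) :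
  u <= y + h -> y <= u / 2 -> h <= w -> u <= 2 * w.
Proof. lra. Qed.

Section Core.
Variables (R : realType) (X : normedModType R[i]) (T Tinv : {linear X -> X}).
Local Notation C := R[i].
Hypotheses (TK : cancel T Tinv) (TinvK : cancel Tinv T).
Variable E : set C.
Hypothesis E0 : E !=set0.
Hypothesis below : forall l : C, rnorm l = 1 -> ~ E l ->
  exists2 B : R, 0 < B & forall y, rnorm y <= B * rnorm (T y - l *: y).

Lemma opoly_le (w : nat -> R) (p : {poly C}) x :
  (forall k x, rnorm (iter k T x) <= w k * rnorm x) ->
  rnorm (opoly T p x) <= (\sum_(k < size p) rnorm p`_k * w k) * rnorm x.
Proof.
move=> hw; apply: le_trans (rnorm_sum _ _ _) _.
rewrite mulr_suml; apply: ler_sum => k _.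
by rewrite rnormZ -mulrA ler_wpM2l ?rnorm_ge0.
Qed.

(* weighted AM-GM: 2 a w <= mu a^2 + w^2 / mu with mu = N^(s+1/2) *)
Lemma tail_l1_le (s : R) : 0 <= s -> exists2 A, 0 < A &
  forall (N n : nat) (D : R) (p q H : {poly C}), (0 < N)%N ->
  p = q + 'X^n * H -> (size q <= n)%N -> 0 <= D ->
  sqnorm (1 + N%:R^-1 / 2) p <= D ^+ 2 ->
  \sum_(k < size H) rnorm H`_k * (1 + k%:R) `^ s <= (D ^+ 2 + A) * N%:R `^ (s + 2^-1).
Proof.
move=> s0; have [A A0 hA] := moment_sum s0.
exists (A * 2 `^ (2 * s + 1)); first by rewrite mulr_gt0 ?powR_gt0.
move=> N n D p q H N0 hp sq D0 hD.
have NR : 0 < N%:R :> R by rewrite ltr0n.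
have N1 : 1 <= N%:R :> R by rewrite ler1n.
have NV0 : 0 < N%:R^-1 :> R by rewrite invr_gt0.
have NV1 : N%:R^-1 <= 1 :> R by rewrite invf_le1.
set x : R := N%:R^-1 / 2 in hD.
have x0 : 0 < x by rewrite /x; lra.
have x1 : x <= 1 by rewrite /x; lra.
have t0 : 0 < 1 + x by lra.
pose mu : R := N%:R `^ (s + 2^-1).
have mu0 : 0 < mu by rewrite powR_gt0.
pose a k := rnorm H`_k * (1 + x) ^+ k.
pose w (k : nat) := (1 + k%:R) `^ s * (1 + x) ^- k.
have sa : \sum_(k < size H) a k ^+ 2 <= D ^+ 2.
  apply: le_trans hD; rewrite /sqnorm.
  pose F k := (rnorm p`_k * (1 + x) ^+ k) ^+ 2.
  have F0 k : 0 <= F k by exact: sqr_ge0.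
  have -> : \sum_(k < size p) F k = \sum_(k < n + size H + size p) F k.
    rewrite (big_ord_widen _ F (leq_addl (n + size H)%N (size p))) big_mkcond /=.
    apply: eq_bigr => k _; case: ltnP => // h.
    by rewrite /F nth_default // rnorm0 mul0r expr0n.
  rewrite 2!big_split_ord /=.
  have s1 : 0 <= \sum_(i < n) F i by apply: sumr_ge0.
  have s2 : 0 <= \sum_(i < size p) F (n + size H + i)%N by apply: sumr_ge0.
  suff : \sum_(k < size H) a k ^+ 2 <= \sum_(i < size H) F (n + i)%N by lra.
  (* As q has size at most n, the coefficients of p from n on are those of H; the extra power (1 +
     x)^n >= 1 is dropped. *)
  apply: ler_sum => k _; rewrite /F /a.
  have -> : p`_(n + k) = H`_k.
    rewrite hp coefD coefXnM ltnNge leq_addr /= addKn nth_default ?add0r //.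
    by apply: leq_trans sq _; rewrite leq_addr.
  apply: lerXn2r; rewrite ?nnegrE ?mulr_ge0 ?rnorm_ge0 ?exprn_ge0 ?(ltW t0) //.
  rewrite ler_wpM2l ?rnorm_ge0 // exprD ler_peMl ?exprn_ge0 ?(ltW t0) //.
  by rewrite exprn_ege1 // lerDl ltW.
have sw : \sum_(k < size H) w k ^+ 2 <= A * 2 `^ (2 * s + 1) * mu ^+ 2.
  have h := hA x (size H) x0 x1.
  have -> : A * 2 `^ (2 * s + 1) * mu ^+ 2 = A * x `^ (- (2 * s + 1)).
    have -> : mu ^+ 2 = N%:R `^ (2 * s + 1).
      by rewrite /mu -powR_mulrn ?powR_ge0 // -powRrM; congr (_ `^ _); field.
    have -> : x = (2 * N%:R)^-1 by rewrite /x; field; rewrite gt_eqF.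
    rewrite -mulrA -powRM //.
    rewrite powRN -[(2 * N%:R)^-1]powR_inv1 ?mulr_ge0 // -powRrM mulN1r powRN invrK //.
  apply: le_trans h; rewrite le_eqVlt; apply/orP; left; apply/eqP.
  by apply: eq_bigr => k _; rewrite exprMn.
have step k : rnorm H`_k * (1 + k%:R) `^ s <= (mu * a k ^+ 2 + w k ^+ 2 / mu) / 2.
  have -> : rnorm H`_k * (1 + k%:R) `^ s = a k * w k.
    by rewrite /a /w; field; rewrite expf_neq0 // gt_eqF.
  have h : 0 <= (mu * a k - w k) ^+ 2 / mu by rewrite divr_ge0 ?sqr_ge0 // ltW.
  have e : (mu * a k - w k) ^+ 2 / mu = mu * a k ^+ 2 + w k ^+ 2 / mu - 2 * (a k * w k).
    by field; rewrite gt_eqF.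
  by rewrite e in h; lra.
apply: (@le_trans _ _ (\sum_(k < size H) (mu * a k ^+ 2 + w k ^+ 2 / mu) / 2)).
  by apply: ler_sum => k _; exact: step.
rewrite -mulr_suml big_split /= -mulr_sumr -mulr_suml -/mu.
set S1 := \sum_(_ < _) a _ ^+ 2 in sa *; set S2 := \sum_(_ < _) w _ ^+ 2 in sw *.
set A' := A * _ in sw *.
have h1 : mu * S1 <= mu * D ^+ 2 by rewrite ler_pM2l.
have h2 : S2 / mu <= A' * mu by rewrite ler_pdivrMr // -mulrA -expr2.
have A'0 : 0 <= A' by rewrite mulr_ge0 ?powR_ge0 // ltW.
have h3 : 0 <= D ^+ 2 * mu by rewrite mulr_ge0 ?sqr_ge0 // ltW.
have h4 : 0 <= A' * mu by rewrite mulr_ge0 // ltW.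
lra.
Qed.

Variables (s C1 C2 beta gam Cz : R).
Hypotheses (s0 : 0 <= s) (C1_gt0 : 0 < C1) (C2_gt0 : 0 < C2)
  (beta_gt0 : 0 < beta) (beta_lt1 : beta < 1) (beta_gam : beta / (1 - beta) < gam).
Hypotheses (hT : forall k x, rnorm (iter k T x) <= C1 * (1 + k%:R) `^ s * rnorm x)
  (hTinv : forall k x, rnorm (iter k Tinv x) <= C2 * expR (k%:R `^ beta) * rnorm x).

(** With u = T^-n x, f(T) P(T) u = u + H(T) x. Here P(T) costs N^(s + 1): at most N bounded
    coefficients against norms of T^k of order N^s. So f(T) is required to be at most N^-(s + 2);
    the spare 1/N makes the term at most half of |u| for large N, and u is recovered from H(T) x. *)
Lemma inverse_iter_le : exists2 A, 0 < A & exists n0, forall n N (Z : seq C),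
  (n0 <= n)%N -> (n <= N)%N ->
  (forall w, w \in Z -> rnorm w = 1) ->
  (forall e, E e -> exists2 w, w \in Z & rnorm (e - w) <= 8 * N%:R^-1) ->
  (forall z, rnorm z = 1 - n%:R^-1 ->
    \sum_(w <- Z) (rnorm ((1 + N%:R^-1)%:C - z * w^*%C))^-1 <= Cz * N%:R `^ (1 - gam)) ->
  forall x, rnorm (iter n Tinv x) <= A * N%:R `^ (s + 2^-1) * rnorm x.
Proof.
have gam0 : 0 <= gam.
  by apply: ltW; apply: le_lt_trans beta_gam; rewrite divr_ge0 ?subr_ge0 // ltW.
have [Cs Cs0 hCs] := @exp_beats R 0 1 0 beta s (lexx 0) ltr01 (lexx 0) beta_gt0 s0.
have grow k : (1 + k%:R) `^ s <= Cs * expR 1 * expR (k%:R `^ beta).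
  have k1 : 0 <= 1 + k%:R :> R by rewrite addr_ge0.
  have := hCs _ k1; rewrite mul0r expR0 mulr1 mul1r => h.
  apply: le_trans h _; rewrite -mulrA -expRD ler_pM2l // ler_expR.
  have := @powR_subadd R 1 k%:R beta ler01 (ler0n _ _) beta_gt0 (ltW beta_lt1).
  by rewrite powR1.
pose C0 := C1 * (Cs * expR 1) + C2.
have CC0 : 0 < C1 * (Cs * expR 1) by rewrite !mulr_gt0 ?expR_gt0.
have C0_gt0 : 0 < C0 by rewrite addr_gt0.
have gT k x : rnorm (iter k T x) <= C0 * expR (k%:R `^ beta) * rnorm x.
  apply: le_trans (hT k x) _; rewrite ler_wpM2r ?rnorm_ge0 // /C0 mulrDl.
  apply: (@le_trans _ _ (C1 * (Cs * expR 1) * expR (k%:R `^ beta))).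
    by rewrite -mulrA ler_pM2l.
  by rewrite lerDl mulr_ge0 ?expR_ge0 // ltW.
have gTinv k x : rnorm (iter k Tinv x) <= C0 * expR (k%:R `^ beta) * rnorm x.
  apply: le_trans (hTinv k x) _; rewrite ler_wpM2r ?rnorm_ge0 // /C0 mulrDl.
  by rewrite lerDr mulr_ge0 ?expR_ge0 // ltW.
have s2 : 0 <= s + 2 by rewrite addr_ge0.
have q1 : 0 < 199 / 200 :> R by lra.
have q2 : 199 / 200 < 1 :> R by lra.
have [N1 hN1] := phi_small TK TinvK E0 below C0_gt0 beta_gt0 gT gTinv beta_lt1
  beta_gam s2 q1 q2.
have [A1 A10 hA1] := tail_l1_le s0.
pose D := 2 * Cz; pose D' := 32 * expR D; pose D6 := 16 * expR D.
have D'0 : 0 <= D' by rewrite mulr_ge0 ?expR_ge0.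
have D60 : 0 < D6 by rewrite mulr_gt0 ?expR_gt0.
have [N2 hN2] := nat_above (2 * (D6 * C1 * 2 `^ s)).
exists (2 * (C1 * (D' ^+ 2 + A1))).
  by rewrite !mulr_gt0 // ltr_wpDl ?sqr_ge0.
exists (maxn 2 (maxn N1 N2)) => n N Z; rewrite !geq_max => /andP[n2 /andP[nN1 nN2]] nN Z1 ZE hZ x.
have N0 : (0 < N)%N := leq_trans (ltnW n2) nN.
have NR : 0 < N%:R :> R by rewrite ltr0n.
have N1R : 1 <= N%:R :> R by rewrite ler1n.
have nR : 0 < n%:R :> R by rewrite ltr0n (ltnW n2).
set r : R := N%:R^-1 in ZE hZ.
have r0 : 0 < r by rewrite invr_gt0.
have rn : r <= n%:R^-1 by rewrite lef_pV2 ?posrE // ler_nat.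
have Ng1 : 1 <= N%:R `^ gam by rewrite -[X in X <= _](powRr0 N%:R) ler_powR.
(* m <= N^gam keeps the sum required by [interpolant] at most 2 Cz; N^gam <= 2 m is what [phi_small]
   needs. *)
have [m [m0 mN Nm]] := nat_between Ng1.
have hD z : rnorm z = 1 - n%:R^-1 ->
    \sum_(w <- Z) m%:R * (2 * r / rnorm ((1 + r)%:C - z * w^*%C)) <= D.
  move=> hz; have h := hZ z hz.
  rewrite -mulr_sumr -mulr_sumr.
  set S := \sum_(_ <- _) _ in h *.
  have S0 : 0 <= S by apply: sumr_ge0 => w _; rewrite invr_ge0 rnorm_ge0.
  apply: (@le_trans _ _ (N%:R `^ gam * (2 * r * (Cz * N%:R `^ (1 - gam))))).
    apply: ler_pM => //; first by rewrite !mulr_ge0 // ltW.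
    by rewrite ler_pM2l // mulr_gt0.
  rewrite powRD; last by rewrite (gt_eqF NR) implybT.
  rewrite powRr1 ?(ltW NR) // powRN /D /r.
  have P0 : N%:R `^ gam != 0 by rewrite gt_eqF // powR_gt0.
  rewrite le_eqVlt; apply/orP; left; apply/eqP; field.
  by rewrite P0 gt_eqF.
have [f [P [H [[fPH sP] fk fnear sq Pk]]]] := interpolant n2 r0 rn Z1 hD.
have NN1 : (N1 <= N)%N := leq_trans nN1 nN.
have fsmall y : N%:R `^ (s + 2) * rnorm (opoly T f y) <= rnorm y.
  (* 2r from z to E and 8r from E to Z make up the 10r of [interpolant]. *)
  apply: (hN1 N m f NN1 N0 Nm fk) => z z1 hz; apply: fnear => //.
  have [e Ee he] := dist_lt E0 hz; have [w wZ hw] := ZE _ Ee.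
  exists w => //; have -> : z - w = (z - e) + (e - w) by rewrite addrA subrK.
  apply: le_trans (rnormD _ _) _.
  have -> : 10 * r = 2 * r + 8 * r by ring.
  by apply: lerD => //; exact: ltW.
set u := iter n Tinv x.
have key : opoly T f (opoly T P u) = u + opoly T H x.
  have -> : opoly T f (opoly T P u) = laurent T Tinv n (f * P) x.
    by rewrite /laurent opolyM /u !opoly_Tinv.
  rewrite fPH /laurent opolyD opoly1 iter_linearD opolyM opolyXn iterTK //.
have hP : rnorm (opoly T P u) <= D6 * C1 * 2 `^ s * N%:R `^ (s + 1) * rnorm u.
  apply: le_trans (opoly_le P u hT) _; rewrite ler_wpM2r ?rnorm_ge0 //.
  apply: (@le_trans _ _ (\sum_(k < size P) D6 * (C1 * (2 * N%:R) `^ s))).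
    apply: ler_sum => k _; apply: ler_pM; rewrite ?rnorm_ge0 ?mulr_ge0 ?powR_ge0 ?(ltW C1_gt0) //.
    rewrite ler_pM2l // ge0_ler_powR ?nnegrE ?addr_ge0 ?mulr_ge0 //.
    have : k.+1%:R <= N%:R :> R by rewrite ler_nat; apply: leq_trans nN; apply: leq_trans sP.
    by rewrite nat1r => h; apply: le_trans h _; rewrite ler_peMl // ler1n.
  rewrite sumr_const card_ord -[_ *+ _]mulr_natl powRM // ?(ltW NR) //.
  rewrite powRD; last by rewrite (gt_eqF NR) implybT.
  rewrite powRr1 ?(ltW NR) //.
  have -> : D6 * C1 * 2 `^ s * (N%:R `^ s * N%:R) = N%:R * (D6 * (C1 * (2 `^ s * N%:R `^ s))).
    by ring.
  rewrite ler_wpM2r ?mulr_ge0 ?powR_ge0 ?(ltW D60) ?(ltW C1_gt0) // ler_nat.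
  exact: leq_trans nN.
have half : rnorm (opoly T f (opoly T P u)) <= rnorm u / 2.
  have := fsmall (opoly T P u); set Y := rnorm (opoly T f _) => h.
  have h2 := le_trans h hP.
  have e : N%:R `^ (s + 2) = N%:R `^ (s + 1) * N%:R :> R.
    rewrite -[X in _ = _ * X]powRr1 ?(ltW NR) // -powRD.
      by congr (_ `^ _); ring.
    by rewrite (gt_eqF NR) implybT.
  have P0 : 0 < N%:R `^ (s + 1) :> R by rewrite powR_gt0.
  have h3 : N%:R * Y <= D6 * C1 * 2 `^ s * rnorm u.
    rewrite -(ler_pM2l P0) mulrA -e; apply: le_trans h2 _.
    by rewrite le_eqVlt; apply/orP; left; apply/eqP; ring.
  have hN2' : 2 * (D6 * C1 * 2 `^ s) <= N%:R.
    by apply: le_trans hN2 _; rewrite ler_nat (leq_trans nN2).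
  have un := rnorm_ge0 u.
  rewrite -(ler_pM2l NR); apply: le_trans h3 _.
  set G := D6 * C1 * 2 `^ s in hN2' *.
  by rewrite mulrA ler_pdivlMr // mulrC mulrA ler_wpM2r.
have hH : rnorm (opoly T H x) <= C1 * ((D' ^+ 2 + A1) * N%:R `^ (s + 2^-1)) * rnorm x.
  apply: le_trans (opoly_le H x hT) _; rewrite ler_wpM2r ?rnorm_ge0 //.
  under eq_bigr => k _ do rewrite mulrCA.
  rewrite -mulr_sumr ler_pM2l //.
  apply: (hA1 N n D' (f * P) 1 H N0 fPH _ D'0 sq).
  by rewrite size_poly1 (ltnW n2).
have eu : u = opoly T f (opoly T P u) - opoly T H x by rewrite key addrK.
have : rnorm u <= rnorm (opoly T f (opoly T P u)) + rnorm (opoly T H x).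
  by rewrite {1}eu rnormB.
move: half hH; set V := N%:R `^ _.
have -> : 2 * (C1 * (D' ^+ 2 + A1)) * V * rnorm x =
  2 * (C1 * ((D' ^+ 2 + A1) * V) * rnorm x) by ring.
by move=> h1 h2 h3; exact: half_absorb h3 h1 h2.
Qed.

End Core.

(** * Counting grid points near a set *)

Section Grid.
Variable R : realType.
Local Notation C := R[i].
Variable E : set C.
Hypothesis E0 : E !=set0.

Definition hit (N j : nat) : Prop :=
  exists2 t : R, 2 * pi * j%:R / N%:R <= t <= 2 * pi * j.+1%:R / N%:R & E (expi t).

Definition gridpt (N j : nat) : C := expi (2 * pi * j%:R / N%:R).

Definition grid (N : nat) : seq C :=
  [seq gridpt N j | j <- iota 0 N & `[< hit N j >]].

Lemma gridP N w : w \in grid N ->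
  exists j, [/\ (j < N)%N, hit N j & w = gridpt N j].
Proof.
case/mapP => j; rewrite mem_filter mem_iota => /andP[/asboolP hj /andP[_ jN]] ->.
by exists j.
Qed.

Lemma rnorm_grid N w : w \in grid N -> rnorm w = 1.
Proof. by case/gridP => j [_ _ ->]; exact: rnorm_expi. Qed.

Lemma cell_of N (t : R) : (0 < N)%N -> 0 <= t < 2 * pi ->
  exists2 j, (j < N)%N & 2 * pi * j%:R / N%:R <= t < 2 * pi * j.+1%:R / N%:R.
Proof.
move=> N0 /andP[t0 t1]; have NR : 0 < N%:R :> R by rewrite ltr0n.
have pi0 := pi_gt0 R.
have p2 : 0 < 2 * pi :> R by lra.
pose x := t * N%:R / (2 * pi).
have x0 : 0 <= x by rewrite !mulr_ge0 ?invr_ge0 // ltW.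
have /andP[h1 h2] := truncn_itv x0.
exists (Num.truncn x).
  rewrite -(ltr_nat R); apply: le_lt_trans h1 _.
  by rewrite ltr_pdivrMr // mulrC ltr_pM2l.
apply/andP; split.
  by rewrite ler_pdivrMr // mulrC -ler_pdivlMr.
by rewrite ltr_pdivlMr // [2 * pi * _]mulrC -ltr_pdivrMr.
Qed.

Lemma cell_width N j : (0 < N)%N ->
  2 * pi * j.+1%:R / N%:R - 2 * pi * j%:R / N%:R = 2 * pi / N%:R :> R.
Proof.
move=> N0; rewrite -natr1; field; rewrite pnatr_eq0; lia.
Qed.

Lemma cell_le8 N : (0 < N)%N -> 2 * pi / N%:R <= 8 * N%:R^-1 :> R.
Proof.
move=> N0; rewrite ler_pM2r ?invr_gt0 ?ltr0n //.
by have := pihalf_lt2 R; lra.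
Qed.

Lemma grid_near N e : (0 < N)%N -> E `<=` circle (R := R) -> E e ->
  exists2 w, w \in grid N & rnorm (e - w) <= 8 * N%:R^-1.
Proof.
move=> N0 EC Ee.
have e1 : rnorm e = 1 by have := EC _ Ee; rewrite /circle /= rnormE => -[].
have [t t2 et] := circle_expi e1.
have [j jN /andP[j1 j2]] := cell_of N0 t2.
exists (gridpt N j).
  apply/mapP; exists j => //; rewrite mem_filter mem_iota /= add0n jN andbT.
  by apply/asboolP; exists t; rewrite -?et // j1 ltW.
rewrite et /gridpt; apply: le_trans (expi_lip _ _) _.
rewrite ger0_norm ?subr_ge0 //; apply: le_trans (cell_le8 N0).
by rewrite -(cell_width j N0) lerD2r ltW.
Qed.

Lemma dist_hit N j t : (0 < N)%N -> hit N j ->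
  2 * pi * j%:R / N%:R <= t <= 2 * pi * j.+1%:R / N%:R ->
  dist (expi t) E <= 8 * N%:R^-1.
Proof.
move=> N0 [u /andP[u1 u2] Eu] /andP[t1 t2].
apply: le_trans (dist_le E0 (expi t) Eu) _.
apply: le_trans (expi_lip _ _) _; apply: le_trans (cell_le8 N0).
by rewrite -(cell_width j N0) ler_norml; apply/andP; split; lra.
Qed.

Lemma continuous_dist : continuous (fun t : R => dist (expi t) E).
Proof.
move=> t; apply/cvgrPdist_le => /= e e0.
near=> u.
have h : `|t - u| <= e by near: u; apply/nbhs_ballP; exists e => //= u /ltW.
have h1 := dist_lip E0 (expi t) (expi u); have h2 := dist_lip E0 (expi u) (expi t).
have h3 := expi_lip t u; have h4 := expi_lip u t; rewrite distrC in h4.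
by rewrite ler_norml; apply/andP; split; lra.
Unshelve. all: by end_near. Qed.

Lemma measurable_weight (de : R) (D : set R) : measurable D ->
  measurable_fun D (fun t : R => (((dist (expi t) E `^ de)%:E)^-1)%E : \bar R).
Proof.
move=> mD.
have md : measurable_fun [set: R] (fun t : R => dist (expi t) E).
  exact: continuous_measurable_fun continuous_dist.
rewrite (_ : (fun t => _) = (fun t => if dist (expi t) E `^ de == 0 then +oo%E
   else (dist (expi t) E `^ (- de))%:E)); last first.
  by apply/funext => t; rewrite inver powRN.
apply: measurable_funTS.
have mp a : measurable_fun [set: R] (fun t : R => dist (expi t) E `^ a).
  exact: measurableT_comp (measurable_powR a) md.
apply: measurable_fun_ifT => //.
  exact: measurable_fun_eqr.
exact/measurable_EFinP.
Qed.

(** On a cell met by E the distance to E is at most 8/N, so the integrand is at least (8/N)^-de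
    there. Integrating over these cells, of length 2 pi / N each, bounds their number. *)
Lemma grid_size_le (de : R) : 0 <= de ->
  (\int[lebesgue_measure]_(t in `[0%R, (2 * pi)%R])
       ((dist (expi t) E `^ de)%:E)^-1 < +oo)%E ->
  exists2 A, 0 < A & forall N, (0 < N)%N -> (size (grid N))%:R <= A * N%:R `^ (1 - de).
Proof.
move=> de0; set I := (\int[_]_(t in _) _)%E => Ifin.
have pi0 := pi_gt0 R.
have I0 : (0 <= I)%E.
  apply: integral_ge0 => t _; rewrite inver; case: ifP => // _.
  by rewrite lee_fin invr_ge0 powR_ge0.
have [a aE] : exists a : R, I = a%:E.
  by move: I0 Ifin; case: (I) => // a _ _; exists a.
have a0 : 0 <= a by move: I0; rewrite aE lee_fin.
exists (a * 8 `^ de + 1); first by rewrite ltr_wpDl // mulr_ge0 ?powR_ge0.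
move=> N N0; have NR : 0 < N%:R :> R by rewrite ltr0n.
(* Half-open cells are disjoint, so their measures add; the closed cells of [hit] share
   endpoints. *)
pose cell (j : 'I_N) : set R := `[2 * pi * j%:R / N%:R, 2 * pi * j.+1%:R / N%:R[%classic.
pose P (j : 'I_N) := `[< hit N j >].
pose U := \big[setU/set0]_(j < N | P j) cell j.
have ord_lt (x y : R) (j k : nat) :
    2 * pi * j%:R / N%:R <= x -> x < 2 * pi * k%:R / N%:R -> (j < k)%N.
  move=> h1 h2; have := le_lt_trans h1 h2.
  by rewrite ltr_pM2r ?invr_gt0 // ltr_pM2l ?ltr_nat //; lra.
have mU : (lebesgue_measure U = (\sum_(j < N | P j) (2 * pi / N%:R)%:E))%E.
  rewrite /U measure_bigsetU_ord_cond //; last first.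
    move=> i j _ _ [t [/=]]; rewrite /cell /= !in_itv /= => /andP[i1 i2] /andP[j1 j2].
    have := ord_lt _ 0 _ _ i1 j2; have := ord_lt _ 0 _ _ j1 i2.
    by move=> h1 h2; apply: val_inj => /=; clear -h1 h2; lia.
    by move=> j _; exact: measurable_itv.
  apply: eq_bigr => j _; transitivity (lebesgue_measure (cell j)); first by [].
  rewrite /cell lebesgue_measure_itv /= lte_fin.
  have hw := cell_width j N0.
  have -> : 2 * pi * j%:R / N%:R < 2 * pi * j.+1%:R / N%:R :> R.
    by rewrite -subr_gt0 hw !mulr_gt0 ?invr_gt0.
  by rewrite -EFinB hw.
have cellP t : U t -> exists j : 'I_N, P j /\ cell j t.
  move: t; apply: (big_ind (fun S : set R => forall t, S t -> exists j, P j /\ cell j t)).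
  - by [].
  - by move=> S1 S2 h1 h2 t [/h1|/h2].
  by move=> j Pj t ct; exists j.
pose c : R := (8 * N%:R^-1) `^ (- de).
have c0 : 0 <= c by exact: powR_ge0.
have msU : measurable U.
  by apply: bigsetU_measurable => j _; exact: measurable_itv.
have UD : U `<=` `[0%R, 2 * pi]%classic.
  move=> t /cellP[j [_]]; rewrite /cell /= !in_itv /= => /andP[h1 h2].
  apply/andP; split.
    by apply: le_trans h1; rewrite !mulr_ge0 ?invr_ge0 // ltW.
  apply: ltW; apply: lt_le_trans h2 _; rewrite ler_pdivrMr // ler_pM2l ?ler_nat //.
  by lra.
have : (\int[lebesgue_measure]_(t in `[0%R, (2 * pi)%R]) (c%:E * (\1_U t)%:E) <= I)%E.
  apply: ge0_le_integral => //.
  - by move=> t _; rewrite mule_ge0 // lee_fin.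
  - apply: measurable_funTS; apply: measurable_funeM.
    by apply/measurable_EFinP; exact: measurable_indic.
  - exact: measurable_weight.
  move=> t _; rewrite indicE; case: (boolP (t \in U)) => [|_]; last first.
    rewrite mule0 inver; case: ifP => // _; by rewrite lee_fin invr_ge0 powR_ge0.
  rewrite inE => /cellP[j [/asboolP hj]]; rewrite /cell /= in_itv /= => /andP[j1 j2].
  have hd : dist (expi t) E <= 8 * N%:R^-1 by apply: dist_hit hj _ => //; rewrite j1 ltW.
  rewrite mule1 inver; case: eqP => [_|/eqP nz]; first by rewrite leey.
  have dp : 0 < dist (expi t) E `^ de by rewrite lt_neqAle eq_sym nz powR_ge0.
  have cp : 0 < (8 * N%:R^-1) `^ de :> R by rewrite powR_gt0 // mulr_gt0 ?invr_gt0.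
  rewrite lee_fin /c powRN lef_pV2 ?posrE //.
  by rewrite ge0_ler_powR ?nnegrE ?dist_ge0 ?mulr_ge0 ?invr_ge0 // ltW.
rewrite ge0_integralZl_EFin //; last first.
  by apply: measurable_funTS; apply/measurable_EFinP; exact: measurable_indic.
rewrite integral_indic // setIidl // -[X in (_ * X)%E]/(lebesgue_measure U) mU aE sumEFin -EFinM lee_fin.
rewrite sumr_const => h.
have sz : size (grid N) = #|[pred j : 'I_N | P j]|.
  rewrite /grid size_map size_filter -sum1_count -{1}(subn0 N) -/(index_iota 0 N).
  by rewrite big_mkord sum1_card.
move: h; rewrite -[#|_|]/(#|[pred j : 'I_N | P j]|) -sz -[_ *+ _]mulr_natl.
set k : R := (size (grid N))%:R => h.
have k0 : 0 <= k by [].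
have cE : c = N%:R `^ de / 8 `^ de.
  rewrite /c powRM ?invr_ge0 // powRN mulrC; congr (_ * _).
  by rewrite -powR_inv1 // -powRrM mulN1r opprK.
have p1 : 1 <= 2 * pi :> R by have := pi_ge2 R; lra.
have P8 : 0 < 8 `^ de :> R by rewrite powR_gt0.
have h2 : k * N%:R `^ de <= a * 8 `^ de * N%:R.
  rewrite -ler_pdivrMr // -ler_pdivrMr //; apply: le_trans h.
  have -> : k * N%:R `^ de / N%:R / 8 `^ de = 1 * (k * c / N%:R).
    by rewrite cE; field; rewrite !gt_eqF.
  have -> : c * (k * (2 * pi / N%:R)) = 2 * pi * (k * c / N%:R) by ring.
  by rewrite ler_wpM2r // !mulr_ge0 ?invr_ge0 // ltW.
have PN : 0 < N%:R `^ de :> R by rewrite powR_gt0.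
rewrite powRD; last by rewrite (gt_eqF NR) implybT.
rewrite powRr1 ?(ltW NR) // powRN mulrA ler_pdivlMr //.
by apply: le_trans h2 _; rewrite ler_pM2r // lerDl.
Qed.

End Grid.

(** * Counting cells with the K-set condition *)

Section Porous.
Variable R : realType.
Local Notation C := R[i].
Variable E : set C.

Lemma big_blocks (V : Type) (idx : V) (op : Monoid.law idx) (F : nat -> V) n Q :
  \big[op/idx]_(j < n * Q) F j = \big[op/idx]_(i < n) \big[op/idx]_(l < Q) F (i * Q + l)%N.
Proof.
elim: n => [|n ih]; first by rewrite mul0n !big_ord0.
rewrite big_ord_recr /= -ih.
have -> : \big[op/idx]_(j < n.+1 * Q) F j = \big[op/idx]_(j < n * Q + Q) F j by rewrite mulSnr.
by rewrite big_split_ord.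
Qed.

(** By the convention [inf set0 = 0] the distance to the empty set is 0, against the inequality for
    the whole circle. *)
Lemma Kset_nonempty : Kset E -> E !=set0.
Proof.
move=> [_ _ [c c0 h]]; apply/set0P/eqP => E0.
have pi0 := pi_gt0 R.
have := h 0 (2 * pi) ltac:(lra) ltac:(lra).
have -> : [set dist z E | z in arc 0 (2 * pi)] = [set 0].
  apply/seteqP; split => [_ [z _ <-]|_ ->].
    by rewrite /dist E0 image_set0 inf0.
  exists (expi 0); last by rewrite /dist E0 image_set0 inf0.
  by exists 0 => //; rewrite /= in_itv /= lexx /=; lra.
by rewrite sup1 subr0; nra.
Qed.

Hypothesis E0 : E !=set0.

Definition subhit (a l : R) (Q j : nat) : Prop :=
  exists2 t, a + l * j%:R / Q%:R <= t <= a + l * j.+1%:R / Q%:R & E (expi t).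

Section Count.
Variables (c : R) (q : nat).
Hypotheses (c0 : 0 < c) (cq : 2 / c <= q%:R) (q2 : (2 <= q)%N).
Hypothesis porous : forall a b : R, a <= b -> b <= a + 2 * pi ->
  c * (b - a) <= sup [set dist z E | z in arc a b].

(** Some t in the arc has distance to E above c l / 2 >= l / q, so the child cell containing t
    misses E. *)
Lemma empty_child (a l : R) : 0 < l -> l <= 2 * pi ->
  exists2 i, (i < q)%N & ~ exists2 t, a + l * i%:R / q%:R <= t <= a + l * i.+1%:R / q%:R &
    E (expi t).
Proof.
move=> l0 l2.
have qR : 0 < q%:R :> R by rewrite ltr0n (ltnW q2).
have h := porous (a := a) (b := a + l) ltac:(lra) ltac:(lra).
have cl : c * l / 2 < sup [set dist z E | z in arc a (a + l)].
  apply: lt_le_trans h; have -> : a + l - a = l by ring.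
  have : 0 < c * l by rewrite mulr_gt0.
  lra.
have [|_ [z [t /= ta <-] <-] hd] := sup_gt _ cl.
  exists (dist (expi a) E), (expi a) => //; exists a => //=.
  by rewrite in_itv /= lexx /=; lra.
move: ta; rewrite in_itv /= => /andP[ta tl].
have x0 : 0 <= (t - a) * q%:R / l by rewrite !mulr_ge0 ?invr_ge0 ?subr_ge0 // ltW.
have key u : `|u - t| <= l / q%:R -> ~ E (expi u).
  move=> hu Eu; have := dist_le E0 (expi t) Eu.
  have := expi_lip t u; rewrite distrC => h1 h2.
  have h3 : l / q%:R <= c * l / 2.
    rewrite ler_pdivrMr //.
    have := cq; rewrite ler_pdivrMr // => h4.
    have : 2 * l <= q%:R * c * l by rewrite ler_pM2r.
    lra.
  lra.
have lq0 : 0 < l / q%:R by rewrite divr_gt0.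
have wid j : a + l * j.+1%:R / q%:R = a + l * j%:R / q%:R + l / q%:R.
  by rewrite -natr1; field; rewrite gt_eqF.
have close i : a + l * i%:R / q%:R <= t <= a + l * i.+1%:R / q%:R ->
    ~ exists2 u, a + l * i%:R / q%:R <= u <= a + l * i.+1%:R / q%:R & E (expi u).
  move=> /andP[t1 t2] [u /andP[u1 u2]]; apply: key.
  by rewrite wid in t2 u2; rewrite ler_norml; apply/andP; split; lra.
(* At the right end the quotient is q itself, one beyond the last index; the last cell is taken
   instead. *)
have [te|tne] := eqVneq t (a + l).
  exists q.-1; first by rewrite ltn_predL (ltnW q2).
  apply: close; rewrite (prednK (ltnW q2)).
  have -> : q.-1%:R = q%:R - 1 :> R by rewrite -[in RHS](prednK (ltnW q2)) -natr1 addrK.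
  rewrite te; apply/andP; split.
    rewrite lerD2l ler_pdivrMr // ler_pM2l //; lra.
  by rewrite mulfK ?gt_eqF.
have tl' : t < a + l by rewrite lt_neqAle tne.
have /andP[h1 h2] := truncn_itv x0.
exists (Num.truncn ((t - a) * q%:R / l)).
  rewrite -(ltr_nat R); apply: le_lt_trans h1 _.
  by rewrite ltr_pdivrMr // mulrC ltr_pM2l // ltrBlDl.
apply: close; apply/andP; split.
  rewrite -lerBrDl ler_pdivrMr // mulrC -ler_pdivlMr //.
rewrite -lerBlDl ler_pdivlMr // [l * _]mulrC -ler_pdivrMr //; exact: ltW.
Qed.

(** As for a Cantor set, one child is empty at each of the k subdivisions, so at most q - 1 of q
    branches survive. *)
Lemma subhit_count k (a l : R) : 0 < l -> l <= 2 * pi ->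
  (\sum_(j < q ^ k) `[< subhit a l (q ^ k) j >] <= q.-1 ^ k)%N.
Proof.
elim: k a l => [|k ih] a l l0 l2; first by rewrite !expn0 big_ord1; case: asboolP.
have qR : 0 < q%:R :> R by rewrite ltr0n (ltnW q2).
have [i0 i0q hi0] := empty_child a l0 l2.
rewrite expnS (big_blocks _ (fun j => nat_of_bool `[< subhit a l (q * q ^ k) j >])).
have lq0 : 0 < l / q%:R by rewrite divr_gt0.
have lq2 : l / q%:R <= 2 * pi.
  by apply: le_trans l2; rewrite ler_pdivrMr // ler_peMr ?(ltW l0) // ler1n (ltnW q2).
have Q0 : 0 < (q ^ k)%:R :> R by rewrite ltr0n expn_gt0 (ltnW q2).
have e (i j : nat) : a + l * (i * q ^ k + j)%:R / (q * q ^ k)%:R =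
   a + l * i%:R / q%:R + l / q%:R * j%:R / (q ^ k)%:R.
  by rewrite !natrM natrD natrM; field; rewrite !gt_eqF.
have sub (i j : nat) : subhit a l (q * q ^ k) (i * q ^ k + j) ->
    subhit (a + l * i%:R / q%:R) (l / q%:R) (q ^ k) j.
  by move=> [t ht Et]; exists t => //; rewrite -!e addnS.
have child i : (\sum_(j < q ^ k) `[< subhit a l (q * q ^ k) (i * q ^ k + j) >] <=
    q.-1 ^ k)%N.
  apply: leq_trans (ih (a + l * i%:R / q%:R) _ lq0 lq2); apply: leq_sum => j _.
  by case: asboolP => // h; case: asboolP => // -[]; exact: sub.
have empty : (\sum_(j < q ^ k) `[< subhit a l (q * q ^ k) (i0 * q ^ k + j) >] = 0)%N.
  apply: big1 => j _; case: asboolP => // /sub[t /andP[t1 t2] Et].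
  case: hi0; exists t => //; apply/andP; split.
    by apply: le_trans t1; rewrite lerDl !mulr_ge0 ?invr_ge0 // ltW.
  apply: le_trans t2 _.
  have -> : a + l * i0.+1%:R / q%:R = a + l * i0%:R / q%:R + l / q%:R.
    by rewrite -natr1; field; rewrite gt_eqF.
  rewrite lerD2l ler_pdivrMr // ler_pM2l //.
  by rewrite ler_nat.
rewrite (bigD1 (Ordinal i0q)) //= empty add0n.
apply: leq_trans (_ : _ <= \sum_(i < q | i != Ordinal i0q) q.-1 ^ k)%N _.
  by apply: leq_sum => i _; exact: child.
rewrite sum_nat_const cardC1 card_ord expnS //.
Qed.

(** The minimum with n - d reflects the circle closing up: beyond pi the chord is that of 2 pi -
    |x|. *)
Lemma chord_ge2 (x : R) d n : (d <= n)%N -> (0 < n)%N ->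
  2 * pi * (d%:R - 1) / n%:R <= `|x| -> `|x| <= 2 * pi * (d%:R + 1) / n%:R ->
  Num.min (d%:R - 1) (n%:R - d%:R - 1) / n%:R <= rnorm (expi x - 1) / 2.
Proof.
move=> dn n0 h1 h2; have nR : 0 < n%:R :> R by rewrite ltr0n.
have pi2 := pi_ge2 R.
set y := `|x| in h1 h2.
have y0 : 0 <= y by exact: normr_ge0.
have xe : rnorm (expi x - 1) = rnorm (expi y - 1).
  rewrite !chordE; have [h|h] := leP 0 x; first by rewrite /y (ger0_norm h).
  by rewrite /y (ltr0_norm h) mulNr sinN mulrN normrN.
rewrite xe ler_pdivrMr //.
have e1 : 2 * pi * (d%:R - 1) <= y * n%:R by rewrite -ler_pdivrMr.
have e2 : y * n%:R <= 2 * pi * (d%:R + 1) by rewrite -ler_pdivlMr.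
have [yp|yp] := leP y pi.
  have := @chord_ge R y; rewrite ger0_norm // => /(_ yp) h.
  apply: (@le_trans _ _ (d%:R - 1)); first by rewrite ge_min lexx.
  have : y * n%:R <= rnorm (expi y - 1) * 2 * n%:R by rewrite ler_pM2r //; lra.
  have [d1|d1] := leP (d%:R : R) 1; last by nra.
  have : 0 <= rnorm (expi y - 1) / 2 * n%:R.
    by rewrite mulr_ge0 // divr_ge0 // rnorm_ge0.
  lra.
set v := 2 * pi - y.
have ev : rnorm (expi y - 1) = rnorm (expi v - 1).
  rewrite /v expiD expi2pi mul1r -conj_expi.
  by rewrite -(rnorm_conj (expi y - 1)) rmorphB rmorph1.
apply: (@le_trans _ _ (n%:R - d%:R - 1)); first by rewrite ge_min lexx orbT.
have nn0 : 0 <= rnorm (expi y - 1) / 2 * n%:R.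
  by rewrite mulr_ge0 // divr_ge0 // rnorm_ge0.
have [m1|m1] := leP (n%:R - d%:R - 1 : R) 0; first by lra.
have v0 : 0 <= v.
  have : y * n%:R <= 2 * pi * n%:R by apply: le_trans e2 _; rewrite ler_wpM2l; lra.
  by rewrite ler_pM2r // /v; lra.
have := @chord_ge R v; rewrite ger0_norm // => /(_ ltac:(rewrite /v; lra)) h.
have : v * n%:R <= rnorm (expi y - 1) * 2 * n%:R by rewrite ler_pM2r // ev; lra.
have : 2 * pi * (n%:R - d%:R - 1) <= v * n%:R by rewrite /v; lra.
nra.
Qed.

(** Scaling by 1/(1 + r) gives a point u of the disc with direction w, and |1 - w| <= |1 - u| + (1 -
    |u|) <= 2 |1 - u|. *)
Lemma gap_ge (z w : C) (r : R) : 0 <= r -> rnorm z <= 1 -> rnorm w = 1 ->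
  z = (rnorm z)%:C * w -> rnorm (1 - w) / 2 <= rnorm ((1 + r)%:C - z).
Proof.
move=> r0 z1 w1 ez; set s := 1 + r.
have s1 : 1 <= s by rewrite lerDl.
have sC : s%:C != 0 by rewrite (inj_eq (@realC_inj R)) gt_eqF //; lra.
pose u := s%:C^-1 * z.
have zu : z = s%:C * u by rewrite /u mulrA divff // mul1r.
have un : rnorm u = rnorm z / s by rewrite /u rnormM rnormV rnormR ?[s^-1 * _]mulrC //; lra.
have u1 : rnorm u <= 1 by rewrite un ler_pdivrMr; lra.
have uw : u = (rnorm u)%:C * w.
  by rewrite {1}/u {1}ez un mulrA rmorphM fmorphV [s%:C^-1 * _]mulrC.
have h1 : rnorm (u - w) = 1 - rnorm u.
  rewrite {1}uw -{2}[w]mul1r -mulrBl rnormM w1 mulr1 -rmorphB rnormC.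
  by rewrite ler0_norm; lra.
have h2 : 1 - rnorm u <= rnorm (1 - u).
  by have := rnorm_ge_dist (1 : C) u; rewrite rnorm1.
have h3 : rnorm (1 - w) <= 2 * rnorm (1 - u).
  have -> : 1 - w = (1 - u) + (u - w) by rewrite addrA subrK.
  by apply: le_trans (rnormD _ _) _; lra.
have h4 : rnorm (1 - u) <= rnorm (s%:C - z).
  have -> : s%:C - z = s%:C * (1 - u) by rewrite mulrBr mulr1 -zu.
  rewrite rnormM rnormR; last by lra.
  by rewrite ler_peMl // rnorm_ge0.
lra.
Qed.

Lemma abs_near (d x : R) : d - 1 <= x -> x <= d + 1 -> `|d| - 1 <= `|x| <= `|d| + 1.
Proof.
move=> h1 h2; have h : `|d - x| <= 1 by rewrite ler_norml; apply/andP; split; lra.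
have := lerB_dist d x; have := lerB_dist x d; rewrite (distrC x) => h3 h4.
by apply/andP; split; lra.
Qed.

(** Adding both terms avoids deciding which way round the circle is shorter. As 1 <= S n, m - 1 <= S
    n implies 1 + m <= 3 S n, and likewise for n - m. *)
Lemma inv_le_two (m n S : R) : 0 <= m -> 0 < n -> 1 <= S * n -> m <= n ->
  Num.min (m - 1) (n - m - 1) <= S * n ->
  S^-1 <= 3 * n * ((1 + m)^-1 + (1 + (n - m))^-1).
Proof.
move=> m0 n0 S1 mn S2; have S0 : 0 < S by rewrite -(pmulr_lgt0 _ n0); lra.
have one y : 0 <= y -> 1 + y <= 3 * (S * n) -> S^-1 <= 3 * n * (1 + y)^-1.
  move=> y0 hy; rewrite -[S^-1]mul1r ler_pdivrMr // mulrAC ler_pdivlMr; last by lra.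
  by rewrite mul1r; lra.
have pos y : 0 <= y -> 0 <= 3 * n * (1 + y)^-1.
  by move=> y0; apply: mulr_ge0; [lra | rewrite invr_ge0; lra].
have nm0 : 0 <= n - m by lra.
rewrite mulrDr; have [hle|hle] := leP (m - 1) (n - m - 1).
  apply: ler_wpDr; [exact: pos | apply: one => //].
  by move: S2; rewrite minElt; case: ifP => _; lra.
apply: ler_wpDl; [exact: pos | apply: one => //].
by move: S2; rewrite minElt; case: ifP => _; lra.
Qed.

(** The grid is grouped in n blocks of q^k cells, n being the scale of the radius 1 - 1/n. A block m
    steps away from the argument of z has at most (q - 1)^k terms, each at most of order n/(1 + m) +
    n/(1 + n - m), and the harmonic sum gives the logarithm. *)
Lemma grid_sum_le n k z : (2 <= n)%N -> rnorm z = 1 - n%:R^-1 ->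
  \sum_(w <- grid E (n * q ^ k)) (rnorm ((1 + (n * q ^ k)%:R^-1)%:C - z * w^*%C))^-1 <=
  (q.-1 ^ k)%:R * (12 * n%:R * (1 + ln n%:R)).
Proof.
move=> n2 zn; set Q := (q ^ k)%N; set N := (n * Q)%N.
have n0 : (0 < n)%N := ltnW n2.
have nR : 0 < n%:R :> R by rewrite ltr0n.
have n1R : 1 <= n%:R :> R by rewrite ler1n.
have q0 : (0 < q)%N := ltnW q2.
have Q0 : (0 < Q)%N by rewrite expn_gt0 q0.
have QR : 0 < Q%:R :> R by rewrite ltr0n.
have nV : n%:R^-1 <= 1 / 2 :> R by rewrite div1r lef_pV2 ?posrE // ler_nat.
have nV0 : 0 < n%:R^-1 :> R by rewrite invr_gt0.
have NV0 : 0 < N%:R^-1 :> R by rewrite invr_gt0 ltr0n muln_gt0 n0.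
have zn0 : 0 < rnorm z by rewrite zn; lra.
have zC : (rnorm z)%:C != 0 by rewrite (inj_eq (@realC_inj R)) gt_eqF.
have [th th2 eth] : exists2 th, 0 <= th < 2 * pi & z = (rnorm z)%:C * expi th.
  have [|th th2 e] := @circle_expi R ((rnorm z)%:C^-1 * z).
    by rewrite rnormM rnormV rnormR ?rnorm_ge0 // mulVf // gt_eqF.
  by exists th => //; rewrite -e mulrA divff // mul1r.
have [i0 i0n /andP[t1 t2]] := cell_of n0 th2.
have pi2 := pi_ge2 R.
pose F (m : nat) : R := 3 * n%:R * ((1 + m%:R)^-1 + (1 + (n - m)%:R)^-1).
have F0 m : 0 <= F m by rewrite !mulr_ge0 ?addr_ge0 ?invr_ge0 // addr_ge0.
pose g j := (rnorm ((1 + N%:R^-1)%:C - z * (gridpt R N j)^*%C))^-1.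
have gle i l : (i < n)%N -> (l < Q)%N -> g (i * Q + l)%N <= F (dst i i0).
  move=> ni lQ; set m := dst i i0.
  pose al : R := 2 * pi * (i * Q + l)%:R / N%:R.
  have mn : (m <= n)%N.
    by rewrite /m /dst; clear -ni i0n; lia.
  have alE : al = 2 * pi * (i%:R + l%:R / Q%:R) / n%:R.
    by rewrite /al /N natrD !natrM; field; rewrite !gt_eqF.
  have lQ1 : 0 <= (l%:R / Q%:R : R) <= 1.
    by rewrite divr_ge0 //= ler_pdivrMr // mul1r ler_nat ltnW.
  have zwE : z * (gridpt R N (i * Q + l)%N)^*%C = (rnorm z)%:C * expi (th - al).
    by rewrite {1}eth /gridpt -/al conj_expi -mulrA -expiD.
  have zwn : rnorm (z * (gridpt R N (i * Q + l)%N)^*%C) = rnorm z.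
    by rewrite zwE rnormM rnorm_expi mulr1 rnormR // ltW.
  have gap1 : n%:R^-1 <= rnorm ((1 + N%:R^-1)%:C - z * (gridpt R N (i * Q + l)%N)^*%C).
    have := rnorm_ge_dist ((1 + N%:R^-1)%:C : C) (z * (gridpt R N (i * Q + l)%N)^*%C).
    rewrite zwn rnormR ?zn; lra.
  have gap2 : rnorm (expi (th - al) - 1) / 2 <=
      rnorm ((1 + N%:R^-1)%:C - z * (gridpt R N (i * Q + l)%N)^*%C).
    rewrite rnormBC; apply: gap_ge; rewrite ?rnorm_expi ?zwn //; first [exact: (ltW NV0) | lra].
  have diff : i%:R - i0%:R - 1 <= (al - th) * n%:R / (2 * pi) <= i%:R - i0%:R + 1.
    have p2 : 0 < 2 * pi :> R by lra.
    have a1 : 2 * pi * i0%:R <= th * n%:R by rewrite -ler_pdivrMr.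
    have a2 : th * n%:R <= 2 * pi * (i0%:R + 1) by rewrite natr1 -ler_pdivlMr // ltW.
    have a3 : al * n%:R = 2 * pi * (i%:R + l%:R / Q%:R) by rewrite alE divfK // gt_eqF.
    move: lQ1; set f := l%:R / Q%:R in a3 * => /andP[f0 f1].
    have -> : (al - th) * n%:R = 2 * pi * (i%:R + f) - th * n%:R by rewrite mulrBl a3.
    rewrite ler_pdivlMr // ler_pdivrMr //.
    by apply/andP; split; nra.
  have nd : m%:R = `|i%:R - i0%:R| :> R.
    rewrite /m /dst; case: (leqP i i0) => h.
      have -> : (i - i0 = 0)%N by apply/eqP; rewrite subn_eq0.
      by rewrite add0n natrB // distrC ger0_norm // subr_ge0 ler_nat.
    have -> : (i0 - i = 0)%N by apply/eqP; rewrite subn_eq0 ltnW.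
    by rewrite addn0 natrB ?(ltnW h) // ger0_norm // subr_ge0 ler_nat ltnW.
  have x1 : 2 * pi * (m%:R - 1) / n%:R <= `|th - al|.
    rewrite ler_pdivrMr // distrC.
    have p2 : 0 < 2 * pi :> R by lra.
    set X := (al - th) * n%:R / (2 * pi) in diff.
    have eX : `|al - th| * n%:R = 2 * pi * `|X|.
      rewrite /X !normrM normfV !(ger0_norm (ltW nR)) (ger0_norm (ltW p2)).
      by rewrite [RHS]mulrC divfK // gt_eqF.
    rewrite eX ler_pM2l // nd; move: diff => /andP[d1 d2].
    by have /andP[] := abs_near d1 d2.
  have x2 : `|th - al| <= 2 * pi * (m%:R + 1) / n%:R.
    rewrite ler_pdivlMr // distrC.
    have p2 : 0 < 2 * pi :> R by lra.
    set X := (al - th) * n%:R / (2 * pi) in diff.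
    have eX : `|al - th| * n%:R = 2 * pi * `|X|.
      rewrite /X !normrM normfV !(ger0_norm (ltW nR)) (ger0_norm (ltW p2)).
      by rewrite [RHS]mulrC divfK // gt_eqF.
    rewrite eX ler_pM2l // nd; move: diff => /andP[d1 d2].
    by have /andP[] := abs_near d1 d2.
  have h := chord_ge2 mn n0 x1 x2.
  rewrite /g /F natrB //; set S := rnorm (_ - z * _) in gap1 gap2 *.
  apply: inv_le_two => //; [by rewrite -ler_pdivrMr // div1r | by rewrite ler_nat|].
  by rewrite -ler_pdivrMr //; apply: le_trans h gap2.
have -> : \sum_(w <- grid E N) (rnorm ((1 + N%:R^-1)%:C - z * w^*%C))^-1 =
   \sum_(j < n * Q) `[< hit E N j >]%:R * g j.
  rewrite /grid big_map big_filter big_mkcond /= -{1}(subn0 N) -/(index_iota 0 N) big_mkord.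
  by apply: eq_bigr => j _; case: ifP => _; rewrite ?mul1r ?mul0r.
rewrite (big_blocks _ (fun j => `[< hit E N j >]%:R * g j)).
apply: (@le_trans _ _ (\sum_(i < n) (q.-1 ^ k)%:R * F (dst i i0))).
  apply: ler_sum => i _.
  apply: (@le_trans _ _ (\sum_(l < Q) `[< hit E N (i * Q + l)%N >]%:R * F (dst i i0))).
    by apply: ler_sum => l _; rewrite ler_wpM2l // gle.
  rewrite -mulr_suml ler_wpM2r // -natr_sum ler_nat.
  have l0 : 0 < 2 * pi / n%:R :> R by rewrite divr_gt0 //; lra.
  have l2 : 2 * pi / n%:R <= 2 * pi :> R by rewrite ler_pdivrMr // ler_peMr //; lra.
  apply: leq_trans (subhit_count k (2 * pi * i%:R / n%:R) l0 l2); apply: leq_sum => l _.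
  have e (j : nat) : 2 * pi * (i * Q + j)%:R / N%:R =
     2 * pi * i%:R / n%:R + 2 * pi / n%:R * j%:R / (q ^ k)%:R :> R.
    by rewrite /N natrD !natrM -/Q; field; rewrite !gt_eqF.
  case: asboolP => // -[t ht Et]; case: asboolP => // -[]; exists t => //.
  by rewrite -!e addnS.
rewrite -mulr_sumr ler_wpM2l //.
apply: le_trans (sum_dst_le F0 i0n) _.
rewrite /F -mulr_sumr big_split /=.
have hh := harmonic_le R n0.
have h2 : \sum_(m < n) (1 + (n - m)%:R)^-1 <= \sum_(m < n) (1 + m%:R)^-1 :> R.
  rewrite (reindex_inj rev_ord_inj) /=; apply: ler_sum => m _.
  rewrite lef_pV2 ?posrE ?ltr_wpDr //.
  by apply: lerD => //; rewrite ler_nat; move: (ltn_ord m); clear; lia.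
set S1 := \sum_(_ < _) _ in h2 *; set S2 := \sum_(_ < _) _ in hh h2 *.
have : 3 * n%:R * (S2 + S1) <= 3 * n%:R * (2 * (1 + ln n%:R)).
  by rewrite ler_wpM2l ?mulr_ge0 //; lra.
lra.
Qed.

End Count.

End Porous.

Section Fine.
Variable R : realType.
Local Notation C := R[i].
Variable E : set C.
Hypothesis E0 : E !=set0.

Lemma fine_grid (ep : R) : Kset E -> 0 < ep ->
  exists gam Cz A : R, [/\ 0 < gam, 0 < Cz, 0 < A &
    forall n, (2 <= n)%N -> exists N, [/\ (n <= N)%N, N%:R <= A * n%:R `^ (1 + ep) &
      forall z, rnorm z = 1 - n%:R^-1 ->
      \sum_(w <- grid E N) (rnorm ((1 + N%:R^-1)%:C - z * w^*%C))^-1 <=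
        Cz * N%:R `^ (1 - gam)]].
Proof.
move=> [_ _ [c c0 por]] ep0.
have [q0 hq0] := nat_above (2 / c).
pose q := maxn 2 q0.
have q2 : (2 <= q)%N by rewrite leq_maxl.
have qc : 2 / c <= q%:R by apply: le_trans hq0 _; rewrite ler_nat leq_maxr.
have qR2 : 2 <= q%:R :> R by rewrite ler_nat.
have qR : 0 < q%:R :> R by lra.
have q1R : q.-1%:R = q%:R - 1 :> R by rewrite -[in RHS](prednK (ltnW q2)) -natr1 addrK.
have q1R0 : 0 < q.-1%:R :> R by rewrite q1R; lra.
pose lq := ln (q%:R : R); pose la := lq - ln (q.-1%:R : R).
have lq0 : 0 < lq by rewrite ln_gt0 //; lra.
have la0 : 0 < la by rewrite subr_gt0 ltr_ln ?posrE // q1R; lra.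
(* With q^k about n^ep, ((q - 1)/q)^k is at most n^-a. Half of a pays for the logarithm; the other
   half, expressed in N of order at most n^(1 + ep), becomes [gam]. *)
pose a := ep * la / lq.
have a0 : 0 < a by rewrite divr_gt0 // mulr_gt0.
pose gam := a / 2 / (1 + ep).
have ep1 : 0 < 1 + ep by lra.
have gam0 : 0 < gam by apply: divr_gt0 => //; apply: divr_gt0.
exists gam, (12 * (1 + 2 / a) * q%:R `^ gam), q%:R.
split => //; first by rewrite !mulr_gt0 ?powR_gt0 // addr_gt0 // divr_gt0 //.
move=> n n2.
have n0 : (0 < n)%N := ltnW n2.
have nR : 0 < n%:R :> R by rewrite ltr0n.
have n1R : 1 <= n%:R :> R by rewrite ler1n.
have ln0 : 0 <= ln (n%:R : R) by rewrite ln_ge0.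
have [k /andP[k1 k2]] := @nat_ceil R (ep * ln n%:R / lq) ltac:(by rewrite !mulr_ge0 ?invr_ge0 // ltW).
exists (n * q ^ k)%N.
have Q1 : (0 < q ^ k)%N by rewrite expn_gt0 (ltnW q2).
have nle : (n <= n * q ^ k)%N by rewrite leq_pmulr.
have Qle : (q ^ k)%:R <= q%:R * n%:R `^ ep :> R.
  rewrite natrX -powR_mulrn ?(ltW qR) //.
  rewrite /powR !gt_eqF // -/lq [X in _ <= X * _](_ : _ = expR lq); last by rewrite lnK.
  rewrite -expRD ler_expR.
  have : k%:R * lq <= (ep * ln n%:R / lq + 1) * lq by rewrite ler_pM2r.
  rewrite mulrDl divfK ?gt_eqF //; lra.
have Nle : (n * q ^ k)%:R <= q%:R * n%:R `^ (1 + ep) :> R.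
  rewrite natrM powRD; last by rewrite (gt_eqF nR) implybT.
  rewrite powRr1 ?(ltW nR) //.
  have -> : q%:R * (n%:R * n%:R `^ ep) = n%:R * (q%:R * n%:R `^ ep) by ring.
  by rewrite ler_pM2l.
split => // z hz.
have hh := grid_sum_le E0 c0 qc q2 por k n2 hz.
apply: le_trans hh _.
set N := (n * q ^ k)%N in nle Nle *.
have NR : 0 < N%:R :> R by rewrite ltr0n muln_gt0 n0.
have lnle : 1 + ln n%:R <= (1 + 2 / a) * n%:R `^ (a / 2).
  have P1 : 1 <= n%:R `^ (a / 2).
    by rewrite -[X in X <= _](powRr0 n%:R) ler_powR // divr_ge0 // ltW.
  have := ln_sublinear (lt_le_trans ltr01 P1); rewrite ln_powR => h.
  have : ln n%:R <= 2 / a * n%:R `^ (a / 2).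
    have -> : ln n%:R = 2 / a * (a / 2 * ln n%:R) by field; rewrite gt_eqF.
    by apply: ler_wpM2l (ltW h); apply: divr_ge0 (ltW a0).
  lra.
have kap : (q.-1 ^ k)%:R <= (q ^ k)%:R * n%:R `^ (- a) :> R.
  rewrite !natrX -[q%:R ^+ k]powR_mulrn ?(ltW qR) // -[q.-1%:R ^+ k]powR_mulrn ?(ltW q1R0) //.
  rewrite /powR !gt_eqF // -expRD ler_expR.
  have : ep * ln n%:R / lq * la <= k%:R * la by rewrite ler_pM2r.
  have -> : ep * ln n%:R / lq * la = a * ln n%:R by rewrite /a; field; rewrite gt_eqF.
  rewrite /la mulrBr -/lq; lra.
have a2 : n%:R `^ (- a) * n%:R `^ (a / 2) = n%:R `^ (- (a / 2)).
  rewrite -powRD; last by rewrite (gt_eqF nR) implybT.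
  by congr (_ `^ _); field.
have Ng : N%:R `^ gam <= q%:R `^ gam * n%:R `^ (a / 2).
  apply: (@le_trans _ _ ((q%:R * n%:R `^ (1 + ep)) `^ gam)).
    apply: ge0_ler_powR => //; rewrite ?nnegrE; try exact: ltW.
    exact: mulr_ge0 (ltW qR) (powR_ge0 _ _).
  rewrite powRM ?powR_ge0 ?(ltW qR) // -powRrM.
  have -> : (1 + ep) * gam = a / 2 by rewrite /gam; field; rewrite gt_eqF.
  by [].
have Pg : 0 < N%:R `^ gam :> R by rewrite powR_gt0.
have P2 : 0 < n%:R `^ (a / 2) :> R by rewrite powR_gt0.
have c12 : 0 <= 12 * n%:R :> R by rewrite mulr_ge0.
have aa0 : 0 <= 1 + 2 / a by rewrite addr_ge0 // divr_ge0 // ltW.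
apply: (@le_trans _ _ ((q ^ k)%:R * n%:R `^ (- a) * (12 * n%:R * ((1 + 2 / a) * n%:R `^ (a / 2))))).
  apply: ler_pM => //; first by rewrite mulr_ge0 // addr_ge0.
  by rewrite ler_wpM2l.
have -> : (q ^ k)%:R * n%:R `^ (- a) * (12 * n%:R * ((1 + 2 / a) * n%:R `^ (a / 2))) =
   12 * (1 + 2 / a) * (N%:R * (n%:R `^ (- a) * n%:R `^ (a / 2))).
  by rewrite /N natrM; ring.
rewrite a2 -[X in _ <= X]mulrA; apply: ler_wpM2l; first exact: mulr_ge0.
rewrite powRD; last by rewrite (gt_eqF NR) implybT.
rewrite powRr1 ?(ltW NR) // !powRN mulrCA; apply: ler_wpM2l; first exact: ltW.
by rewrite ler_pdivlMr // mulrC ler_pdivrMr.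
Qed.

End Fine.

(** * Operator norms *)

Section OpNorm.
Variables (R : realType) (X : completeNormedModType R[i]).

Lemma bounded_opP (A : X -> X) :
  bounded_op A <-> exists2 M, 0 <= M & forall x, rnorm (A x) <= M * rnorm x.
Proof.
split=> [[M hM]|[M _ hM]].
  exists `|M| => // x; have := hM x; rewrite !rnormE -rmorphM lecR => h.
  by apply: le_trans h _; rewrite ler_wpM2r ?rnorm_ge0 ?ler_norm.
by exists M => x; rewrite !rnormE -rmorphM lecR.
Qed.

Lemma iter_bounded (A : X -> X) n : bounded_op A -> bounded_op (iter n A).
Proof.
move=> /bounded_opP[M M0 hM]; apply/bounded_opP; exists (M ^+ n); first exact: exprn_ge0.
move=> x; elim: n => [|n ih]; first by rewrite mul1r.
by rewrite iterS exprS -mulrA; apply: le_trans (hM _) _; rewrite ler_wpM2l.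
Qed.

Definition unit_images (A : X -> X) := [set complex.Re `|A x| | x in [set x : X | `|x| <= 1]].

Lemma unit_images_ubound (A : X -> X) M : 0 <= M ->
  (forall x, rnorm (A x) <= M * rnorm x) -> ubound (unit_images A) M.
Proof.
move=> M0 hM _ [x /= hx <-]; move: hx; rewrite rnormE -[1]/(1%:C) lecR => hx.
by apply: le_trans (hM x) _; rewrite -[leRHS]mulr1 ler_wpM2l.
Qed.

Lemma unit_images_nonempty A : unit_images A !=set0.
Proof. by exists (rnorm (A 0)); exists 0 => //=; rewrite normr0. Qed.

Lemma opnorm_le (A : X -> X) M : 0 <= M ->
  (forall x, rnorm (A x) <= M * rnorm x) -> opnorm A <= M.
Proof.
by move=> M0 hM; apply: ge_sup (unit_images_nonempty A) (unit_images_ubound M0 hM).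
Qed.

Lemma le_sup_opnorm (A : X -> X) x : bounded_op A -> rnorm x <= 1 -> rnorm (A x) <= opnorm A.
Proof.
move=> /bounded_opP[M M0 hM] hx; apply: ub_le_sup.
  by exists M; exact: unit_images_ubound.
by exists x => //=; rewrite rnormE -[1]/(1%:C) lecR.
Qed.

Lemma opnorm_ge0 (A : X -> X) : bounded_op A -> 0 <= opnorm A.
Proof.
move=> hA; apply: le_trans (rnorm_ge0 (A 0)) (le_sup_opnorm hA _).
by rewrite rnorm0.
Qed.

Lemma le_opnorm (A : X -> X) x : (forall (c : R[i]) x, A (c *: x) = c *: A x) ->
  bounded_op A -> rnorm (A x) <= opnorm A * rnorm x.
Proof.
move=> hZ hA; have [x0|x0] := eqVneq (rnorm x) 0.
  have /bounded_opP[M _ hM] := hA.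
  by have := hM x; rewrite x0 !mulr0.
have xp : 0 < rnorm x by rewrite lt0r x0 rnorm_ge0.
have := @le_sup_opnorm A ((rnorm x)^-1%:C *: x) hA.
rewrite hZ !rnormZ !rnormR ?invr_ge0 ?rnorm_ge0 // mulVf // => /(_ (lexx _)) h.
by rewrite mulrC -ler_pdivrMl.
Qed.

Lemma opnorm_bigO (A : X -> X) (e : nat -> R) K n0 : 0 <= K -> (forall n, 0 <= e n) ->
  (forall n x, (n0 <= n)%N -> rnorm (iter n A x) <= K * e n * rnorm x) -> bounded_op A ->
  (fun n => opnorm (iter n A)) =O_\oo e.
Proof.
move=> K0 e0 h hA; apply/eqO_exP; exists (K + 1); first by lra.
near=> n; have nn : (n0 <= n)%N by near: n; exact: nbhs_infty_ge.
rewrite !ger0_norm ?opnorm_ge0 //; last exact: iter_bounded.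
apply: (@le_trans _ _ (K * e n)); last by rewrite ler_wpM2r // lerDl.
by apply: opnorm_le => [|x]; [rewrite mulr_ge0 | exact: h].
Unshelve. all: end_near. Qed.

(** Finitely many early terms go into the constant. Two functions are needed because [e] may vanish
    where the operator does not, as n^s does at n = 0 for s > 0. *)
Lemma iter_bigO (A : {linear X -> X}) (e f : nat -> R) : bounded_op A ->
  (forall k, 0 <= e k <= f k) -> (forall k, 0 < f k) ->
  (fun n => opnorm (iter n A)) =O_\oo e ->
  exists2 K, 0 < K & forall k x, rnorm (iter k A x) <= K * f k * rnorm x.
Proof.
move=> hA ef f0 /eqO_exP[c c0 [N _ hN]].
have q0 i : 0 <= opnorm (iter i A) / f i.
  by rewrite divr_ge0 ?(ltW (f0 i)) // opnorm_ge0 //; exact: iter_bounded.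
exists (c + \sum_(i < N) opnorm (iter i A) / f i).
  by rewrite ltr_wpDr // sumr_ge0.
move=> k x; apply: le_trans (le_opnorm x (@iter_linearZ _ _ A k) (iter_bounded k hA)) _.
rewrite ler_wpM2r ?rnorm_ge0 // mulrDl; have [kN|Nk] := ltnP k N.
  rewrite ler_wpDl //; first by rewrite mulr_ge0 // ltW.
  rewrite -ler_pdivrMr // (bigD1 (Ordinal kN)) //= lerDl sumr_ge0 // => i _.
have := hN k Nk; rewrite /= ger0_norm ?opnorm_ge0 //; last exact: iter_bounded.
have /andP[ek0 ek] := ef k; rewrite ger0_norm // => h.
apply: ler_wpDr; first by rewrite mulr_ge0 ?sumr_ge0 // ltW.
by apply: le_trans h _; rewrite ler_wpM2l // ltW.
Qed.

End OpNorm.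

(** * The two choices of scale *)

Lemma below_spectrum (R : realType) (X : completeNormedModType R[i]) (T : {linear X -> X})
    (E : set R[i]) : spectrum T `<=` E -> forall l, ~ E l ->
  exists2 B : R, 0 < B & forall y, rnorm y <= B * rnorm (T y - l *: y).
Proof.
move=> hE l nEl; have /contrapT[B [/bounded_opP[M M0 hM] TB _]] : ~ spectrum T l by move/hE.
exists (M + 1) => [|y]; first by lra.
rewrite -{1}(TB y); apply: le_trans (hM _) _.
by rewrite ler_wpM2r ?rnorm_ge0 // lerDl.
Qed.

(** |z| = 1 - 1/n alone bounds every term by n, a loss that is harmless when N is a large power of
    n. *)
Lemma crude_sum_le (R : realType) n N (Z : seq R[i]) z : (0 < n)%N ->
  (forall w, w \in Z -> rnorm w = 1) -> rnorm z = 1 - n%:R^-1 ->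
  \sum_(w <- Z) (rnorm ((1 + N%:R^-1)%:C - z * w^*%C))^-1 <= n%:R * (size Z)%:R.
Proof.
move=> n0 hZ hz; have -> : n%:R * (size Z)%:R = \sum_(w <- Z) n%:R :> R.
  by rewrite big_const_seq iter_addr_0 count_predT mulr_natr.
rewrite big_seq [leRHS]big_seq; apply: ler_sum => w /hZ hw.
have nR : 0 < n%:R :> R by rewrite ltr0n.
have N0 : 0 <= N%:R^-1 :> R by rewrite invr_ge0.
have h : n%:R^-1 <= rnorm ((1 + N%:R^-1)%:C - z * w^*%C).
  have := rnorm_ge_dist ((1 + N%:R^-1)%:C : R[i]) (z * w^*%C).
  rewrite rnormM rnorm_conj hw hz rnormR; lra.
have S0 : 0 < rnorm ((1 + N%:R^-1)%:C - z * w^*%C) by apply: lt_le_trans h; rewrite invr_gt0.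
by rewrite -[leRHS]invrK lef_pV2 ?posrE ?invr_gt0.
Qed.

Section Stages.
Variables (R : realType) (X : completeNormedModType R[i]) (T Tinv : {linear X -> X}).
Local Notation C := R[i].
Hypotheses (TK : cancel T Tinv) (TinvK : cancel Tinv T).
Variable E : set C.
Hypotheses (E0 : E !=set0) (Ecirc : E `<=` circle (R := R)).
Hypothesis below : forall l : C, rnorm l = 1 -> ~ E l ->
  exists2 B : R, 0 < B & forall y, rnorm y <= B * rnorm (T y - l *: y).
Variables (s C1 C2 beta : R).
Hypotheses (s0 : 0 <= s) (C1_gt0 : 0 < C1) (C2_gt0 : 0 < C2)
  (beta_gt0 : 0 < beta) (beta_lt1 : beta < 1).
Hypotheses (hT : forall k x, rnorm (iter k T x) <= C1 * (1 + k%:R) `^ s * rnorm x)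
  (hTinv : forall k x, rnorm (iter k Tinv x) <= C2 * expR (k%:R `^ beta) * rnorm x).

(** With N = n^b the crude sum is at most n A N^(1 - de) = A N^(1 - (de - 1/b)). So gam = de - 1/b,
    and b is chosen with 1/b < de - beta/(1 - beta). *)
Lemma polynomial_growth (de A : R) : beta / (1 - beta) < de ->
  (forall N, (0 < N)%N -> (size (grid E N))%:R <= A * N%:R `^ (1 - de)) ->
  exists2 p : R, 0 <= p & exists2 K, 0 < K & exists n0, forall n x, (n0 <= n)%N ->
    rnorm (iter n Tinv x) <= K * n%:R `^ p * rnorm x.
Proof.
move=> hde hA.
have d0 : 0 < de - beta / (1 - beta) by rewrite subr_gt0.
have [b0 hb0] := nat_above (de - beta / (1 - beta))^-1.
pose b := b0.+1.
have bV : b%:R^-1 < de - beta / (1 - beta) :> R.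
  rewrite -[ltRHS]invrK ltf_pV2 ?posrE ?ltr0n ?invr_gt0 //.
  by apply: le_lt_trans hb0 _; rewrite ltr_nat.
have hgam : beta / (1 - beta) < de - b%:R^-1 by lra.
have [K K0 [n0 hK]] := @inverse_iter_le _ _ _ _ TK TinvK _ E0 below _ _ _ _ _ A s0 C1_gt0 C2_gt0 beta_gt0 beta_lt1 hgam hT hTinv.
have s20 : 0 <= s + 2^-1 by rewrite addr_ge0 // invr_ge0.
exists (b%:R * (s + 2^-1)); first by rewrite mulr_ge0.
exists K => //; exists (maxn 1 n0) => n x; rewrite geq_max => /andP[n1 nn0].
have N0 : (0 < n ^ b)%N by rewrite expn_gt0 n1.
have nN : (n <= n ^ b)%N by rewrite expnS leq_pmulr // expn_gt0 n1.
have nR : 0 < n%:R :> R by rewrite ltr0n.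
have NE : (n ^ b)%:R = n%:R `^ b%:R :> R by rewrite natrX powR_mulrn // ltW.
have := hK n (n ^ b)%N (grid E (n ^ b)) nn0 nN (@rnorm_grid _ _ _).
rewrite powRrM -NE; apply=> [e Ee|z hz].
  exact: grid_near N0 Ecirc Ee.
apply: le_trans (crude_sum_le _ n1 (@rnorm_grid _ _ _) hz) _.
apply: le_trans (ler_wpM2l (ltW nR) (hA _ N0)) _.
have -> : 1 - (de - b%:R^-1) = b%:R^-1 + (1 - de) :> R by ring.
rewrite [X in _ <= _ * X]powRD; last by rewrite (gt_eqF (_ : 0 < (n ^ b)%:R)) ?implybT ?ltr0n.
have -> : (n ^ b)%:R `^ b%:R^-1 = n%:R :> R.
  by rewrite NE -powRrM divff ?powRr1 ?pnatr_eq0 // ltW.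
by rewrite mulrCA.
Qed.

Lemma sharp_growth (gam Cz A ep : R) : 0 < A -> 0 < ep ->
  beta / (1 - beta) < gam ->
  (forall n, (2 <= n)%N -> exists N, [/\ (n <= N)%N, N%:R <= A * n%:R `^ (1 + ep) &
      forall z, rnorm z = 1 - n%:R^-1 ->
      \sum_(w <- grid E N) (rnorm ((1 + N%:R^-1)%:C - z * w^*%C))^-1 <=
        Cz * N%:R `^ (1 - gam)]) ->
  exists2 K, 0 < K & exists n0, forall n x, (n0 <= n)%N ->
    rnorm (iter n Tinv x) <= K * n%:R `^ ((1 + ep) * (s + 2^-1)) * rnorm x.
Proof.
move=> A0 ep0 hgam hN.
have [K K0 [n0 hK]] := @inverse_iter_le _ _ _ _ TK TinvK _ E0 below _ _ _ _ _ Cz s0 C1_gt0 C2_gt0 beta_gt0 beta_lt1 hgam hT hTinv.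
have s20 : 0 <= s + 2^-1 by rewrite addr_ge0 // invr_ge0.
exists (K * A `^ (s + 2^-1)); first by rewrite mulr_gt0 // powR_gt0.
exists (maxn 2 n0) => n x; rewrite geq_max => /andP[n2 nn0].
have [N [nN Nle hz]] := hN n n2.
have N0 : (0 < N)%N by apply: leq_trans nN; apply: ltnW.
have near e : E e -> exists2 w, w \in grid E N & rnorm (e - w) <= 8 * N%:R^-1.
  exact: grid_near N0 Ecirc.
apply: le_trans (hK n N (grid E N) nn0 nN (@rnorm_grid _ _ _) near hz x) _.
rewrite ler_wpM2r ?rnorm_ge0 // -mulrA ler_wpM2l ?(ltW K0) //.
rewrite [X in _ <= _ * X]powRrM -powRM ?powR_ge0 ?(ltW A0) //.
by rewrite ge0_ler_powR ?nnegrE // mulr_ge0 ?powR_ge0 // ltW.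
Qed.

End Stages.

Lemma deltaE_ge0 (R : realType) (E : set R[i]) : 0 <= deltaE E.
Proof.
rewrite /deltaE; set S := [set _ | _].
have [[[de Sde] ubS]|/sup_out -> //] := pselect (has_sup S).
by apply: le_trans (ub_le_sup ubS Sde); case: Sde.
Qed.

Lemma deltaE_gt (R : realType) (E : set R[i]) (b : R) : 0 <= b -> b < deltaE E ->
  exists de, [/\ 0 <= de, b < de &
    (\int[lebesgue_measure]_(t in `[0%R, (2 * pi)%R])
       ((dist (expi t) E `^ de)%:E)^-1 < +oo)%E].
Proof.
rewrite /deltaE; set S := [set _ | _] => b0 bS.
(* Without a supremum the value would be the default 0, which 0 <= b < sup S excludes. *)
have hS : has_sup S by apply: contrapT => /sup_out e; move: bS; rewrite e ltNge b0.
have [|de [de0 hde] h] := @sup_adherent R S (sup S - b) _ hS; first by rewrite subr_gt0.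
by exists de; split => //; move: h; rewrite subKr.
Qed.

Lemma half_ratio (R : realType) (gam : R) : 0 < gam ->
  exists2 b, 0 < b < 1 & b / (1 - b) < gam.
Proof.
move=> g0; exists (gam / (2 * (1 + gam))).
  by rewrite divr_gt0 ?ltr_pdivrMr ?mul1r ?mulr_gt0; lra.
have -> : gam / (2 * (1 + gam)) / (1 - gam / (2 * (1 + gam))) = gam / (2 + gam).
  by field; rewrite !gt_eqF //=; lra.
by rewrite ltr_pdivrMr; nra.
Qed.

Lemma ler_natr_powR (R : realType) n p q : (0 < n)%N -> p <= q -> n%:R `^ p <= n%:R `^ q :> R.
Proof. by move=> n0 pq; rewrite ler_powR // ler1n. Qed.

Theorem theorem2p3 (R : realType) (E : set R[i]) (hE : Kset E)
    (s : R) (hs : 0 <= s)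
    (X : completeNormedModType R[i]) (T Tinv : {linear X -> X})
    (hT : bounded_op T) (hTinv : inverse_op T Tinv)
    (hspec : spectrum T `<=` E)
    (hpos : (fun n : nat => opnorm (iter n T)) =O_\oo
            (fun n : nat => n%:R `^ s))
    (beta : R) (hbeta : beta < deltaE E / (1 + deltaE E))
    (hneg : (fun n : nat => opnorm (iter n Tinv)) =O_\oo
            (fun n : nat => expR (n%:R `^ beta)))
    (eps : R) (heps : 0 < eps) :
  (fun n : nat => opnorm (iter n Tinv)) =O_\oo
  (fun n : nat => n%:R `^ (s + 2^-1 + eps)).
Proof.
have [bTinv TK TinvK] := hTinv; have [_ Ecirc _] := hE.
have E0 := Kset_nonempty hE.
have exp1 (b : R) k : 0 <= expR (k%:R `^ b) <= expR (k%:R `^ b) by rewrite expR_ge0 lexx.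
have exp0 (b : R) (k : nat) : 0 < expR (k%:R `^ b) by exact: expR_gt0.
have [C2 C20 hC2] := iter_bigO bTinv (exp1 beta) (exp0 beta) hneg.
have s20 : 0 <= s + 2^-1 by lra.
(* For beta <= 0 the hypothesis already bounds T^-n, as n^beta <= 1 for n >= 1; the estimates above
   assume beta > 0. *)
have [b0|b0] := leP beta 0.
  apply: (@opnorm_bigO _ _ _ _ (C2 * expR 1) 1%N) => //.
    by rewrite mulr_ge0 ?expR_ge0 // ltW.
  move=> n x n1; apply: le_trans (hC2 n x) _.
  rewrite ler_wpM2r ?rnorm_ge0 // -[leLHS]mulr1 ler_pM ?mulr_ge0 ?expR_ge0 ?(ltW C20) //.
    by rewrite ler_wpM2l ?(ltW C20) // ler_expR -[leRHS](powRr0 n%:R) ler_natr_powR.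
  by rewrite -[leLHS](powRr0 n%:R) ler_natr_powR //; lra.
have dE : 0 < deltaE E.
  rewrite lt0r deltaE_ge0 andbT; apply: contraTneq hbeta => ->.
  by rewrite mul0r -leNgt ltW.
have b1 : beta < 1.
  by apply: lt_trans hbeta _; rewrite ltr_pdivrMr; lra.
have hb : beta / (1 - beta) < deltaE E.
  by move: hbeta; rewrite ltr_pdivlMr ?ltr_pdivrMr; nra.
have bb0 : 0 <= beta / (1 - beta) by rewrite divr_ge0 ?subr_ge0 // ltW.
have [de [de0 hde intE]] := deltaE_gt bb0 hb.
have [A _ hA] := grid_size_le E0 de0 intE.
have pow1 k : 0 <= k%:R `^ s <= ((1 + k%:R) `^ s : R).
  by rewrite powR_ge0 /= ge0_ler_powR ?nnegrE ?addr_ge0 // lerDr.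
have pow0 (k : nat) : 0 < (1 + k%:R) `^ s :> R by rewrite powR_gt0 // ltr_wpDr.
have [C1 C10 hC1] := iter_bigO hT pow1 pow0 hpos.
have below l (_ : rnorm l = 1) := below_spectrum hspec (l := l).
have [p p0 [K K0 [n0 hK]]] :=
  polynomial_growth TK TinvK E0 Ecirc below hs C10 C20 b0 b1 hC1 hC2 hde hA.
have e0 n : 0 <= n%:R `^ p :> R by exact: powR_ge0.
have hO := opnorm_bigO (ltW K0) e0 (fun n x h => hK n x h) bTinv.
(* Chosen so that (1 + ep)(s + 1/2) = s + 1/2 + eps. *)
pose ep := eps / (s + 2^-1).
have ep0 : 0 < ep by rewrite divr_gt0 //; lra.
have [gam [Cz [A' [g0 Cz0 A'0 fine]]]] := fine_grid E0 hE ep0.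
(* The [gam] of the porous grid may be tiny, but polynomial growth stays below a multiple of
   exp(k^b2) for every b2 > 0, so the estimate applies again with b2 in place of beta. *)
have [b2 /andP[b20 b21] hb2] := half_ratio g0.
have [Ce Ce0 hCe] := @exp_beats R 0 1 0 b2 p (lexx 0) ltr01 (lexx 0) b20 p0.
have ef k : 0 <= k%:R `^ p <= Ce * expR (k%:R `^ b2).
  by rewrite e0 /=; have := hCe _ (ler0n R k); rewrite mul0r expR0 mulr1 mul1r.
have f0 (k : nat) : 0 < Ce * expR (k%:R `^ b2) by rewrite mulr_gt0 ?expR_gt0.
have [C3 C30 hC3] := iter_bigO bTinv ef f0 hO.
have hC3' k x : rnorm (iter k Tinv x) <= C3 * Ce * expR (k%:R `^ b2) * rnorm x.
  by have := hC3 k x; rewrite !mulrA.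
have [K' K'0 [n1 hK']] :=
  sharp_growth TK TinvK E0 Ecirc below hs C10 (mulr_gt0 C30 Ce0) b20 b21 hC1 hC3'
    A'0 ep0 hb2 fine.
apply: (@opnorm_bigO _ _ _ _ K' n1) => //; first exact: ltW.
move=> n x /hK'; rewrite mulrDl mul1r divfK; first exact.
by rewrite gt_eqF //; clear -hs; lra.
Qed.
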